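(* Let $\mathbb{X},\mathbb{Y}\subset\mathbb{C}$ be bounded Lipschitz domains of finite connectivity. Suppose that $h\colon\overline{\mathbb{X}}\to\overline{\mathbb{Y}}$ is a monotone map onto $\overline{\mathbb{Y}}$ of Sobolev class $\mathscr W^{1,2}(\mathbb{X},\mathbb{C})$ with positive Jacobian determinant $\det Dh>0$ almost everywhere in $\mathbb{X}$. Then: (i) the set $\mathbb{Y}_h=\{y\in h(\overline{\mathbb{X}}):h^{-1}(y)\text{ is a single point}\}$ has full measure in $\overline{\mathbb{Y}}$; (ii) there exists a set $\mathbb{X}_h\subset\mathbb{X}$ of full measure in $\mathbb{X}$ such that the restriction of $h$ to $\mathbb{X}_h$ is injective.
   Context: A continuous map $h\colon\overline{\mathbb{X}}\to\overline{\mathbb{Y}}$ is monotone (in the sense of Morrey) if the preimage $h^{-1}(C)$ of every continuum $C\subset\overline{\mathbb{Y}}$ is a continuum in $\overline{\mathbb{X}}$. *)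

(* Defs.v *)
(* The complex plane C is modelled as R * R
   (R : realType), with the product topology and the 2-dimensional
   Lebesgue measure  lebesgue_measure \x lebesgue_measure. *)
From HB Require Import structures.
From mathcomp Require Import all_boot all_order all_algebra.
From mathcomp Require Import all_classical all_reals all_analysis.
Set Implicit Arguments. Unset Strict Implicit. Unset Printing Implicit Defensive.
Import Order.TTheory GRing.Theory Num.Theory.
Import numFieldNormedType.Exports.
Local Open Scope classical_set_scope.
Local Open Scope ring_scope.

Section Defs.
Variable R : realType.
Local Notation pt := (R * R)%type.

Definition leb2 : set pt -> \bar R :=
  (@lebesgue_measure R \x @lebesgue_measure R)%E.

Definition bounded_plane (X : set pt) : Prop :=
  exists M : R, forall x, X x -> `|x.1| <= M /\ `|x.2| <= M.

Definition lipschitz_fun (f : R -> R) : Prop :=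
  exists L : R, forall a b, `|f a - f b| <= L * `|a - b|.

(* bounded Lipschitz domain: a nonempty bounded connected open set whose
   boundary is, near each of its points, after a rotation, the graph of a
   Lipschitz function with the domain lying above the graph. *)
Definition lipschitz_domain (X : set pt) : Prop :=
  [/\ open X, connected X, X !=set0, bounded_plane X &
   forall p, (closure X `\` X) p ->
     exists (r : R) (c s : R) (f : R -> R),
       [/\ 0 < r, c ^+ 2 + s ^+ 2 = 1, lipschitz_fun f &
        forall q : pt, ball p r q ->
          (X q <-> (let u := q.1 - p.1 in let v := q.2 - p.2 in
                    f (c * u + s * v) < - s * u + c * v))]].

Definition finitely_connected (X : set pt) : Prop :=
  finite_set (connected_component (~` X) @` (~` X)).

Definition continuum (C : set pt) : Prop :=
  [/\ compact C, connected C & C !=set0].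

Definition monotone_map (X Y : set pt) (h : pt -> pt) : Prop :=
  [/\ {within closure X, continuous h},
      h @` closure X = closure Y &
      forall C, C `<=` closure Y -> continuum C ->
        continuum (closure X `&` h @^-1` C)].

Fixpoint iter_deriv (ds : seq pt) (phi : pt -> R) : pt -> R :=
  match ds with
  | [::] => phi
  | v :: ds' => fun x => 'D_v (iter_deriv ds' phi) x
  end.

Definition smooth_fun (phi : pt -> R) : Prop :=
  forall ds : seq pt, continuous (iter_deriv ds phi) /\
    forall (v x : pt), derivable (iter_deriv ds phi) x v.

Definition test_fun (X : set pt) (phi : pt -> R) : Prop :=
  smooth_fun phi /\
  exists K : set pt, [/\ compact K, K `<=` X & forall x, ~ K x -> phi x = 0].

Definition L2 (X : set pt) (f : pt -> R) : Prop :=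
  measurable_fun X f /\ (\int[leb2]_(x in X) ((f x) ^+ 2)%:E < +oo)%E.

Definition weak_deriv (X : set pt) (u : pt -> R) (e : pt) (g : pt -> R) :=
  forall phi, test_fun X phi ->
    Rintegral leb2 X (fun x => u x * 'D_e phi x) =
    - Rintegral leb2 X (fun x => g x * phi x).

Definition e1 : pt := (1, 0).
Definition e2 : pt := (0, 1).

Definition sobolev12_pos_jacobian (X : set pt) (h : pt -> pt) : Prop :=
  L2 X (fun x => (h x).1) /\ L2 X (fun x => (h x).2) /\
  exists g11 g12 g21 g22 : pt -> R,
    [/\ [/\ L2 X g11, L2 X g12, L2 X g21 & L2 X g22],
        [/\ weak_deriv X (fun x => (h x).1) e1 g11,
            weak_deriv X (fun x => (h x).1) e2 g12,
            weak_deriv X (fun x => (h x).2) e1 g21 &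
            weak_deriv X (fun x => (h x).2) e2 g22] &
        {ae leb2, forall x, X x -> 0 < g11 x * g22 x - g12 x * g21 x}].

Definition Yh (X : set pt) (h : pt -> pt) : set pt :=
  [set y | (h @` closure X) y /\
           exists x, closure X `&` h @^-1` [set y] = [set x]].

End Defs.

(* Main.v *)
(* A monotone map propagates boundary estimates inwards: if [h] is
   confined to a small square on the frame of a box, then the preimage of the
   complement of a slightly larger square is connected, so [h] maps the whole box
   into a comparable square. A [W^{1,2}] map is absolutely continuous on almost all
   lines of any rotated grid, so choosing good lines by averaging bounds the
   oscillation of [h] on a box of size [d] by the square root of the energy
   [1 + |Dh|^2] of a comparable box. Hence, at points of [X] and, using the Lipschitz
   charts, at points of its boundary, small squares are mapped into squares of area
   at most a constant times their energy, and a covering argument shows that [h]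
   sends null subsets of [X], and the boundary of [X], to null sets.
   Near almost every [x] the matrix [Dh] is close in mean to an invertible matrix
   [A]; then [h - A] oscillates little along good lines of two concentric boxes. The
   fiber through [x] is connected, so if it were not [{x}] it would cross both
   boxes, contradicting the expansion of [A]. *)
Require Import Defs.
From HB Require Import structures.
From mathcomp Require Import all_boot all_order all_algebra.
From mathcomp Require Import all_classical all_reals all_analysis.
From mathcomp Require Import measurable_realfun ring lra zify.
Set Implicit Arguments. Unset Strict Implicit. Unset Printing Implicit Defensive.
Import Order.TTheory GRing.Theory Num.Theory.
Import numFieldNormedType.Exports.
Local Open Scope classical_set_scope.
Local Open Scope ring_scope.

(** * Iterated differentiability *)

Section Ck.
Context {R : realType}.

(** One covering scheme, [null_image], carries the measure theory: a set that is null for a finite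
    density [F] has a null image as soon as small squares about its points are mapped into squares
    whose area is controlled by the [F]-mass of a larger concentric square. Since null means null
    for [F], the boundary of [X] qualifies whenever [F] vanishes off [X]. The scheme is applied to
    [h] with the energy as density, and also to the identity: with [\1_X] it shows that a Lipschitz
    boundary is null, and with the deviation of [Dh] from a fixed matrix it shows that [Dh] is close
    in mean to that matrix near almost every point where it is close. Matrices and tolerances are
    rational, so only countably many exceptional sets occur. The area bound is scale invariant in
    dimension two: Young's inequality bounds the integral of the gradient over a square of size
    [rho] by [rho] times the root of its energy, and good lines are taken from strips of width
    comparable to [rho]. Part (i) rests on the fact behind (ii): a value with several preimages lies
    on the boundary of [Y], or comes from the boundary of [X], or from the null set of points of [X]
    that share their fiber. *)

Fixpoint Ck (V : normedModType R) n (f : V -> R) : Prop :=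
  continuous f /\
  match n with
  | 0 => True
  | m.+1 => (forall x v, derivable f x v) /\ forall v, Ck m (fun x => 'D_v f x)
  end.

Lemma CkS_inv (V : normedModType R) n (f : V -> R) : Ck n.+1 f -> Ck n f.
Proof.
elim: n f => [|n IHn] f [cf [df Df]]; split => //.
by split => // v; apply: IHn; exact: Df.
Qed.

Lemma Ck_cst (V : normedModType R) n (c : R) : Ck n (fun _ : V => c).
Proof.
elim: n c => [|n IHn] c; (split; first by move=> x; exact: cst_continuous) => //.
split => [x v|v]; first exact: derivable_cst.
have -> : (fun x => 'D_v (fun=> c) x) = (fun _ : V => 0 : R).
  by apply/funext => x; exact: derive_cst.
exact: IHn.
Qed.

Lemma CkD (V : normedModType R) n (f g : V -> R) :
  Ck n f -> Ck n g -> Ck n (fun x => f x + g x).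
Proof.
elim: n f g => [|n IHn] f g [cf f'] [cg g'].
  by split => // x; apply: continuousD; [exact: cf|exact: cg].
split; first by move=> x; apply: continuousD; [exact: cf|exact: cg].
case: f' g' => [df Df] [dg Dg]; split => [x v|v]; first exact: derivableD.
have -> : (fun x => 'D_v (fun x => f x + g x) x) =
    (fun x => 'D_v f x + 'D_v g x).
  by apply/funext => x; rewrite (@deriveD _ _ _ f g).
by apply: IHn; [exact: Df|exact: Dg].
Qed.

Lemma CkM (V : normedModType R) n (f g : V -> R) :
  Ck n f -> Ck n g -> Ck n (fun x => f x * g x).
Proof.
elim: n f g => [|n IHn] f g Hf Hg.
  split => // x; apply: continuousM; [exact: Hf.1|exact: Hg.1].
split; first by move=> x; apply: continuousM; [exact: Hf.1|exact: Hg.1].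
have [_ [df Df]] := Hf; have [_ [dg Dg]] := Hg.
split => [x v|v]; first exact: derivableM.
have -> : (fun x => 'D_v (fun x => f x * g x) x) =
    (fun x => f x * 'D_v g x + g x * 'D_v f x).
  by apply/funext => x; rewrite (@deriveM _ _ f g).
by apply: CkD; apply: IHn; [exact: CkS_inv|exact: Dg|exact: CkS_inv|exact: Df].
Qed.

Lemma CkV (V : normedModType R) n (f : V -> R) : (forall x, f x != 0) ->
  Ck n f -> Ck n (fun x => (f x)^-1).
Proof.
move=> f0; elim: n => [|n IHn] Hf.
  by split => // x; apply: continuousV => //; exact: Hf.1.
split; first by move=> x; apply: continuousV => //; exact: Hf.1.
have [_ [df Df]] := Hf.
split => [x v|v]; first exact: derivableV.
have -> : (fun x => 'D_v (fun x => (f x)^-1) x) =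
    (fun x => (-1) * (((f x)^-1 * (f x)^-1) * 'D_v f x)).
  apply/funext => x; rewrite (@deriveV _ _ f)//= /GRing.scale/=.
  by rewrite expr2 invfM; ring.
have H1 := IHn (CkS_inv Hf).
by apply: CkM; [exact: Ck_cst|apply: CkM; [exact: CkM|exact: Df]].
Qed.

(** Stated for the difference quotients themselves, so that one rewriting transfers both
    derivability and the value of the derivative. *)
Lemma derive_comp_linear (V W : normedModType R) (L : V -> W)
    (f : W -> R) (x v : V) :
  (forall k a b, L (k *: a + b) = k *: L a + L b) ->
  (fun h : R => h^-1 *: (((f \o L) \o shift x) (h *: v) - (f \o L) x)) =
  (fun h : R => h^-1 *: ((f \o shift (L x)) (h *: L v) - f (L x))).
Proof. by move=> linL; apply/funext => t /=; rewrite linL. Qed.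

Lemma Ck_comp_linear (V W : normedModType R) (L : V -> W) n (f : W -> R) :
  (forall k a b, L (k *: a + b) = k *: L a + L b) -> continuous L ->
  Ck n f -> Ck n (fun x => f (L x)).
Proof.
move=> linL cL; elim: n f => [|n IHn] f [cf Hf].
  by split => // x; apply: (@continuous_comp _ _ _ L f); [exact: cL|exact: cf].
split; first by move=> x; apply: (@continuous_comp _ _ _ L f); [exact: cL|exact: cf].
case: Hf => df Df; split => [x v|v].
  by rewrite /derivable (derive_comp_linear f _ _ linL); exact: df.
have -> : (fun x => 'D_v (fun x => f (L x)) x) = (fun x => 'D_(L v) f (L x)).
  by apply/funext => x; rewrite /derive (derive_comp_linear f _ _ linL).
by apply: (IHn (fun x => 'D_(L v) f x)); exact: Df.
Qed.

End Ck.

Lemma Ck_smooth_fun (R : realType) (phi : R * R -> R) :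
  (forall n, Ck n phi) -> smooth_fun phi.
Proof.
move=> Hphi.
(* Each derivative costs one order, so the induction on [ds] keeps [n] arbitrary. *)
have H ds n : Ck n (iter_deriv ds phi).
  elim: ds n => [|v ds IH] n; first exact: Hphi.
  by have [_ [_ /(_ v)]] := IH n.+1.
by move=> ds; have [c [d _]] := H ds 1%N; split; [exact: c|move=> v x; exact: d].
Qed.

(** * Smooth steps *)

Section smooth_step.
Context {R : realType}.

(** The powers of [x^-1] are included because differentiation then stays inside the family: the
    derivative of [flat n] is a combination of [flat n.+2] and [flat n.+1]. *)
Definition flat n (x : R) : R := if 0 < x then x^-1 ^+ n * expR (- x^-1) else 0.

Lemma flat_ge0 n x : 0 <= flat n x.
Proof.
rewrite /flat; case: ifPn => // x0.
by rewrite mulr_ge0 ?expR_ge0// exprn_ge0// invr_ge0 ltW.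
Qed.

(** One term of the exponential series at [x^-1] suffices. The quadratic decay makes the difference
    quotient at 0 vanish. *)
Lemma flat_le n x : flat n x <= (n.+2)`!%:R * x ^+ 2.
Proof.
rewrite /flat; case: ifPn => x0; last by rewrite mulr_ge0// sqr_ge0.
rewrite expRN -[leRHS]mulr1 -[X in _ <= _ * X](@mulVf _ (expR x^-1)) ?gt_eqF ?expR_gt0//.
rewrite mulrA [leRHS]mulrAC ler_wpM2r ?invr_ge0 ?expR_ge0//.
have x0' : 0 < x^-1 by rewrite invr_gt0.
have H := @expR_ge1Dxn R x^-1 n.+1 (ltW x0').
have {}H : x^-1 ^+ n.+2 / n.+2`!%:R <= expR x^-1.
  by apply: le_trans H; rewrite lerDr.
have F0 : (0 : R) < n.+2`!%:R by rewrite ltr0n fact_gt0.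
rewrite ler_pdivrMr// in H.
rewrite mulrAC [X in X * _]mulrC -ler_pdivrMr ?exprn_gt0//.
by rewrite -exprVn -exprD addn2.
Qed.

Lemma is_derive_flat n x :
  is_derive x (1 : R) (flat n) (flat n.+2 x - n%:R * flat n.+1 x).
Proof.
have [x0|x0|->] := ltgtP x 0.
- apply: (@near_eq_is_derive _ _ _ (cst 0)); last first.
    rewrite /flat !ltNge (ltW x0)/= mulr0 subr0; exact: is_derive_cst.
  near=> y; rewrite /flat ltNge; suff -> : y <= 0 by [].
  by near: y; exact: lt_le_nbhsl.
- apply: (@near_eq_is_derive _ _ _
    ((fun y => y^-1 ^+ n) * (expR \o (fun y : R => - y^-1)))).
    by near=> y; rewrite /flat ifT//; near: y; exact: lt_nbhsr.
  have xn0 : x != 0 by rewrite gt_eqF.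
  have iV : is_derive x (1 : R) (fun y : R => y^-1) (- x ^- 2).
    by rewrite -[- x ^- 2]mulr1; exact: is_deriveV.
  have iE : is_derive x (1 : R) (expR \o (fun y : R => - y^-1))
      (expR (- x^-1) * (- - x ^- 2)).
    by apply: (@is_derive1_comp _ expR (fun y => - y^-1)); exact: is_deriveN.
  have iX : is_derive x (1 : R) ((fun y : R => y^-1) ^+ n)
      (n%:R * x^-1 ^+ n.-1 * - x ^- 2).
    case: n => [|n]; last exact: (@is_deriveX _ _ (fun y : R => y^-1)).
    by rewrite expr0 mul0r mul0r; exact: is_derive_cst.
  have -> : (fun y : R => y^-1 ^+ n) = (fun y : R => y^-1) ^+ n.
    by apply/funext => y; rewrite exprfctE.
  apply: is_derive_eq => /=.
  rewrite /flat x0 /= /GRing.scale/= exprfctE.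
  case: n iX => [|n] _; first by rewrite mul0r !expr0; field.
  by rewrite /= !exprS; field.
- have f0 m : flat m 0 = 0 by rewrite /flat ltxx.
  rewrite !f0 mulr0 subr0.
  suff H : h^-1 *: ((flat n \o shift 0) (h *: (1 : R)) - flat n 0)
      @[h --> 0^'] --> (0 : R).
    apply: DeriveDef; first by apply/cvg_ex; exists 0.
    exact/cvg_lim.
  apply/cvgr0Pnorm_lt => e e0; near=> h.
  rewrite /= addr0 f0 subr0 /GRing.scale/= mulr1 normrM normfV.
  have h0 : h != 0 by near: h; exact: nbhs_dnbhs_neq.
  rewrite mulrC ltr_pdivrMr ?normr_gt0// ger0_norm ?flat_ge0//.
  apply: le_lt_trans (flat_le n h) _.
  rewrite -normr_id -real_normK ?num_real// expr2 normr_id mulrA ltr_pM2r ?normr_gt0//.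
  rewrite mulrC -ltr_pdivlMr ?ltr0n ?fact_gt0//.
  near: h; apply: dnbhs0_lt; rewrite divr_gt0// ltr0n fact_gt0//.
Unshelve. all: end_near.
Qed.

Lemma derive_scale (f : R -> R) (x df v : R) : is_derive x (1 : R) f df ->
  is_derive x v f (v * df).
Proof.
move=> [d1 d2]; have df1 : differentiable f x by exact/derivable1_diffP.
apply: DeriveDef; first exact: diff_derivable.
rewrite deriveE//; have -> : 'd f x v = 'd f x (v *: (1 : R)).
  by rewrite /GRing.scale/= mulr1.
by rewrite linearZ -deriveE// d2.
Qed.

Lemma is_derive_continuous (f f' : R -> R) :
  (forall x, is_derive x (1 : R) f (f' x)) -> continuous f.
Proof.
move=> H x; apply: differentiable_continuous; apply/derivable1_diffP.
by have [] := H x.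
Qed.

Lemma Ck_is_derive n (f f' : R -> R) :
  (forall x, is_derive x (1 : R) f (f' x)) -> Ck n f' -> Ck n.+1 f.
Proof.
move=> H Hf'; split; first exact: is_derive_continuous H.
split => [x v|v]; first by have [] := derive_scale v (H x).
have -> : (fun x => 'D_v f x) = (fun x => v * f' x).
  by apply/funext => x; have [] := derive_scale v (H x).
by apply: CkM => //; exact: Ck_cst.
Qed.

Lemma Ck_flat m n : Ck m (flat n).
Proof.
elim: m n => [|m IHm] n.
  by split => //; exact: is_derive_continuous (is_derive_flat n).
apply: Ck_is_derive (is_derive_flat n) _; apply: CkD => //.
have -> : (fun x => - (n%:R * flat n.+1 x)) = (fun x => - n%:R * flat n.+1 x).
  by apply/funext => x; rewrite mulNr.
by apply: CkM => //; exact: Ck_cst.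
Qed.

Lemma Ck_comp_affine n (f : R -> R) (a b : R) : Ck n f ->
  Ck n (fun x => f (a * x + b)).
Proof.
elim: n f => [|n IHn] f Hf.
  split => // x; apply: continuous_comp; last exact: Hf.1.
  apply: continuousD; last exact: cst_continuous.
  by apply: continuousM => //; exact: cst_continuous.
have [cf [df Df]] := Hf.
apply: (@Ck_is_derive n (fun x => f (a * x + b)) (fun x => 'D_1 f (a * x + b) * a)) => [x|].
  have Hd : is_derive (a * x + b) (1 : R) f ('D_1 f (a * x + b)).
    by apply: DeriveDef => //; exact: df.
  apply: (@is_derive1_comp _ f (fun x => a * x + b)) => //.
  have Ha := is_deriveD (is_deriveZ a (is_derive_id x (1 : R)))
    (is_derive_cst b x 1).
  by apply: is_derive_eq Ha _; rewrite addr0 /GRing.scale/= mulr1.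
apply: CkM; last exact: Ck_cst.
by apply: (IHn ('D_1 f)); exact: Df.
Qed.

(** The usual quotient of flat functions; [1 - x] is written in the affine form that
    [Ck_comp_affine] expects. *)
Definition sstep (x : R) := flat 0 x / (flat 0 x + flat 0 (- 1 * x + 1)).

Lemma flat0_gt0 (x : R) : 0 < x -> 0 < flat 0 x.
Proof. by move=> x0; rewrite /flat x0 expr0 mul1r expR_gt0. Qed.

Lemma flat_le0 n (x : R) : x <= 0 -> flat n x = 0.
Proof. by rewrite /flat ltNge => ->. Qed.

Lemma sstep_denom (x : R) : 0 < flat 0 x + flat 0 (- 1 * x + 1).
Proof.
have [x0|x0] := ltP 0 x.
  by rewrite ltr_wpDr ?flat_ge0// flat0_gt0.
by rewrite ltr_wpDl ?flat_ge0// flat0_gt0//; lra.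
Qed.

Lemma Ck_sstep n : Ck n sstep.
Proof.
apply: CkM; first exact: Ck_flat.
apply: CkV => [x|]; first by rewrite gt_eqF// sstep_denom.
apply: CkD; first exact: Ck_flat.
by apply: (@Ck_comp_affine _ _ (-1) 1); exact: Ck_flat.
Qed.

Lemma sstep0 (x : R) : x <= 0 -> sstep x = 0.
Proof. by move=> x0; rewrite /sstep flat_le0// mul0r. Qed.

Lemma sstep1 (x : R) : 1 <= x -> sstep x = 1.
Proof.
move=> x1; have := sstep_denom x.
rewrite /sstep (@flat_le0 0 (-1 * x + 1)); last by lra.
by rewrite addr0 => H; rewrite divff// gt_eqF.
Qed.

Lemma sstep_ge0 (x : R) : 0 <= sstep x.
Proof. by rewrite /sstep divr_ge0 ?flat_ge0// ltW// sstep_denom. Qed.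

Lemma sstep_le1 (x : R) : sstep x <= 1.
Proof.
by rewrite /sstep ler_pdivrMr ?sstep_denom// mul1r lerDl flat_ge0.
Qed.

Lemma is_derive_sstep (x : R) : is_derive x (1 : R) sstep ('D_1 sstep x).
Proof. by have [_ [d _]] := Ck_sstep 1; apply: DeriveDef. Qed.

Lemma continuous_Dsstep : continuous ('D_1 sstep : R -> R).
Proof. by have [_ [_ /(_ 1) []]] := Ck_sstep 1. Qed.

End smooth_step.

(** * Planar Lebesgue measure and rotations *)

Section leb2_measure.
Context {R : realType}.
Local Notation pt := (R * R)%type.
Local Notation mu := (@lebesgue_measure R).
Local Notation lam2 := (@leb2 R).

Let leb2_0 : lam2 set0 = 0%E.
Proof. exact: (@measure0 _ _ _ (mu \x mu)%E). Qed.

Let leb2_ge0 (A : set pt) : (0 <= lam2 A)%E.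
Proof. exact: (@measure_ge0 _ _ _ (mu \x mu)%E). Qed.

Let leb2_sigma_additive : semi_sigma_additive (lam2).
Proof. exact: (@measure_semi_sigma_additive _ _ _ (mu \x mu)%E). Qed.

HB.instance Definition _ := isMeasure.Build _ pt R (lam2)
  leb2_0 leb2_ge0 leb2_sigma_additive.

Lemma leb2_setX (A B : set R) : measurable A -> measurable B ->
  lam2 (A `*` B) = (mu A * mu B)%E.
Proof. exact: (@product_measure1E _ _ _ _ R mu mu). Qed.

Let leb2_sigma_finite : sigma_finite setT (lam2).
Proof.
have /sigma_finiteP[F [TF ndF Foo]] := sigma_finiteT mu.
exists (fun n => F n `*` F n).
  apply/seteqP; split => // -[x y] _.
  have [n _ Fx] : (\bigcup_i F i) x by rewrite -TF.
  have [m _ Fy] : (\bigcup_i F i) y by rewrite -TF.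
  exists (maxn n m) => //; split => /=.
    by move: x Fx; exact/subsetPset/ndF/leq_maxl.
  by move: y Fy; exact/subsetPset/ndF/leq_maxr.
move=> n; have [mF Fn] := Foo n; split; first exact: measurableX.
by rewrite leb2_setX// lte_mul_pinfty// ge0_fin_numE.
Qed.

HB.instance Definition _ := Measure_isSigmaFinite.Build _ pt R (lam2)
  leb2_sigma_finite.

Lemma leb2E (A : set pt) : lam2 A = (\int[mu]_x mu (xsection A x))%E.
Proof. by []. Qed.

(** Slicing in either order gives the same values on rectangles, and these determine the product
    measure. *)
Lemma leb2_ysection (A : set pt) : measurable A ->
  lam2 A = (\int[mu]_y mu (ysection A y))%E.
Proof.
have H := @product_measure_unique _ _ _ _ R mu mu (mu \x^ mu)%E.
by apply: H => B C mB mC; exact: product_measure2E.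
Qed.

(* The library integrates against [mu \x mu] on a copy of [R] whose measurable
   structure is not convertible to that of [R] (although the measurable sets
   are); integrals are transported along the identity. *)
Let mpt := (measurableTypeR R * measurableTypeR R)%type.
Let idpt : mpt -> pt := idfun.

Let measurable_idpt : measurable_fun [set: mpt] idpt.
Proof. by move=> _ A mA; rewrite setTI; exact: mA. Qed.

Lemma ge0_integral_leb2E (f : pt -> \bar R) : measurable_fun setT f ->
  (forall z, 0 <= f z)%E ->
  (\int[lam2]_z f z = \int[(mu \x mu)%E]_z f z)%E.
Proof.
move=> mf f0.
have := @ge0_integral_pushforward _ _ mpt pt R idpt measurable_idpt (mu \x mu)%E
  setT f measurableT mf.
rewrite preimage_setT => <-; last by move=> y _; exact: f0.
by apply: eq_measure_integral.
Qed.

Lemma integrable_leb2E (f : pt -> \bar R) : lam2.-integrable setT f ->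
  (mu \x mu)%E.-integrable [set: mpt] f.
Proof.
move=> /integrableP[mf fi]; apply/integrableP; split; first by [].
rewrite -ge0_integral_leb2E//.
exact: measurableT_comp.
Qed.

Lemma integral_leb2E (f : pt -> \bar R) : lam2.-integrable setT f ->
  (\int[lam2]_z f z = \int[(mu \x mu)%E]_z f z)%E.
Proof.
move=> fi; have mf := measurable_int lam2 fi.
rewrite integralE [RHS]integralE -!ge0_integral_leb2E//.
  exact: measurable_funeneg.
exact: measurable_funepos.
Qed.

Lemma leb2_tonelli_y (f : pt -> \bar R) : measurable_fun setT f ->
  (forall z, 0 <= f z)%E ->
  (\int[lam2]_z f z = \int[mu]_y \int[mu]_x f (x, y))%E.
Proof.
move=> mf f0; rewrite ge0_integral_leb2E//.
exact: (@fubini_tonelli2 _ _ _ _ R mu mu f mf f0).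
Qed.

Lemma measurable_tonelli_y (f : pt -> \bar R) : measurable_fun setT f ->
  (forall z, 0 <= f z)%E ->
  measurable_fun setT (fun y => \int[mu]_x f (x, y))%E.
Proof.
by move=> mf f0; exact: (@measurable_fun_fubini_tonelli_G _ _ _ _ R mu f mf f0).
Qed.

Lemma leb2_fubini_y (f : pt -> \bar R) : lam2.-integrable setT f ->
  (\int[lam2]_z f z = \int[mu]_y \int[mu]_x f (x, y))%E.
Proof.
move=> fi; rewrite integral_leb2E//; have fi' := integrable_leb2E fi.
by apply/esym; exact: (@integral21_prod_meas1 _ _ _ _ R mu mu f fi').
Qed.

Lemma ae_integrable_fubini_y (f : pt -> \bar R) : lam2.-integrable setT f ->
  {ae mu, forall y, mu.-integrable setT (fun x => f (x, y))}.
Proof.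
by move=> /integrable_leb2E fi; exact: (@ae_integrable2 _ _ _ _ R mu mu f fi).
Qed.

Lemma measurable_fubini_y (f : pt -> \bar R) : lam2.-integrable setT f ->
  measurable_fun setT (fun y => \int[mu]_x f (x, y))%E.
Proof.
by move=> /integrable_leb2E fi; exact: (@measurable_fubini_G _ _ _ _ R mu mu f fi).
Qed.

End leb2_measure.

(** * Borel sets of the plane and invariance of the measure under rotations *)

Section plane_measure.
Context {R : realType}.
Local Notation pt := (R * R)%type.
Local Notation mu := (@lebesgue_measure R).
Local Notation lam2 := (@leb2 R).

(** Measurable sets of [R * R] form the product sigma-algebra, so [U] is written as a countable
    union of boxes: those with rational centre and radius [n.+1%:R^-1] that lie in [U]. *)
Lemma open_measurable2 (U : set pt) : open U -> measurable U.
Proof.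
move=> oU.
pose B (q : rat * rat * nat) : set pt :=
  ball (ratr q.1.1 : R) q.2.+1%:R^-1 `*` ball (ratr q.1.2 : R) q.2.+1%:R^-1.
have mB q : measurable (B q) by apply: measurableX; apply: open_measurable; exact: ball_open.
suff -> : U = \bigcup_(q in [set q | B q `<=` U]) B q.
  rewrite bigcup_mkcond; apply: countable_bigcupT_measurable => [|q]; first exact: countableP.
  by case: ifPn.
apply/seteqP; split => [[x y] Uxy|z [q /= BU]]; last exact: BU.
have : nbhs (x, y) U by exact: oU.
case/nbhs_ballP => e /= e0 xyU.
have [n ne] : exists n, n.+1%:R^-1 < e / 2.
  have := near_infty_natSinv_lt (PosNum (divr_gt0 e0 (ltr0Sn R 1))).
  by case=> n _ /(_ n (leqnn n)) /=; exists n.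
have n0 : (0 : R) < n.+1%:R^-1 by rewrite invr_gt0.
have [d dE] : exists d : R, d = n.+1%:R^-1 by exists n.+1%:R^-1.
rewrite -dE in ne n0.
have rQ (t : R) : exists q : rat, `|t - ratr q| < d.
  have : t - d < t + d by lra.
  case/rat_in_itvoo => q; rewrite in_itv/= => /andP[? ?].
  by exists q; rewrite ltr_norml; lra.
have [p xp] := rQ x; have [q yq] := rQ y.
exists (p, q, n); last by split; rewrite /= -dE /ball/= distrC.
move=> [a b] [/=]; rewrite -dE => Ba Bb; apply: xyU; split.
- rewrite /= /ball /= in Ba *.
  rewrite (_ : x - a = (x - ratr p) + (ratr p - a)); last by ring.
  by apply: le_lt_trans (ler_normD _ _) _; lra.
- rewrite /= /ball /= in Bb *.
  rewrite (_ : y - b = (y - ratr q) + (ratr q - b)); last by ring.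
  by apply: le_lt_trans (ler_normD _ _) _; lra.
Qed.

Lemma closed_measurable2 (U : set pt) : closed U -> measurable U.
Proof.
by move=> cU; rewrite -(setCK U); apply: measurableC; apply: open_measurable2; exact: closed_openC.
Qed.

Lemma lebesgue_measure_translate (a : R) (A : set R) : measurable A ->
  mu ((fun y : R => y + a) @^-1` A) = mu A.
Proof.
have mphi : measurable_fun [set: R] (fun y : R => y + a).
  exact: measurable_funD.
pose phi : {mfun R >-> R} := HB.pack (fun y : R => y + a)
   (isMeasurableFun.Build _ _ _ _ _ mphi).
have H : forall X, ocitv X -> @lebesgue_measure R X = pushforward mu (phi : _ -> measurableTypeR R) X.
  move=> _ [[u v]] _ <-.
  rewrite /pushforward (_ : _ @^-1` _ = `]u - a, v - a]%classic).
    rewrite !lebesgue_measure_itv/= !lte_fin ltrD2r.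
    by case: ifPn => // _; rewrite -!EFinB; congr (_%:E); ring.
  by apply/seteqP; split => x /=; rewrite !in_itv/= => /andP[? ?]; apply/andP; split; lra.
by move=> mA; apply/esym; have := lebesgue_measure_unique H mA; apply.
Qed.

Definition preserves_leb2 (T : pt -> pt) :=
  measurable_fun setT T /\
  forall A, measurable A -> lam2 (T @^-1` A) = lam2 A.

Lemma preserves_leb2_comp (T S : pt -> pt) :
  preserves_leb2 T -> preserves_leb2 S -> preserves_leb2 (T \o S).
Proof.
move=> [mT pT] [mS pS]; split; first exact: measurableT_comp.
move=> A mA; rewrite comp_preimage pS ?pT//.
by rewrite -[X in measurable X]setTI; exact: mT.
Qed.

Lemma measurable_affine_pair (a b c d : R) :
  measurable_fun setT (fun z : pt => (a * z.1 + b * z.2, c * z.1 + d * z.2)).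
Proof.
by apply: measurable_fun_pair; apply: measurable_funD; apply: measurable_funM.
Qed.

(** Each vertical section is merely translated, so the measures of the sections agree. *)
Lemma preserves_leb2_shear2 (k : R) :
  preserves_leb2 (fun z => (1 * z.1 + 0 * z.2, k * z.1 + 1 * z.2)).
Proof.
split; first exact: measurable_affine_pair.
move=> A mA; rewrite !leb2E; apply: eq_integral => x _ /=.
rewrite -[RHS](@lebesgue_measure_translate (k * x)); last exact: measurable_xsection.
congr (mu _); apply/seteqP; split => y /=; rewrite /xsection/= !inE/=;
  by rewrite !mul1r mul0r addr0 addrC.
Qed.

Lemma preserves_leb2_shear1 (k : R) :
  preserves_leb2 (fun z => (1 * z.1 + k * z.2, 0 * z.1 + 1 * z.2)).
Proof.
split; first exact: measurable_affine_pair.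
move=> A mA.
rewrite !leb2_ysection//; last first.
  rewrite -[X in measurable X]setTI; exact: measurable_affine_pair.
apply: eq_integral => y _ /=.
rewrite -[RHS](@lebesgue_measure_translate (k * y)); last exact: measurable_ysection.
congr (mu _); apply/seteqP; split => x /=; rewrite /ysection/= !inE/=;
  by rewrite !mul1r mul0r add0r.
Qed.

Definition rot (c s : R) (z : pt) : pt := (c * z.1 - s * z.2, s * z.1 + c * z.2).

Lemma measurable_rot c s : measurable_fun setT (rot c s).
Proof.
have -> : rot c s = (fun z : pt => (c * z.1 + (- s) * z.2, s * z.1 + c * z.2)).
  by apply/funext => z; rewrite /rot mulNr.
exact: measurable_affine_pair.
Qed.

(* A rotation is a product of three shears, unless it is a half-turn, which is
   the square of a quarter-turn. *)
Lemma preserves_leb2_rot (c s : R) : c ^+ 2 + s ^+ 2 = 1 ->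
  preserves_leb2 (rot c s).
Proof.
have gen (c' s' : R) : c' != -1 -> c' ^+ 2 + s' ^+ 2 = 1 -> preserves_leb2 (rot c' s').
  move=> c1 cs; have c10 : 1 + c' != 0 by rewrite addrC -subr_eq0 opprK in c1 *.
  (* For the rotation by [theta] this is [- tan (theta / 2)], which is finite except for the
     half-turn. *)
  pose t := - (s' / (1 + c')).
  have := preserves_leb2_comp (preserves_leb2_shear1 t)
    (preserves_leb2_comp (preserves_leb2_shear2 s') (preserves_leb2_shear1 t)).
  congr preserves_leb2; apply/funext => z /=; rewrite /rot /t.
  have s2 : s' ^+ 2 = (1 - c') * (1 + c').
    by rewrite -[s' ^+ 2](addKr (c' ^+ 2)) cs; ring.
  have st : s' * (s' / (1 + c')) = 1 - c'.
    by rewrite mulrA -expr2 s2 mulfK.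
  have stt : s' / (1 + c') * (s' * (s' / (1 + c'))) = s' / (1 + c') * (1 - c').
    by rewrite st.
  have e : s' / (1 + c') * (1 + c') = s' by rewrite mulfVK.
  set w := s' / (1 + c') in st stt e *.
  have e2 : w * c' = s' - w by rewrite -[in RHS]e; ring.
  congr pair.
    transitivity ((1 - s' * w) * z.1 + (w * (s' * w) - 2 * w) * z.2); first by ring.
    by rewrite stt st; rewrite mulrBr e2; ring.
  transitivity (s' * z.1 + (1 - s' * w) * z.2); first by ring.
  by rewrite st; ring.
move=> cs; have [c1|] := eqVneq c (-1); last by move=> ?; exact: gen.
have s0 : s = 0.
  by apply/eqP; rewrite -sqrf_eq0; apply/eqP; move: cs; rewrite c1; lra.
have q : preserves_leb2 (rot 0 1).
  by apply: gen; [rewrite eq_sym oppr_eq0 oner_eq0|rewrite expr0n expr1n add0r].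
have := preserves_leb2_comp q q.
congr preserves_leb2; apply/funext => z /=; rewrite /rot /= c1 s0.
by congr pair; ring.
Qed.

Lemma ge0_integral_preserves (T : pt -> pt) (D : set pt) (f : pt -> \bar R) :
  preserves_leb2 T -> measurable D -> measurable_fun D f ->
  (forall x, D x -> 0 <= f x)%E ->
  (\int[lam2]_(x in T @^-1` D) f (T x) = \int[lam2]_(x in D) f x)%E.
Proof.
move=> [mT pT] mD mf f0.
pose T' : {mfun pt >-> pt} := HB.pack T (isMeasurableFun.Build _ _ _ _ _ mT).
transitivity (\int[pushforward lam2 T']_(x in D) f x)%E.
  by rewrite ge0_integral_pushforward// => y; rewrite inE; exact: f0.
have H := @eq_measure_integral _ pt R D lam2 (pushforward lam2 T') f.
by apply: H => A mA _; exact: pT.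
Qed.

Lemma integrable_preserves (T : pt -> pt) (D : set pt) (f : pt -> \bar R) :
  preserves_leb2 T -> measurable D -> lam2.-integrable D f ->
  lam2.-integrable (T @^-1` D) (f \o T).
Proof.
move=> pT mD /integrableP[mf fi]; apply/integrableP.
have mTD : measurable (T @^-1` D) by rewrite -[X in measurable X]setTI; exact: pT.1.
split.
  apply: (measurable_comp mD _ mf) => //; first by move=> _ [x Dx <-].
  exact: measurable_funTS pT.1.
rewrite (ge0_integral_preserves (f := fun x => `|f x|%E))//.
by exact: measurableT_comp.
Qed.

Lemma integral_preserves (T : pt -> pt) (D : set pt) (f : pt -> \bar R) :
  preserves_leb2 T -> measurable D -> lam2.-integrable D f ->
  (\int[lam2]_(x in T @^-1` D) f (T x) = \int[lam2]_(x in D) f x)%E.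
Proof.
move=> pT mD fi; have mf := measurable_int lam2 fi.
rewrite integralE [RHS]integralE; congr (_ - _)%E.
  rewrite -(ge0_integral_preserves pT mD (measurable_funepos mf))//.
  by apply: eq_integral => x _; rewrite !funeposE.
rewrite -(ge0_integral_preserves pT mD (measurable_funeneg mf))//.
by apply: eq_integral => x _; rewrite !funenegE.
Qed.

End plane_measure.

(** * Monotone maps and squares *)

Section squares.
Context {R : realType}.
Local Notation pt := (R * R)%type.
Implicit Types (x y z eta : pt) (d e : R).

Definition csquare eta d : set pt :=
  [set z | `|z.1 - eta.1| <= d /\ `|z.2 - eta.2| <= d].
Definition osquare eta d : set pt :=
  [set z | `|z.1 - eta.1| < d /\ `|z.2 - eta.2| < d].

Lemma osquareE eta d : osquare eta d = ball eta d.
Proof.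
by apply/seteqP; split => z [/= h1 h2]; split; rewrite /= /ball /= distrC in h1 h2 *;
  rewrite // distrC.
Qed.

Lemma open_osquare eta d : open (osquare eta d).
Proof. by rewrite osquareE; exact: ball_open. Qed.

Lemma csquareE eta d :
  csquare eta d = `[eta.1 - d, eta.1 + d] `*` `[eta.2 - d, eta.2 + d].
Proof.
by apply/seteqP; split => z; rewrite /csquare /setX/= !in_itv/= !ler_distl => -[-> ->].
Qed.

Lemma compact_csquare eta d : compact (csquare eta d).
Proof. by rewrite csquareE; apply: compact_setX; exact: segment_compact. Qed.

Lemma closed_csquare eta d : closed (csquare eta d).
Proof.
apply: compact_closed; last exact: compact_csquare.
exact: norm_hausdorff.
Qed.

Lemma csquare_subset x y d e : `|x.1 - y.1| + d <= e -> `|x.2 - y.2| + d <= e ->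
  csquare x d `<=` csquare y e.
Proof.
move=> h1 h2 z [z1 z2]; split.
  rewrite (_ : z.1 - y.1 = (z.1 - x.1) + (x.1 - y.1)); last by ring.
  by rewrite (le_trans (ler_normD _ _))//; lra.
rewrite (_ : z.2 - y.2 = (z.2 - x.2) + (x.2 - y.2)); last by ring.
by rewrite (le_trans (ler_normD _ _))//; lra.
Qed.

Lemma csquare_le x d e : d <= e -> csquare x d `<=` csquare x e.
Proof. by move=> de; apply: csquare_subset; rewrite subrr normr0 add0r. Qed.

Lemma csquare_center x d : 0 <= d -> csquare x d x.
Proof. by move=> d0; split; rewrite subrr normr0. Qed.

Lemma measurable_csquare x d : measurable (csquare x d).
Proof. by rewrite csquareE; exact: measurableX. Qed.

Lemma leb2_csquare x d : 0 <= d -> leb2 (csquare x d) = (4 * d ^+ 2)%:E.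
Proof.
move=> d0; rewrite csquareE leb2_setX//.
have H (a : R) : lebesgue_measure `[a - d, a + d] = (2 * d)%:E.
  rewrite lebesgue_measure_itv/= lte_fin; case: ltP => h.
    by rewrite -EFinB; congr (_%:E); ring.
  by congr (_%:E); lra.
by rewrite !H -EFinM; congr (_%:E); ring.
Qed.

Lemma nbhs_osquare x (U : set pt) : nbhs x U <-> exists2 e, 0 < e & osquare x e `<=` U.
Proof.
split=> [/nbhs_ballP[e /= e0 H]|[e e0 H]]; first by exists e => //; rewrite osquareE.
by apply/nbhs_ballP; exists e => //; rewrite -osquareE.
Qed.

Lemma open_csquare (U : set pt) x : open U -> U x ->
  exists2 e, 0 < e & csquare x e `<=` U.
Proof.
move=> oU Ux; have /nbhs_osquare[e e0 H] : nbhs x U by exact: oU.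
exists (e / 2); first by lra.
by move=> z [z1 z2]; apply: H; split; lra.
Qed.

Lemma bounded_plane_closure (X : set pt) : bounded_plane X ->
  exists2 M, 0 < M & closure X `<=` csquare (0, 0) M.
Proof.
move=> [M HM]; exists (`|M| + 1); first by rewrite ltr_wpDl.
have : X `<=` csquare (0, 0) (`|M| + 1).
  move=> x /HM[h1 h2]; split; rewrite /= subr0.
    by have := ler_norm M; lra.
  by have := ler_norm M; lra.
move=> /closureS H; apply: (subset_trans H).
by have /closure_id <- := @closed_csquare (0, 0) (`|M| + 1).
Qed.

Lemma bounded_plane_compact (X : set pt) : bounded_plane X -> compact (closure X).
Proof.
move=> /bounded_plane_closure[M M0 XM].
by apply: subclosed_compact XM; [exact: closed_closure|exact: compact_csquare].
Qed.

Lemma connected_segment_image (f : R -> pt) (a b : R) :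
  continuous f -> connected (f @` `[a, b]).
Proof.
move=> cf; apply: connected_continuous_connected; first exact: segment_connected.
exact: continuous_subspaceT.
Qed.

Definition sphere eta d : set pt := csquare eta d `\` osquare eta d.

(** The edges come in cyclic order, so that each one meets the union of its predecessors in a
    corner; connectedness is proved along this order. *)
Lemma sphereE eta d : 0 <= d -> sphere eta d =
  ((fun t => (t, eta.2 + d)) @` `[eta.1 - d, eta.1 + d]) `|`
  ((fun t => (eta.1 + d, t)) @` `[eta.2 - d, eta.2 + d]) `|`
  ((fun t => (t, eta.2 - d)) @` `[eta.1 - d, eta.1 + d]) `|`
  ((fun t => (eta.1 - d, t)) @` `[eta.2 - d, eta.2 + d]).
Proof.
move=> d0; apply/seteqP; split => [[a b]|z].
  rewrite /sphere csquareE /osquare /= !in_itv/= => -[[a1 b1] ab].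
  have [ad|ad] := ltP `|a - eta.1| d; last first.
    have /orP[/eqP ae|/eqP ae] : (a == eta.1 - d) || (a == eta.1 + d).
    - move: ad; rewrite ler_normr => /orP[ad|ad]; apply/orP; [right|left]; apply/eqP; lra.
    - by right; exists b; rewrite ?in_itv//= -ae.
    - by left; left; right; exists b; rewrite ?in_itv//= -ae.
  have [bd|bd] := ltP `|b - eta.2| d; first by case: ab.
  have /orP[/eqP be|/eqP be] : (b == eta.2 - d) || (b == eta.2 + d).
  - move: bd; rewrite ler_normr => /orP[bd|bd]; apply/orP; [right|left]; apply/eqP; lra.
  - by left; right; exists a; rewrite ?in_itv//= -be.
  - by left; left; left; exists a; rewrite ?in_itv//= -be.
have dd a : a + d - a = d by ring.
have dd' a : a - d - a = - d by ring.
rewrite /sphere /csquare /osquare/=.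
case=> [[[|]|]|] [t]; rewrite /= in_itv/= -ler_distl => td <- /=;
  rewrite ?dd ?dd' ?normrN (ger0_norm d0) ltxx.
all: by split; [split|case].
Qed.

Lemma connected_sphere eta d : 0 <= d -> connected (sphere eta d).
Proof.
move=> d0; rewrite sphereE//.
have c1 (t0 : R) : continuous (fun t : R => (t, t0) : pt).
  move=> t U /nbhs_osquare[e e0 H]; apply/nbhs_ballP; exists e => //= s.
  rewrite /ball/= => ts; apply: H.
  by split; rewrite /= ?subrr ?normr0// distrC.
have c2 (t0 : R) : continuous (fun t : R => (t0, t) : pt).
  move=> t U /nbhs_osquare[e e0 H]; apply/nbhs_ballP; exists e => //= s.
  rewrite /ball/= => ts; apply: H.
  by split; rewrite /= ?subrr ?normr0// distrC.
apply: connectedU; last exact: connected_segment_image.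
  exists (eta.1 - d, eta.2 + d); split; last by exists (eta.2 + d) => //=; rewrite in_itv/=; lra.
  by left; left; exists (eta.1 - d) => //=; rewrite in_itv/=; lra.
apply: connectedU; last exact: connected_segment_image.
  exists (eta.1 + d, eta.2 - d); split; last by exists (eta.1 + d) => //=; rewrite in_itv/=; lra.
  by right; exists (eta.2 - d) => //=; rewrite in_itv/=; lra.
apply: connectedU; try exact: connected_segment_image.
exists (eta.1 + d, eta.2 + d); split; first by exists (eta.1 + d) => //=; rewrite in_itv/=; lra.
by exists (eta.2 + d) => //=; rewrite in_itv/=; lra.
Qed.

Lemma osquare_csquare eta d : osquare eta d `<=` csquare eta d.
Proof. by move=> z [? ?]; split; exact: ltW. Qed.

Lemma csquare_split eta d z : csquare eta d z -> osquare eta d z \/ sphere eta d z.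
Proof. by move=> cz; have [|] := pselect (osquare eta d z); [left|right]. Qed.

(* A clopen part of [W `\` osquare eta d] either misses or contains the sphere;
   in the second case it stays clopen in [W] after adding the square. *)
Lemma connected_setD_osquare (W : set pt) eta d :
  connected W -> closed W -> 0 < d -> csquare eta d `<=` W ->
  connected (W `\` osquare eta d).
Proof.
move=> cW clW d0 dW B B0 [G oG BG] [C cC BC].
have SK : sphere eta d `<=` W `\` osquare eta d by move=> z [/dW ? ?].
have clK : closed (W `\` osquare eta d).
  by apply: closedI => //; exact/open_closedC/open_osquare.
have clB : closed B by rewrite BC; exact: closedI.
have BK : B `<=` W `\` osquare eta d by rewrite BG => z [].
have [SB0|/set0P SB0] := eqVneq (sphere eta d `&` B) set0.
  have Bsq z : B z -> ~ csquare eta d z.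
    move=> Bz /csquare_split[oz|sz]; first by have [] := BK _ Bz.
    by have : (sphere eta d `&` B) z by []; rewrite SB0.
  have BW : B = W.
    apply: cW => //.
    - exists (G `&` ~` csquare eta d).
        by apply: openI => //; exact/closed_openC/closed_csquare.
      apply/seteqP; split => [z Bz|z [Wz [Gz nz]]].
        by split; [have [] := BK _ Bz|split; [rewrite BG in Bz; case: Bz|exact: Bsq]].
      rewrite BG; split => //; split => // oz; apply: nz; exact: osquare_csquare.
    - by exists B => //; rewrite setIidr// => z /BK[].
  exfalso; apply: (Bsq eta); last exact: csquare_center (ltW d0).
  by rewrite BW; apply: dW; exact: csquare_center (ltW d0).
have SB : sphere eta d `<=` B.
  have SBS : sphere eta d `&` B = sphere eta d.
    apply: (@connected_sphere eta d (ltW d0)) => //.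
      exists G => //; rewrite BG; apply/seteqP; split => [z [sz [_ Gz]]//|z [sz Gz]].
      by split => //; split => //; exact: SK.
    by exists B.
  by rewrite -SBS => z [].
have BW : B `|` csquare eta d = W.
  apply: cW; first by case: B0 => z Bz; exists z; left.
  - exists (G `|` osquare eta d); first by apply: openU => //; exact: open_osquare.
    apply/seteqP; split => [z [Bz|cz]|z [Wz Gz]].
    + by split; [have [] := BK _ Bz|left; rewrite BG in Bz; case: Bz].
    + split; first exact: dW.
      case: (csquare_split cz) => [oz|sz]; first by right.
      by left; have := SB _ sz; rewrite BG => -[].
    + case: Gz => [Gz|oz]; last by right; exact: osquare_csquare.
      have [oz|noz] := pselect (osquare eta d z); first by right; exact: osquare_csquare.
      by left; rewrite BG.
  - exists (B `|` csquare eta d); first by apply: closedU => //; exact: closed_csquare.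
    by rewrite setIidr// => z [/BK[]|/dW].
apply/seteqP; split => // z [Wz nz]; rewrite -BW in Wz; case: Wz => // cz.
by case: (csquare_split cz) => // sz; exact: SB.
Qed.

End squares.

(** * Oscillation of a monotone map inside a separating set *)

Section monotone.
Context {R : realType}.
Local Notation pt := (R * R)%type.

Let far_point (a b r d : R) :
  `|a + 3 * r - b| < 2 * d -> `|b - a| <= 2 * r -> 2 * d < r -> False.
Proof. by rewrite ltr_norml ler_norml => /andP[? ?] /andP[? ?]; lra. Qed.

Let osc_pos (X Y U V : set pt) (h : pt -> pt) (y0 eta : pt) (r d : R) :
  monotone_map X Y h -> connected Y -> bounded_plane Y ->
  0 < r -> csquare y0 (3 * r) `<=` Y ->
  closed U -> closed V -> closure X `<=` U `|` V ->
  (forall x, closure X x -> U x -> V x -> csquare eta d (h x)) ->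
  csquare y0 (2 * r) eta ->
  (forall x, closure X x -> U x -> csquare y0 (2 * r) (h x)) ->
  0 < d -> forall x, closure X x -> U x -> csquare eta (8 * d) (h x).
Proof.
move=> [ch hXY mono] cY bY r0 sqY cU cV XUV hS eta0 hU d0 x Xx Ux.
(* For [r <= 2 * d] the bound is free: [h x] and [eta] lie in the square of half-side [2 * r], hence
   are at most [4 * r <= 8 * d] apart. *)
have [dr|dr] := leP r (2 * d).
  apply: csquare_subset (hU _ Xx Ux); case: eta0 => h1 h2; rewrite distrC; lra.
apply/not_notP => nhx.
have clY : connected (closure Y) by exact: connected_closure.
have e0 : 0 < 2 * d by lra.
have sqW : csquare eta (2 * d) `<=` closure Y.
  apply: subset_trans (@subset_closure _ Y); apply: subset_trans sqY.
  by case: eta0 => h1 h2; apply: csquare_subset; lra.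
pose K := closure Y `\` osquare eta (2 * d).
have cK : connected K by exact: connected_setD_osquare (@closed_closure _ Y) e0 sqW.
(* A value that forces the preimage of [K] out of [U]: it is outside the square of half-side [2 * r]
   containing the image of [U], and at distance at least [r > 2 * d] from [eta], so it stays in
   [K]. *)
pose y1 : pt := (y0.1 + 3 * r, y0.2).
have y1Y : closure Y y1.
  apply: subset_closure; apply: sqY; split => /=.
    by rewrite addrC addKr ger0_norm//; lra.
  by rewrite subrr normr0; lra.
have Ky1 : K y1.
  split => // -[/= h1 _]; case: eta0 => h2 _.
  exact: far_point h1 h2 dr.
have contK : continuum K.
  split => //; last by exists y1.
  apply: subclosed_compact (bounded_plane_compact bY) _; last by move=> z [].
  by apply: closedI; [exact: closed_closure|exact/open_closedC/open_osquare].
have [_ cP _] := mono K (fun z => @proj1 _ _) contK.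
have [z1 Xz1 hz1] : (h @` closure X) y1 by rewrite hXY.
have nUz1 : ~ U z1.
  move=> /(hU _ Xz1); rewrite hz1 => -[/= h1 _].
  by move: h1; rewrite addrC addKr ger0_norm; lra.
have nUV z : closure X z -> K (h z) -> U z -> V z -> False.
  move=> Xz [_ nhz] Uz Vz; apply: nhz; case: (hS _ Xz Uz Vz) => h1 h2.
  by split; lra.
have PU : (closure X `&` h @^-1` K) `&` U = closure X `&` h @^-1` K.
  apply: cP.
  - exists x; split => //; split => //; split.
      by rewrite -hXY; exists x.
    by move=> ohx; apply: nhx; case: ohx => h1 h2; split; lra.
  - exists (~` V); first exact: closed_openC.
    apply/seteqP; split => z [[Xz hz] Wz]; split => //; first exact: nUV Wz.
    by case: (XUV _ Xz).
  - by exists U.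
by apply: nUz1; have : (closure X `&` h @^-1` K) z1; [split => //=; rewrite hz1|rewrite -PU => -[]].
Qed.

(* [U] and [V] separate [closure X] along [U `&` V]; the preimage of the
   continuum [closure Y `\` osquare eta (2 * d)] avoids [U `&` V] and is not
   contained in [U], hence it avoids [U]. *)
Lemma monotone_map_osc (X Y U V : set pt) (h : pt -> pt) (y0 eta : pt) (r d : R) :
  monotone_map X Y h -> connected Y -> bounded_plane Y ->
  0 < r -> csquare y0 (3 * r) `<=` Y ->
  closed U -> closed V -> closure X `<=` U `|` V ->
  (forall x, closure X x -> U x -> V x -> csquare eta d (h x)) ->
  csquare y0 (2 * r) eta ->
  (forall x, closure X x -> U x -> csquare y0 (2 * r) (h x)) ->
  0 <= d -> forall x, closure X x -> U x -> csquare eta (8 * d) (h x).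
Proof.
move=> mono cY bY r0 sqY cU cV XUV hS eta0 hU d0 x Xx Ux.
(* Removing an open square requires a positive size, while [d] may be 0; hence [d] is enlarged by
   [e / 8] and [e] tends to 0. *)
have H e : 0 < e -> csquare eta (8 * d + e) (h x).
  move=> e0; rewrite (_ : 8 * d + e = 8 * (d + e / 8)); last by field.
  apply: (osc_pos mono cY bY r0 sqY cU cV XUV _ eta0 hU) => //; last by lra.
  by move=> z Xz Uz Vz; apply: csquare_le (hS _ Xz Uz Vz); lra.
by split; apply/ler_addgt0Pr => e /H[].
Qed.

End monotone.

(** * Outer regularity *)

Section regularity.
Context {R : realType}.
Local Notation pt := (R * R)%type.
Variable nu : {measure set pt -> \bar R}.
Hypothesis nufin : (nu setT < +oo)%E.

Let nuoo A : measurable A -> (nu A < +oo)%E.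
Proof. by move=> mA; rewrite (le_lt_trans _ nufin)// le_measure// inE. Qed.

Lemma decreasing_small_measure (D : (set pt)^nat) (e : R) :
  (forall n, measurable (D n)) -> nonincreasing_seq D ->
  \bigcap_n D n = set0 -> 0 < e -> exists n, (nu (D n) < e%:E)%E.
Proof.
move=> mD ndD D0 e0.
have := @nonincreasing_cvg_mu _ _ _ nu D (nuoo (mD 0%N)) mD.
rewrite D0 measure0 => /(_ measurable0 ndD) H.
have : \forall n \near \oo, (nu (D n) < e%:E)%E.
  apply: (H [set y | (y < e%:E)%E]); apply: open_nbhs_nbhs; split.
    exact: open_ereal_lt_ereal.
  by rewrite /= lte_fin.
by case=> n _ /(_ n (leqnn n)) Dn; exists n.
Qed.

(** Inner and outer approximation are demanded together, so that taking complements only exchanges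
    their roles. *)
Definition regular_set (A : set pt) := forall e : R, 0 < e ->
  exists G K, [/\ open G, closed K, K `<=` A, A `<=` G & (nu (G `\` K) < e%:E)%E].

Lemma regular_setC A : regular_set A -> regular_set (~` A).
Proof.
move=> rA e e0; have [G [K [oG cK KA AG GK]]] := rA _ e0.
exists (~` K), (~` G); split.
- exact: closed_openC.
- exact: open_closedC.
- exact: subsetC.
- exact: subsetC.
- by rewrite setDE setCK setIC -setDE.
Qed.

Lemma regular_set_bigcup (A : (set pt)^nat) : (forall n, regular_set (A n)) ->
  regular_set (\bigcup_n A n).
Proof.
move=> rA e e0.
have e2 n : 0 < (e / 2) / (2 ^ n.+1)%:R by rewrite divr_gt0 ?divr_gt0// ltr0n expn_gt0.
have /choice[f Hf] : forall n, exists GK : set pt * set pt,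
  [/\ open GK.1, closed GK.2, GK.2 `<=` A n, A n `<=` GK.1 &
    (nu (GK.1 `\` GK.2) < ((e / 2) / (2 ^ n.+1)%:R)%:E)%E].
  by move=> n; have [G [K H]] := rA n _ (e2 n); exists (G, K).
(* A countable union of closed sets may fail to be closed. Finitely many of them suffice up to
   [e / 2], by continuity from above of the finite measure. *)
pose KK n := \big[setU/set0]_(i < n) (f i).2.
have KKE n : KK n = \bigcup_(i in `I_n) (f i).2 by rewrite /KK bigcup_mkord.
have cKK n : closed (KK n).
  by apply: closed_bigsetU => i _; have [] := Hf i.
have mG : measurable (\bigcup_n (f n).1).
  by apply: open_measurable2; apply: bigcup_open => n _; have [] := Hf n.
have mK n : measurable (f n).2 by apply: closed_measurable2; have [] := Hf n.
have mG' n : measurable (f n).1 by apply: open_measurable2; have [] := Hf n.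
pose D n := (\bigcup_k (f k).2) `\` KK n.
have mD n : measurable (D n).
  apply: measurableD; first exact: bigcupT_measurable.
  exact: closed_measurable2.
have [N DN] : exists n, (nu (D n) < (e / 2)%:E)%E.
  apply: decreasing_small_measure => //; last by lra.
    move=> m n mn; apply/subsetPset; apply: setDS.
    rewrite !KKE => x [k /= km fx]; exists k => //=.
    exact: leq_trans mn.
  apply/seteqP; split => // x Dx; have [[k _ fk] _] := Dx 0%N I.
  have [_] := Dx k.+1 I; apply; rewrite KKE.
  by exists k => /=.
exists (\bigcup_n (f n).1), (KK N); split => //.
- by apply: bigcup_open => n _; have [] := Hf n.
- rewrite KKE => x [k _ fk]; exists k => //.
  by have [_ _ + _ _] := Hf k; apply.
- by move=> x [k _ Ax]; exists k => //; have [_ _ _ + _] := Hf k; apply.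
have mB k : measurable ((f k).1 `\` (f k).2) by exact: measurableD.
have sub : (\bigcup_n (f n).1) `\` KK N `<=`
    (\bigcup_n ((f n).1 `\` (f n).2)) `|` D N.
  move=> x [[k _ fk] nx]; have [kx|kx] := pselect ((\bigcup_k (f k).2) x).
    by right.
  by left; exists k => //; split => // kx'; apply: kx; exists k.
apply: (@le_lt_trans _ _ (nu (\bigcup_n ((f n).1 `\` (f n).2)) + nu (D N))%E).
  apply: le_trans (measureU2 _ _ _).
  - apply: le_measure => //; rewrite inE.
      by apply: measurableD => //; exact: closed_measurable2.
    by apply: measurableU => //; exact: bigcupT_measurable.
  - exact: bigcupT_measurable.
  - exact: mD.
rewrite [e in X in (_ < X)%E](splitr e) EFinD; apply: lee_ltD => //.
  by rewrite ge0_fin_numE// nuoo//; exact: bigcupT_measurable.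
apply: le_trans (@epsilon_trick0 R (e / 2) xpredT _); last by lra.
apply: le_trans (measure_sigma_subadditive nu mB (bigcupT_measurable _ mB)
  (@subset_refl _ _)) _.
by apply: lee_nneseries => // n _; apply: ltW; have [_ _ _ _ Hn] := Hf n; exact: Hn.
Qed.

Lemma regular_set_closed_decreasing (K : set pt) (G : (set pt)^nat) :
  closed K -> (forall n, open (G n)) -> nonincreasing_seq G ->
  \bigcap_n G n = K -> regular_set K.
Proof.
move=> cK oG ndG GK e e0.
have KG n : K `<=` G n by rewrite -GK => x; apply.
have [n Hn] : exists n, (nu (G n `\` K) < e%:E)%E.
  apply: decreasing_small_measure => //.
  - by move=> n; apply: measurableD; [exact: open_measurable2|exact: closed_measurable2].
  - by move=> m n mn; apply/subsetPset; apply: setSD; apply/subsetPset; exact: ndG.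
  - apply/seteqP; split => // x Dx; have [_ /=] := Dx 0%N I; apply.
    by rewrite -GK => n _; have [] := Dx n I.
exists (G n), K; split => //; exact: KG.
Qed.

Let regular_sigma_algebra : sigma_algebra setT regular_set.
Proof.
split.
- move=> e e0; exists set0, set0; split; [exact: open0|exact: closed0|by []|by []|].
  by rewrite setD0 measure0 lte_fin.
- by move=> A rA; rewrite setTD; exact: regular_setC.
- exact: regular_set_bigcup.
Qed.

(** The sets with regular preimage form a sigma-algebra, and it contains the closed half-lines
    because they are decreasing intersections of open ones. *)
Let regular_strip (p : pt -> R) : continuous p ->
  forall A, measurable A -> regular_set (p @^-1` A).
Proof.
move=> cp.
have sa : sigma_algebra setT [set A : set R | regular_set (p @^-1` A)].
  case: regular_sigma_algebra => r0 rC rU; split.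
  - by rewrite /= preimage_set0.
  - by move=> A rA; rewrite setTD /= preimage_setC; exact: regular_setC.
  - by move=> A rA; rewrite /= preimage_bigcup; exact: rU.
have : (@ocitv R).-sigma.-measurable `<=` [set A : set R | regular_set (p @^-1` A)].
  rewrite RGenCInfty.measurableE; apply: smallest_sub => // _ [x ->] /=.
  apply: (@regular_set_closed_decreasing _
    (fun n => p @^-1` `]x - n.+1%:R^-1, +oo[)).
  - by apply: closed_comp; [move=> z _; exact: cp|exact: rray_closed].
  - by move=> n; apply: open_comp; [move=> z _; exact: cp|exact: rray_open].
  - move=> m n mn; apply/subsetPset => z /=; rewrite !in_itv/= !andbT.
    apply: le_lt_trans; rewrite lerD2l lerN2 lef_pV2 ?posrE ?ltr0n//.
    by rewrite ler_nat ltnS.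
  - apply/seteqP; split => z /=; rewrite ?in_itv/= ?andbT.
      move=> H; apply/ler_addgt0Pr => e e0.
      have := near_infty_natSinv_lt (PosNum e0).
      case=> n _ /(_ n (leqnn n)) /= ne.
      have := H n I; rewrite /= in_itv/= andbT; move: (n.+1%:R^-1) ne => t; lra.
    move=> xz n _; rewrite /= in_itv/= andbT (lt_le_trans _ xz)//.
    by rewrite ltrBlDr ltrDl invr_gt0 ltr0n.
by move=> H A mA; exact: (H A mA).
Qed.

Lemma finite_measure_regular (A : set pt) : measurable A -> regular_set A.
Proof.
have H : (@measurable _ pt) `<=` regular_set.
  rewrite measurable_prod_measurableType; apply: smallest_sub => //.
  move=> _ [B mB [C mC <-]].
  rewrite (_ : B `*` C = ~` (~` (fst @^-1` B) `|` ~` (snd @^-1` C))); last first.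
    by rewrite setCU !setCK.
  apply: regular_setC.
  have rU (U V : set pt) : regular_set U -> regular_set V -> regular_set (U `|` V).
    move=> rU rV; rewrite -bigcup2E; apply: regular_set_bigcup => -[|[|n]] //=.
    by case: regular_sigma_algebra.
  by apply: rU; apply: regular_setC; apply: regular_strip => // z; [exact: cvg_fst|exact: cvg_snd].
exact: H.
Qed.

End regularity.

(** * Open neighbourhoods of small mass *)

Section density.
Context {R : realType}.
Local Notation pt := (R * R)%type.
Local Notation lam2 := (@leb2 R).

(** Outer regularity of the finite measure with density [F]. The set [E] is null for this measure;
    it may have positive Lebesgue measure as long as [F] vanishes on it. *)
Lemma density_open_cover (F : pt -> \bar R) (E : set pt) (e : R) :
  lam2.-integrable setT F -> (forall z, 0 <= F z)%E ->
  measurable E -> (\int[lam2]_(z in E) F z = 0)%E -> 0 < e ->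
  exists U, [/\ open U, E `<=` U & (\int[lam2]_(z in U) F z <= e%:E)%E].
Proof.
move=> Fi F0 mE E0 e0; have mF := measurable_int lam2 Fi.
pose n0 (A : set pt) := (\int[lam2]_(z in A) F z)%E.
have n00 : n0 set0 = 0%E by rewrite /n0 integral_set0.
have n0ge0 A : (0 <= n0 A)%E by apply: integral_ge0.
have n0sa : semi_sigma_additive n0.
  move=> A mA tA mUA; rewrite /n0 ge0_integral_bigcup//; last exact: measurable_funTS.
  by apply: is_cvg_nneseries => n _ _; exact: n0ge0.
pose nu : {measure set pt -> \bar R} :=
  HB.pack n0 (isMeasure.Build _ pt R n0 n00 n0ge0 n0sa).
have nufin : (nu setT < +oo)%E.
  move/integrableP : Fi => [_]; apply: le_lt_trans.
  by rewrite /nu/= /n0; apply: ge0_le_integral => //; [exact: measurableT_comp|move=> x _; exact: lee_abs].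
have [G [K [oG cK KE EG GK]]] := finite_measure_regular nufin mE e0.
exists G; split => //.
have mG := open_measurable2 oG; have mK := closed_measurable2 cK.
have -> : (\int[lam2]_(z in G) F z = nu G)%E by [].
have nuK : nu K = 0%E.
  apply/eqP; rewrite eq_le measure_ge0 andbT -[X in (_ <= X)%E]E0.
  by apply: ge0_subset_integral => //; exact: measurable_funTS.
have GE : G = K `|` (G `\` K) by rewrite setDUK//; exact: subset_trans EG.
rewrite GE; apply: le_trans (measureU2 _ _ _) _; [by []|exact: measurableD|].
apply: (@le_trans _ _ (0 + nu (G `\` K))%E); last by rewrite add0e ltW.
by apply: leeD => //; rewrite le_eqVlt; apply/orP; left; apply/eqP; exact: nuK.
Qed.

End density.

(** * Images of null sets *)

Section null_image.
Context {R : realType}.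
Local Notation pt := (R * R)%type.
Local Notation lam2 := (@leb2 R).

(** A closed interval of length [2 * C.+1] contains at most [2 * C + 3] integers. This is the
    overlap of the enlarged cells of a grid in one coordinate. *)
Lemma count_near (a : R) (C N : nat) :
  \sum_(i < N) (if `|a - i%:R| <= C.+1%:R then 1 else 0 : R) <= (2 * C + 3)%:R.
Proof.
have aux (i t : nat) : (t <= i + 2 * C.+1)%N -> (t < 2 * C + 3 + i)%N by lia.
rewrite -big_mkcond/= sumr_const ler_nat.
set P := [pred i : 'I_N | `|a - i%:R| <= C.+1%:R].
rewrite cardE -(size_map val); set s := map _ _.
pose t := Num.truncn (a + C.+1%:R).
suff H : {subset s <= iota (t.+1 - (2 * C + 3)) (2 * C + 3)}.
  rewrite -[X in (_ <= X)%N](size_iota (t.+1 - (2 * C + 3))).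
  by apply: uniq_leq_size => //; rewrite map_inj_uniq ?enum_uniq//; exact: val_inj.
move=> j /mapP[i]; rewrite mem_enum => Pi ->.
have {}Pi : `|a - i%:R| <= C.+1%:R := Pi.
have [h1 h2] : i%:R <= a + C.+1%:R /\ a + C.+1%:R <= i%:R + (2 * C.+1)%:R.
  move: Pi; rewrite ler_norml => /andP[? ?]; split; first by lra.
  rewrite natrM; lra.
have a0 : 0 <= a + C.+1%:R by apply: le_trans h1; rewrite ler0n.
have it : (i <= t)%N by rewrite truncn_ge_nat.
have ti : (t <= i + 2 * C.+1)%N.
  rewrite -(@ler_nat R) natrD; apply: le_trans h2.
  by have /andP[] := truncn_itv a0.
rewrite mem_iota; apply/andP; split; first by rewrite leq_subLR aux.
by rewrite (leq_ltn_trans it)// addnC -leq_subLR leqnn.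
Qed.

Lemma small_cover_negligible (A : set pt) :
  (forall e : R, 0 < e -> exists B, [/\ measurable B, A `<=` B & (lam2 B <= e%:E)%E]) ->
  lam2.-negligible A.
Proof.
move=> H.
have /choice[B HB] : forall n : nat, exists B, [/\ measurable B, A `<=` B &
    (lam2 B <= n.+1%:R^-1%:E)%E] by move=> n; apply: H; rewrite invr_gt0.
exists (\bigcap_n B n); split.
- by apply: bigcapT_measurable => n; have [] := HB n.
- apply/eqP; rewrite eq_le measure_ge0 andbT; apply/lee_addgt0Pr => e e0.
  rewrite add0e.
  have := near_infty_natSinv_lt (PosNum e0).
  case=> n _ /(_ n (leqnn n)) /= ne.
  have [mB _ Bn] := HB n.
  apply: (@le_trans _ _ (lam2 (B n))).
    apply: le_measure; rewrite ?inE//; last by move=> x; exact.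
    by apply: bigcapT_measurable => k; have [] := HB k.
  by apply: le_trans Bn _; rewrite lee_fin ltW.
- by move=> x Ax n _; have [_ + _] := HB n; apply.
Qed.

(** The sets [A n] are arbitrary, so continuity from below is applied to the lower limit of the
    covers: the intersections [D n] of the later covers increase and still contain [A n]. *)
Lemma cover_increasing (A : (set pt)^nat) (e : R) :
  nondecreasing_seq A ->
  (forall n, exists B, [/\ measurable B, A n `<=` B & (lam2 B <= e%:E)%E]) ->
  exists B, [/\ measurable B, \bigcup_n A n `<=` B & (lam2 B <= e%:E)%E].
Proof.
move=> ndA /choice[B HB].
have mB n : measurable (B n) by have [] := HB n.
pose D n := \bigcap_(k in [set k | (n <= k)%N]) B k.
have mD n : measurable (D n).
  by rewrite /D bigcap_mkcond; apply: bigcapT_measurable => k; case: ifPn.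
have ndD : nondecreasing_seq D.
  by move=> m n mn; apply/subsetPset => x Dx k /= nk; apply: Dx => /=; exact: leq_trans nk.
have De n : (lam2 (D n) <= e%:E)%E.
  have [_ _] := HB n; apply: le_trans; apply: le_measure; rewrite ?inE//.
  by move=> x; apply => /=.
exists (\bigcup_n D n); split.
- exact: bigcupT_measurable.
- move=> x [n _ Ax]; exists n => // k /= nk; have [_ + _] := HB k; apply.
  by move/subsetPset : (ndA _ _ nk); apply.
- have H := @nondecreasing_cvg_mu _ _ _ lam2 D mD (bigcupT_measurable _ mD) ndD.
  have := cvg_lim (@ereal_hausdorff R) H => <-.
  apply: lime_le; first by apply/cvg_ex; exists (lam2 (\bigcup_n D n)).
  by near=> n; exact: De.
Unshelve. all: by end_near. Qed.

Lemma measure_bigsetU_le (I : Type) (s : seq I) (B : I -> set pt) :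
  (forall i, measurable (B i)) ->
  (lam2 (\big[setU/set0]_(i <- s) B i) <= \sum_(i <- s) lam2 (B i))%E.
Proof.
move=> mB; elim: s => [|i s IH]; first by rewrite !big_nil measure0.
rewrite !big_cons; apply: le_trans (measureU2 _ _ _) _ => //.
  exact: bigsetU_measurable.
exact: leeD.
Qed.

Lemma ler_truncn_cell (a : R) : 0 <= a -> `|a - (Num.truncn a)%:R| <= 1.
Proof.
move=> a0; have /andP[h1 h2] := truncn_itv a0.
by rewrite -natr1 in h2; rewrite ler_norml; apply/andP; split; lra.
Qed.

(* The plane is cut into cells of side [delta]; each cell meeting [E] is
   replaced by a square of area comparable to the mass of a concentric square,
   and these concentric squares overlap at most [(2 * C + 3) ^ 2] times. *)
Lemma grid_cover (F : pt -> \bar R) (C : nat) (M delta : R) (E U : set pt)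
    (H : pt -> pt) :
  measurable_fun setT F -> (forall z, 0 <= F z)%E -> 0 < delta ->
  measurable U -> E `<=` csquare (0, 0) M ->
  (forall x, E x -> csquare x (C%:R * delta) `<=` U /\
    exists eta d, [/\ 0 <= d,
      forall x', E x' -> csquare x delta x' -> csquare eta d (H x') &
      ((d ^+ 2)%:E <= C%:R%:E * \int[lam2]_(z in csquare x (C%:R * delta)) F z)%E]) ->
  exists B, [/\ measurable B, H @` E `<=` B &
    (lam2 B <= (4 * C%:R * ((2 * C + 3)%:R ^+ 2))%:E * \int[lam2]_(z in U) F z)%E].
Proof.
move=> mF F0 d0 mU EM HE.
pose N := (Num.truncn (2 * M / delta)).+1.
pose idx (t : R) := Num.truncn ((t + M) / delta).
pose w (p : 'I_N * 'I_N) : pt := (p.1%:R * delta - M, p.2%:R * delta - M).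
pose W p := csquare (w p) (C.+1%:R * delta).
pose cell (p : 'I_N * 'I_N) := [set x | E x /\ idx x.1 = p.1 /\ idx x.2 = p.2].
have idxP (t : R) : `|t| <= M -> (idx t < N)%N /\ `|t - ((idx t)%:R * delta - M)| <= delta.
  rewrite ler_norml => /andP[h1 h2].
  have tM : 0 <= (t + M) / delta by rewrite divr_ge0 ?(ltW d0)//; lra.
  split.
    by rewrite ltnS; apply: le_truncn; rewrite ler_pM2r ?invr_gt0//; lra.
  have := ler_truncn_cell tM; rewrite -/(idx t).
  rewrite -(ler_pM2r d0) mul1r -{2}(gtr0_norm d0) -normrM.
  by rewrite mulrBl divfK ?gt_eqF//; congr (`|_| <= _); ring.
have cellP p x : cell p x -> `|x.1 - (w p).1| <= delta /\ `|x.2 - (w p).2| <= delta.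
  move=> [Ex [e1 e2]]; rewrite /w /= -e1 -e2; have [/= x1 x2] := EM _ Ex.
  rewrite subr0 in x1; rewrite subr0 in x2.
  by split; [have [_] := idxP _ x1|have [_] := idxP _ x2].
have cellW p x : cell p x -> csquare x (C%:R * delta) `<=` W p.
  move=> /cellP[h1 h2]; apply: csquare_subset.
    by rewrite -natr1 mulrDl mul1r; lra.
  by rewrite -natr1 mulrDl mul1r; lra.
have mW p : measurable (W p) by exact: measurable_csquare.
have int0 (A : set pt) : (0 <= \int[lam2]_(z in A) F z)%E by exact: integral_ge0.
have /choice[B HB] : forall p, exists B : set pt, [/\ measurable B,
    H @` cell p `<=` B & (lam2 B <= (4 * C%:R)%:E * \int[lam2]_(z in W p `&` U) F z)%E].
  move=> p; have [[x cx]|nc] := pselect (exists x, cell p x); last first.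
    exists set0; split => //; first by move=> ? [x cx _]; apply: nc; exists x.
    by rewrite measure0 mule_ge0// lee_fin.
  have [xU [eta [d [dge0 Hd dF]]]] := HE _ (proj1 cx).
  exists (csquare eta d); split; first exact: measurable_csquare.
    move=> _ [x' cx' <-]; apply: Hd; first by case: cx'.
    have [Ex [e1 e2]] := cx; have [Ex' [e1' e2']] := cx'.
    have [a1 a2] := EM _ Ex; have [b1 b2] := EM _ Ex'.
    rewrite /= subr0 in a1; rewrite /= subr0 in a2.
    rewrite /= subr0 in b1; rewrite /= subr0 in b2.
    have same (t t' : R) : `|t| <= M -> `|t'| <= M -> idx t = idx t' -> `|t' - t| <= delta.
      rewrite !ler_norml => /andP[t1 t2] /andP[t1' t2'] tt.
      have tM : 0 <= (t + M) / delta by rewrite divr_ge0 ?(ltW d0)//; lra.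
      have tM' : 0 <= (t' + M) / delta by rewrite divr_ge0 ?(ltW d0)//; lra.
      have /andP[u1 u2] := truncn_itv tM; have /andP[v1 v2] := truncn_itv tM'.
      rewrite -/(idx t) in u1 u2; rewrite -/(idx t') -tt in v1 v2.
      rewrite ler_pdivlMr// in u1; rewrite ltr_pdivrMr// in u2.
      rewrite ler_pdivlMr// in v1; rewrite ltr_pdivrMr// in v2.
      rewrite -natr1 mulrDl mul1r in u2; rewrite -natr1 mulrDl mul1r in v2.
      by apply/andP; split; lra.
    by split; apply: same => //; rewrite ?e1 ?e1' ?e2 ?e2'.
  rewrite leb2_csquare// EFinM (EFinM 4) -muleA; apply: lee_wpmul2l => //.
  apply: le_trans dF _; apply: lee_wpmul2l => //.
  apply: ge0_subset_integral => //.
  - exact: measurable_csquare.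
  - exact: measurableI.
  - exact: measurable_funTS.
  - by move=> z xz; split; [exact: (cellW _ _ cx)|exact: xU].
exists (\big[setU/set0]_(p : 'I_N * 'I_N) B p); split.
- by apply: bigsetU_measurable => p _; have [] := HB p.
- move=> _ [x Ex <-]; have [x1 x2] := EM _ Ex.
  rewrite /= subr0 in x1; rewrite /= subr0 in x2.
  pose p : 'I_N * 'I_N := (Ordinal (proj1 (idxP _ x1)), Ordinal (proj1 (idxP _ x2))).
  rewrite -bigcup_seq; exists p => /=; first by rewrite mem_index_enum.
  by have [_ + _] := HB p; apply; exists x.
apply: le_trans (measure_bigsetU_le _ _) _; first by move=> p; have [] := HB p.
apply: (@le_trans _ _ (\sum_(p : 'I_N * 'I_N)
    (4 * C%:R)%:E * \int[lam2]_(z in U) ((\1_(W p) z)%:E * F z))%E).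
  apply: lee_sum => p _; have [_ _ /le_trans] := HB p; apply.
  apply: lee_wpmul2l => //; rewrite integral_mkcondl//.
  rewrite le_eqVlt; apply/orP; left; apply/eqP; apply: eq_integral => z _.
  rewrite patchE indicE; case: ifPn => _; first by rewrite mul1e.
  by rewrite mul0e.
have mfun p : measurable_fun U (fun z => (\1_(W p) z)%:E * F z)%E.
  apply: emeasurable_funM; last exact: measurable_funTS.
  by apply/measurable_EFinP; exact: measurable_indic.
have fun0 p z : (0 <= (\1_(W p) z)%:E * F z)%E by rewrite mule_ge0// lee_fin.
rewrite -ge0_sume_distrr; last by move=> p _; exact: integral_ge0.
rewrite (EFinM (4 * C%:R) (_ ^+ 2)) -muleA; apply: lee_wpmul2l; first by rewrite lee_fin.
have mFU : measurable_fun U F by exact: measurable_funTS.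
have K0 : (0 <= ((2 * C + 3)%:R ^+ 2 : R)%:E)%E by rewrite lee_fin sqr_ge0.
have -> : (\sum_(p : 'I_N * 'I_N) \int[lam2]_(z in U) ((\1_(W p) z)%:E * F z) =
    \int[lam2]_(z in U) \sum_(p : 'I_N * 'I_N) ((\1_(W p) z)%:E * F z))%E.
  by rewrite ge0_integral_sum.
rewrite -ge0_integralZl//.
apply: ge0_le_integral => //.
- by move=> z _; apply: sume_ge0.
- exact: emeasurable_sum.
- by apply: measurable_funeM; exact: measurable_funTS.
move=> z _; rewrite -ge0_sume_distrl; last by move=> p _; rewrite lee_fin.
apply: lee_wpmul2r => //; rewrite sumEFin lee_fin.
(* The number of enlarged cells containing [z] factors into two one-dimensional counts. *)
pose f (t : R) (i : 'I_N) : R := if `|(t + M) / delta - i%:R| <= C.+1%:R then 1 else 0.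
have -> : \sum_(p : 'I_N * 'I_N) \1_(W p) z = \sum_(p : 'I_N * 'I_N) f z.1 p.1 * f z.2 p.2.
  apply: eq_bigr => p _; rewrite indicE /f.
  have Ew (t : R) (i : nat) : (`|t - (i%:R * delta - M)| <= C.+1%:R * delta) =
      (`|(t + M) / delta - i%:R| <= C.+1%:R).
    rewrite (_ : (t + M) / delta - i%:R = (t - (i%:R * delta - M)) / delta).
      by rewrite normrM normfV (gtr0_norm d0) ler_pdivrMr.
    by field; rewrite gt_eqF.
  case: ifPn => h1; case: ifPn => h2; rewrite ?mulr0 ?mul0r ?mulr1.
  - by rewrite mem_set//; split; rewrite /= Ew.
  - rewrite memNset// => -[_]; rewrite /= Ew => h; by rewrite h in h2.
  - rewrite memNset// => -[+ _]; rewrite /= Ew => h; by rewrite h in h1.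
  - rewrite memNset// => -[+ _]; rewrite /= Ew => h; by rewrite h in h1.
rewrite -(pair_bigA _ (fun i j => f z.1 i * f z.2 j))/= -big_distrlr/= expr2.
by apply: ler_pM; [| |exact: count_near|exact: count_near];
  apply: sumr_ge0 => i _; rewrite /f; case: ifP.
Qed.

(** The admissible scale varies with the point, whereas a grid has one scale. The sets [En] gather
    the points for which all scales below [n.+1%:R^-1] are admissible and stay inside an open set
    [U] of small mass; they increase to [E]. The measurable set [E'] is what outer regularity is
    applied to. *)
Lemma null_image (F : pt -> \bar R) (C : nat) (E E' : set pt) (H : pt -> pt) :
  lam2.-integrable setT F -> (forall z, 0 <= F z)%E ->
  measurable E' -> (\int[lam2]_(z in E') F z = 0)%E -> E `<=` E' ->
  (forall x, E x -> exists2 d0 : R, 0 < d0 &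
    forall delta, 0 < delta -> delta < d0 -> exists eta d, [/\ 0 <= d,
      forall x', E x' -> csquare x delta x' -> csquare eta d (H x') &
      ((d ^+ 2)%:E <= C%:R%:E * \int[lam2]_(z in csquare x (C%:R * delta)) F z)%E]) ->
  lam2.-negligible (H @` E).
Proof.
move=> Fi F0 mE' E'0 EE' HE; apply: small_cover_negligible => e e0.
have mF := measurable_int lam2 Fi.
pose K : R := 4 * C%:R * ((2 * C + 3)%:R ^+ 2).
have K0 : 0 <= K by rewrite /K mulr_ge0 ?mulr_ge0 ?sqr_ge0.
have e1 : 0 < e / (K + 1) by rewrite divr_gt0//; lra.
have [U [oU EU UF]] := density_open_cover Fi F0 mE' E'0 e1.
pose En (n : nat) := [set x | [/\ E x, csquare (0, 0) n%:R x &
  forall delta, 0 < delta -> delta < n.+1%:R^-1 ->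
    csquare x (C%:R * delta) `<=` U /\ exists eta d, [/\ 0 <= d,
      forall x', E x' -> csquare x delta x' -> csquare eta d (H x') &
      ((d ^+ 2)%:E <= C%:R%:E * \int[lam2]_(z in csquare x (C%:R * delta)) F z)%E]]].
have EE : E `<=` \bigcup_n En n.
  move=> x Ex; have [d0 d00 Hd] := HE _ Ex.
  have [r r0 rU] := open_csquare oU (EU _ (EE' _ Ex)).
  (* All conditions for membership in [En] become upper bounds on [delta^-1] or on the coordinates
     of [x], and [b] dominates them together. *)
  pose b := Num.max (Num.max `|x.1| `|x.2|) (Num.max d0^-1 (C%:R / r)).
  pose n := Num.truncn b.
  have b0 : 0 <= b by rewrite /b !le_max normr_ge0.
  have bn : b < n.+1%:R by have /andP[] := truncn_itv b0.
  exists n.+1 => //; split => //.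
    split; rewrite /= subr0 (le_trans _ (ltW bn))// /b !le_max lexx ?orbT//.
  move=> delta dl0 dln.
  have bdelta : b * delta < 1.
    rewrite -ltr_pdivlMr// div1r; apply: lt_trans bn _.
    rewrite -[X in X < _]invrK ltf_pV2 ?posrE ?invr_gt0//.
    by apply: lt_trans dln _; rewrite ltf_pV2 ?posrE// ltr_nat.
  split.
    apply: subset_trans rU; apply: csquare_le.
    have : C%:R / r * delta <= b * delta.
      by rewrite ler_pM2r// /b !le_max lexx !orbT.
    move=> /le_trans/(_ (ltW bdelta)).
    by rewrite mulrAC ler_pdivrMr// mul1r.
  apply: Hd => //.
  have : d0^-1 * delta <= b * delta by rewrite ler_pM2r// /b !le_max lexx !orbT.
  move=> /le_lt_trans/(_ bdelta).
  by rewrite mulrC ltr_pdivrMr// mul1r.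
have ndEn : nondecreasing_seq En.
  move=> m n mn; apply/subsetPset => x [Ex xm Hx]; split => //.
    by apply: csquare_le xm; rewrite ler_nat.
  move=> delta dl0 dln; apply: Hx => //; apply: lt_le_trans dln _.
  by rewrite lef_pV2 ?posrE// ler_nat ltnS.
have [] := @cover_increasing (fun n => H @` En n) e _ _.
- move=> m n mn; apply/subsetPset; apply: image_subset.
  by apply/subsetPset; exact: ndEn.
- move=> n.
  have n20 : 0 < n.+2%:R^-1 :> R by rewrite invr_gt0.
  have n2n : n.+2%:R^-1 < n.+1%:R^-1 :> R by rewrite ltf_pV2 ?posrE// ltr_nat.
  have [||B [mB HB Be]] := @grid_cover F C n%:R n.+2%:R^-1 (En n) U H mF F0 n20
    (open_measurable2 oU).
  + by move=> x [].
  + move=> x [Ex _ /(_ _ n20 n2n)[xU [eta [d [h1 h2 h3]]]]]; split => //.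
    by exists eta, d; split => // x' [Ex' _ _]; exact: h2.
  exists B; split => //; apply: le_trans Be _.
  apply: (@le_trans _ _ (K%:E * (e / (K + 1))%:E)%E).
    by apply: lee_wpmul2l => //; rewrite lee_fin.
  rewrite -EFinM lee_fin mulrA ler_pdivrMr; last by lra.
  by rewrite mulrDr mulr1 mulrC; lra.
- move=> B [mB HB Be]; exists B; split => //.
  apply: subset_trans HB => _ [x /EE[n _ Enx] <-]; by exists n.
Qed.

End null_image.

(** * Weak derivatives in rotated coordinates *)

Section weak_derivative.
Context {R : realType}.
Local Notation pt := (R * R)%type.
Local Notation lam2 := (@leb2 R).

Lemma continuous_measurable2 (f : pt -> R) : continuous f -> measurable_fun setT f.
Proof.
move=> cf; apply: (measurability _ (RGenOpens.measurableE R)).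
move=> _ [_ [a [b ->] <-]]; rewrite setTI; apply: open_measurable2.
by apply: open_comp => //; exact: interval_open.
Qed.

Lemma bounded_plane_lty (X : set pt) : bounded_plane X -> measurable X ->
  (lam2 X < +oo)%E.
Proof.
move=> /bounded_plane_closure[M M0 XM] mX.
apply: (@le_lt_trans _ _ (lam2 (csquare (0, 0) M))); last first.
  by rewrite leb2_csquare ?ltW// ltry.
apply: le_measure; rewrite ?inE//; first exact: measurable_csquare.
exact: subset_trans (@subset_closure _ X) XM.
Qed.

Lemma L2_integrable (X : set pt) (f : pt -> R) : open X -> bounded_plane X ->
  L2 X f -> lam2.-integrable X (EFin \o f).
Proof.
move=> oX bX [mf f2]; have mX := open_measurable2 oX.
have i1 : lam2.-integrable X (EFin \o cst 1).
  apply: measurable_bounded_integrable => //; first exact: bounded_plane_lty.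
  by exists 1; split => // x x1 y _; rewrite /= normr1 ltW.
have i2 : lam2.-integrable X (fun x => (f x ^+ 2)%:E).
  apply/integrableP; split; first by apply/measurable_EFinP; exact: measurable_funX.
  apply: le_lt_trans f2; rewrite le_eqVlt; apply/orP; left; apply/eqP.
  by apply: eq_integral => x _; rewrite /= ger0_norm ?sqr_ge0.
apply: le_integrable (integrableD mX i1 i2) => //.
  exact/measurable_EFinP.
move=> x _ /=; rewrite lee_fin [leRHS]ger0_norm ?addr_ge0 ?sqr_ge0//.
rewrite -[f x ^+ 2]real_normK ?num_real//.
have := sqr_ge0 (`|f x| - 1); rewrite sqrrB expr1n mulr1 => H.
have := normr_ge0 (f x); lra.
Qed.

Lemma bounded_continuous (X : set pt) (f : pt -> R) : bounded_plane X ->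
  continuous f -> [bounded f x | x in X].
Proof.
move=> /bounded_plane_closure[M M0 XM] cf.
have /compact_bounded[K [Kr HK]] : compact (f @` csquare (0, 0) M).
  apply: continuous_compact; last exact: compact_csquare.
  exact: continuous_subspaceT.
exists K; split => // x Kx z Xz /=; apply: (HK x Kx).
by exists z => //; apply: XM; exact: subset_closure.
Qed.

Lemma integrable_mul_continuous (X : set pt) (u f : pt -> R) :
  open X -> bounded_plane X -> lam2.-integrable X (EFin \o u) -> continuous f ->
  lam2.-integrable X (EFin \o (fun x => u x * f x)).
Proof.
move=> oX bX ui cf.
have -> : EFin \o (fun x => u x * f x) = ((EFin \o u) \* (EFin \o f))%E.
  by apply/funext => x /=; rewrite EFinM.
apply: integrableMl => //.
- exact: open_measurable2.
- by apply: measurable_funTS; exact: continuous_measurable2.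
- exact: bounded_continuous.
Qed.

Definition lform (a b : R) (q : pt) : R := a * q.1 + b * q.2.

Lemma lform_continuous a b : continuous (lform a b).
Proof.
by move=> q; apply: cvgD; apply: cvgM;
  [exact: cvg_cst|exact: cvg_fst|exact: cvg_cst|exact: cvg_snd].
Qed.

Lemma lform_linear a b (k : R) (p q : pt) :
  lform a b (k *: p + q) = k *: lform a b p + lform a b q.
Proof. by rewrite /lform /= /GRing.scale/=; ring. Qed.

Lemma rot_continuous (c s : R) : continuous (rot c s).
Proof.
move=> z U /nbhs_osquare[e e0 HU].
have h1 := @lform_continuous c (- s) z; have h2 := @lform_continuous s c z.
move/cvgrPdist_lt : h1 => /(_ e e0) h1; move/cvgrPdist_lt : h2 => /(_ e e0) h2.
apply: filterS2 h1 h2 => q /=; rewrite /lform => h1 h2; apply: HU; split.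
  by rewrite /= distrC; move: h1; rewrite !mulNr.
by rewrite /= distrC.
Qed.

Lemma derive_tensor (al be : R -> R) (a b a' b' : R) (v q : pt) :
  (forall n, Ck n al) -> (forall n, Ck n be) ->
  'D_v (fun q => al (lform a b q) * be (lform a' b' q)) q =
  al (lform a b q) * (lform a' b' v * 'D_1 be (lform a' b' q)) +
  be (lform a' b' q) * (lform a b v * 'D_1 al (lform a b q)).
Proof.
move=> sal sbe.
have H (f : R -> R) x y : (forall n, Ck n f) ->
    derivable (fun q => f (lform x y q)) q v /\
    'D_v (fun q => f (lform x y q)) q = lform x y v * 'D_1 f (lform x y q).
  move=> sf; have [_ [df _]] := sf 1%N.
  have d1 : is_derive (lform x y q) (1 : R) f ('D_1 f (lform x y q)) by apply: DeriveDef.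
  have [d2 d3] := derive_scale (lform x y v) d1.
  have E := derive_comp_linear f q v (lform_linear x y).
  split; first by rewrite /derivable E; exact: d2.
  by rewrite -d3 /derive E.
have [d1 e1'] := H al a b sal; have [d2 e2'] := H be a' b' sbe.
have := @deriveM _ _ (fun q => al (lform a b q)) (fun q => be (lform a' b' q)) q v d1 d2.
by rewrite e1' e2'.
Qed.

Lemma derive_support (f : R -> R) (a b x : R) :
  (forall y, ~ (a <= y <= b) -> f y = 0) -> ~ (a <= x <= b) -> 'D_1 f x = 0.
Proof.
move=> f0 nx.
transitivity ('D_1 (cst (0 : R) : R -> R) x); last exact: derive_cst.
apply: near_eq_derive.
have [xa|ax] := ltP x a.
  near=> y; apply: f0; apply/negP; rewrite negb_and -!ltNge; apply/orP; left.
  by near: y; exact: lt_nbhsl.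
have bx : b < x by rewrite ltNge; apply/negP => xb; apply: nx; rewrite ax.
near=> y; apply: f0; apply/negP; rewrite negb_and -!ltNge; apply/orP; right.
by near: y; exact: lt_nbhsr.
Unshelve. all: by end_near. Qed.

Lemma Rintegral_rot (X Q : set pt) (c s : R) (f : pt -> R) :
  c ^+ 2 + s ^+ 2 = 1 -> measurable X -> lam2.-integrable X (EFin \o f) ->
  Q `<=` rot c s @^-1` X ->
  (forall z, X (rot c s z) -> ~ Q z -> f (rot c s z) = 0) ->
  Rintegral lam2 X f = Rintegral lam2 Q (fun z => f (rot c s z)).
Proof.
move=> cs mX fi QX f0.
transitivity (Rintegral lam2 (rot c s @^-1` X) (fun z => f (rot c s z))).
  rewrite /Rintegral; congr fine.
  by rewrite -(integral_preserves (preserves_leb2_rot cs) mX fi).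
rewrite Rintegral_mkcond [RHS]Rintegral_mkcond; congr Rintegral.
apply/funext => z; rewrite !patchE.
case: ifPn; rewrite (inE, notin_setE) => Xz; case: ifPn; rewrite (inE, notin_setE) => Qz //.
  exact: f0.
by exfalso; exact: (Xz (QX _ Qz)).
Qed.

Let Rintegral_leb2E (X : set pt) (f : pt -> R) : measurable X ->
  lam2.-integrable X (EFin \o f) ->
  Rintegral lam2 X f = Rintegral (@lebesgue_measure R \x @lebesgue_measure R)%E X f.
Proof.
move=> mX fi; rewrite /Rintegral integral_mkcond [in RHS]integral_mkcond.
congr fine; apply: (@integral_leb2E R ((EFin \o f) \_ X)).
exact/(integrable_mkcond _ mX).
Qed.

(* The integrals in [weak_deriv] are over the non-convertible copy of the
   measurable space [R * R]. *)
Lemma weak_deriv_leb2 (X : set pt) (u g phi : pt -> R) (e : pt) :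
  weak_deriv X u e g -> test_fun X phi -> measurable X ->
  lam2.-integrable X (EFin \o (fun x => u x * 'D_e phi x)) ->
  lam2.-integrable X (EFin \o (fun x => g x * phi x)) ->
  Rintegral lam2 X (fun x => u x * 'D_e phi x) =
  - Rintegral lam2 X (fun x => g x * phi x).
Proof.
move=> w tphi mX i1 i2; rewrite !Rintegral_leb2E//.
exact: (w phi tphi).
Qed.

(** The product of [al] and [be] in the rotated coordinates is a test function on [X]. Weighting its
    two weak equations by [c] and [s] differentiates along the first rotated axis: the terms with
    the derivative of [be] cancel, and the others collect the factor [c ^+ 2 + s ^+ 2]. *)
Lemma weak_deriv_rot (X : set pt) (u g1 g2 : pt -> R) (c s a b a' b' : R)
    (al be : R -> R) :
  open X -> bounded_plane X -> L2 X u -> L2 X g1 -> L2 X g2 ->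
  weak_deriv X u (e1 R) g1 -> weak_deriv X u (e2 R) g2 ->
  c ^+ 2 + s ^+ 2 = 1 ->
  `[a, b] `*` `[a', b'] `<=` rot c s @^-1` X ->
  (forall n, Ck n al) -> (forall n, Ck n be) ->
  (forall x, ~ (a <= x <= b) -> al x = 0) ->
  (forall x, ~ (a' <= x <= b') -> be x = 0) ->
  Rintegral lam2 (`[a, b] `*` `[a', b'])
    (fun z => u (rot c s z) * ('D_1 al z.1 * be z.2)) =
  - Rintegral lam2 (`[a, b] `*` `[a', b'])
    (fun z => (c * g1 (rot c s z) + s * g2 (rot c s z)) * (al z.1 * be z.2)).
Proof.
move=> oX bX u2 g12 g22 w1 w2 cs QX sal sbe al0 be0.
set Q := _ `*` _ in QX *.
have mX := open_measurable2 oX.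
pose l1 := lform c s; pose l2 := lform (- s) c.
have l1r z : l1 (rot c s z) = z.1.
  by rewrite /l1 /lform /rot/= -[RHS]mul1r -cs; ring.
have l2r z : l2 (rot c s z) = z.2.
  by rewrite /l2 /lform /rot/= -[RHS]mul1r -cs; ring.
have rl q : rot c s (l1 q, l2 q) = q.
  case: q => q1 q2; rewrite /l1 /l2 /lform /rot/=; congr pair.
    by rewrite -[RHS]mul1r -cs; ring.
  by rewrite -[RHS]mul1r -cs; ring.
pose phi q := al (l1 q) * be (l2 q).
have cl1 := @lform_continuous c s; have cl2 := @lform_continuous (- s) c.
have cont (f : R -> R) : continuous f ->
    continuous (fun q => f (l1 q)) /\ continuous (fun q => f (l2 q)).
  move=> cf; split=> q.
    by apply: (@continuous_comp _ _ _ l1 f); [exact: cl1|exact: cf].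
  by apply: (@continuous_comp _ _ _ l2 f); [exact: cl2|exact: cf].
have [cal1 _] := cont al (sal 0%N).1; have [_ cbe2] := cont be (sbe 0%N).1.
have [cdal1 _] := cont _ ((sal 1%N).2.2 1).1.
have [_ cdbe2] := cont _ ((sbe 1%N).2.2 1).1.
have phiX : test_fun X phi.
  split.
    by apply: Ck_smooth_fun => n; apply: CkM; apply: Ck_comp_linear => //;
      exact: lform_linear.
  exists (rot c s @` Q); split.
  - apply: continuous_compact; first exact/continuous_subspaceT/rot_continuous.
    by apply: compact_setX; exact: segment_compact.
  - by move=> _ [z Qz <-]; exact: QX.
  - move=> q nQ; rewrite /phi.
    have [h1|h1] := pselect (a <= l1 q <= b); last by rewrite al0// mul0r.
    have [h2|h2] := pselect (a' <= l2 q <= b'); last by rewrite be0// mulr0.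
    exfalso; apply: nQ; exists (l1 q, l2 q); last exact: rl.
    by split; rewrite /= in_itv.
have ui := L2_integrable oX bX u2.
have g1i := L2_integrable oX bX g12; have g2i := L2_integrable oX bX g22.
have cphi : continuous phi.
  by move=> q; apply: cvgM; [exact: cal1|exact: cbe2].
pose d1 q := al (l1 q) * (- s * 'D_1 be (l2 q)) + be (l2 q) * (c * 'D_1 al (l1 q)).
pose d2 q := al (l1 q) * (c * 'D_1 be (l2 q)) + be (l2 q) * (s * 'D_1 al (l1 q)).
have cd (k k' : R) : continuous (fun q =>
    al (l1 q) * (k * 'D_1 be (l2 q)) + be (l2 q) * (k' * 'D_1 al (l1 q))).
  move=> q; apply: cvgD; apply: cvgM; [exact: cal1| |exact: cbe2|].
    by apply: cvgM; [exact: cvg_cst|exact: cdbe2].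
  by apply: cvgM; [exact: cvg_cst|exact: cdal1].
have D1 : (fun x => u x * 'D_(e1 R) phi x) = (fun x => u x * d1 x).
  apply/funext => q; rewrite (derive_tensor _ _ _ _ _ _ sal sbe).
  have -> : lform c s (e1 R) = c by rewrite /lform /e1/= mulr1 mulr0 addr0.
  have -> : lform (- s) c (e1 R) = - s by rewrite /lform /e1/= mulr1 mulr0 addr0.
  by [].
have D2 : (fun x => u x * 'D_(e2 R) phi x) = (fun x => u x * d2 x).
  apply/funext => q; rewrite (derive_tensor _ _ _ _ _ _ sal sbe).
  have -> : lform c s (e2 R) = s by rewrite /lform /e2/= mulr1 mulr0 add0r.
  have -> : lform (- s) c (e2 R) = c by rewrite /lform /e2/= mulr1 mulr0 add0r.
  by [].
have iu1 : lam2.-integrable X (EFin \o (fun x => u x * d1 x)).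
  by apply: integrable_mul_continuous => //; exact: cd.
have iu2 : lam2.-integrable X (EFin \o (fun x => u x * d2 x)).
  by apply: integrable_mul_continuous => //; exact: cd.
have ig1 : lam2.-integrable X (EFin \o (fun x => g1 x * phi x)).
  exact: integrable_mul_continuous.
have ig2 : lam2.-integrable X (EFin \o (fun x => g2 x * phi x)).
  exact: integrable_mul_continuous.
have W1 : Rintegral lam2 X (fun x => u x * d1 x) =
    - Rintegral lam2 X (fun x => g1 x * phi x).
  by rewrite -D1; apply: weak_deriv_leb2 => //; rewrite D1.
have W2 : Rintegral lam2 X (fun x => u x * d2 x) =
    - Rintegral lam2 X (fun x => g2 x * phi x).
  by rewrite -D2; apply: weak_deriv_leb2 => //; rewrite D2.
have comb (f g : pt -> R) : lam2.-integrable X (EFin \o f) ->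
    lam2.-integrable X (EFin \o g) ->
    lam2.-integrable X (EFin \o (fun x => c * f x + s * g x)) /\
    Rintegral lam2 X (fun x => c * f x + s * g x) =
    c * Rintegral lam2 X f + s * Rintegral lam2 X g.
  move=> fi gi.
  have cfi : lam2.-integrable X (EFin \o (fun x => c * f x)).
    by apply: eq_integrable (integrableZl mX c fi) => // x _; rewrite /= EFinM.
  have sgi : lam2.-integrable X (EFin \o (fun x => s * g x)).
    by apply: eq_integrable (integrableZl mX s gi) => // x _; rewrite /= EFinM.
  split.
    by apply: eq_integrable (integrableD mX cfi sgi) => // x _; rewrite /= EFinD.
  by rewrite RintegralD// !RintegralZl.
have [iu Eu] := comb _ _ iu1 iu2; have [ig Eg] := comb _ _ ig1 ig2.
have main : Rintegral lam2 X (fun x => c * (u x * d1 x) + s * (u x * d2 x)) =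
    - Rintegral lam2 X (fun x => c * (g1 x * phi x) + s * (g2 x * phi x)).
  by rewrite Eu Eg W1 W2; ring.
have Fu : (fun x => c * (u x * d1 x) + s * (u x * d2 x)) =
    (fun x => u x * ('D_1 al (l1 x) * be (l2 x))).
  apply/funext => x; rewrite /d1 /d2.
  transitivity ((c ^+ 2 + s ^+ 2) * (u x * ('D_1 al (l1 x) * be (l2 x)))); first by ring.
  by rewrite cs mul1r.
have Fg : (fun x => c * (g1 x * phi x) + s * (g2 x * phi x)) =
    (fun x => (c * g1 x + s * g2 x) * (al (l1 x) * be (l2 x))).
  by apply/funext => x; rewrite /phi; ring.
rewrite Fu Fg in main; rewrite Fu in iu; rewrite Fg in ig.
have nQ z : ~ Q z -> ~ (a <= z.1 <= b) \/ ~ (a' <= z.2 <= b').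
  move=> nQz; have [h|] := pselect (a <= z.1 <= b); last by left.
  by right => h'; apply: nQz; split; rewrite /= in_itv.
rewrite (@Rintegral_rot _ Q _ _ _ cs mX iu) // in main; last first.
  move=> z _ /nQ; rewrite l1r l2r => -[h|h]; last by rewrite (be0 _ h) !mulr0.
  by rewrite (derive_support al0 h) mul0r mulr0.
rewrite (@Rintegral_rot _ Q _ _ _ cs mX ig) // in main; last first.
  move=> z _ /nQ; rewrite l1r l2r => -[h|h]; last by rewrite (be0 _ h) !mulr0.
  by rewrite (al0 _ h) mul0r mulr0.
have -> : (fun z => u (rot c s z) * ('D_1 al z.1 * be z.2)) =
  (fun z => u (rot c s z) * ('D_1 al (l1 (rot c s z)) * be (l2 (rot c s z)))).
  by apply/funext => z; rewrite l1r l2r.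
rewrite main; congr (- Rintegral _ _ _).
by apply/funext => z; rewrite l1r l2r.
Qed.

End weak_derivative.

(** * The rectangle identity *)

Lemma ae_imp d (T : measurableType d) (R : realType) (mu : {measure set T -> \bar R})
    (P Q : T -> Prop) : (forall x, P x -> Q x) ->
  {ae mu, forall x, P x} -> {ae mu, forall x, Q x}.
Proof. by move=> PQ; apply: negligibleS => x /= nQ /PQ. Qed.

Section approximate_identity.
Context {R : realType}.
Local Notation mu := (@lebesgue_measure R).

Lemma Dsstep0 (x : R) : ~ (0 <= x <= 1) -> 'D_1 (@sstep R) x = 0.
Proof.
move=> nx; have [x0|x0] := ltP x 0.
  transitivity ('D_1 (cst (0 : R) : R -> R) x); last exact: derive_cst.
  apply: near_eq_derive; near=> y; apply: sstep0.
  by near: y; exact: lt_le_nbhsl.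
have x1 : 1 < x by rewrite ltNge; apply/negP => x1; apply: nx; rewrite x0.
transitivity ('D_1 (cst (1 : R) : R -> R) x); last exact: derive_cst.
apply: near_eq_derive; near=> y; apply: sstep1; apply: ltW.
by near: y; exact: lt_nbhsr.
Unshelve. all: by end_near. Qed.

Lemma Dsstep_bound : exists2 B : R, 0 < B & forall x, `|'D_1 (@sstep R) x| <= B.
Proof.
have /compact_bounded[K [Kr HK]] : compact ('D_1 (@sstep R) @` `[0, 1]).
  apply: continuous_compact; last exact: segment_compact.
  exact/continuous_subspaceT/continuous_Dsstep.
exists (`|K| + 1); first by rewrite ltr_wpDl.
move=> x; have [x01|nx] := pselect (0 <= x <= 1); last first.
  by rewrite Dsstep0// normr0 addr_ge0.
apply: (HK (`|K| + 1)); first by rewrite (le_lt_trans (ler_norm K))// ltrDl.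
by exists x => //; rewrite /= in_itv.
Qed.

(** The rise takes place on [[a, a + l^-1]], to the right of [a]. Limits are therefore indicators of
    intervals open on the left, and a step at [b] needs room beyond [b]. *)
Definition sstepn (l a x : R) := sstep (l * x + - (l * a)).

Lemma Ck_sstepn n l a : Ck n (sstepn l a).
Proof. by apply: Ck_comp_affine; exact: Ck_sstep. Qed.

Lemma Dsstepn l a x : 'D_1 (sstepn l a) x = 'D_1 (@sstep R) (l * x + - (l * a)) * l.
Proof.
have H : is_derive x (1 : R) (sstepn l a) ('D_1 (@sstep R) (l * x + - (l * a)) * l).
  apply: (@is_derive1_comp _ (@sstep R) (fun x => l * x + - (l * a))).
    exact: is_derive_sstep.
  have Ha := is_deriveD (is_deriveZ l (is_derive_id x (1 : R)))
    (is_derive_cst (- (l * a)) x 1).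
  by apply: is_derive_eq Ha _; rewrite addr0 /GRing.scale/= mulr1.
by case: H.
Qed.

Lemma sstepn0 l a x : 0 < l -> x <= a -> sstepn l a x = 0.
Proof. by move=> l0 xa; apply: sstep0; rewrite -mulrBr pmulr_rle0// subr_le0. Qed.

Lemma sstepn1 l a x : 0 < l -> a + l^-1 <= x -> sstepn l a x = 1.
Proof.
move=> l0 xa; apply: sstep1; rewrite -mulrBr -ler_pdivrMl// mulr1; lra.
Qed.

Lemma Rintegral_shrink (A B : set R) (f : R -> R) : B `<=` A ->
  (forall x, A x -> ~ B x -> f x = 0) -> Rintegral mu A f = Rintegral mu B f.
Proof.
move=> BA f0; rewrite Rintegral_mkcond [RHS]Rintegral_mkcond; congr Rintegral.
apply/funext => x; rewrite !patchE.
case: ifPn; rewrite (inE, notin_setE) => Ax; case: ifPn; rewrite (inE, notin_setE) => Bx //.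
  exact: f0.
by exfalso; exact: (Ax (BA _ Bx)).
Qed.

Lemma continuous_segment_integrable (f : R -> R) (p q : R) :
  (forall x, p <= x <= q -> {for x, continuous f}) ->
  mu.-integrable `[p, q] (EFin \o f).
Proof.
move=> cf; apply: continuous_compact_integrable; first exact: segment_compact.
apply: continuous_in_subspaceT => x; rewrite inE/= in_itv/=; exact: cf.
Qed.

(** The derivative of the step has integral 1, so the error is the integral of [w x - w a] against
    it. That derivative is at most [B * l] on an interval of length [l^-1], and the factors [l]
    cancel. *)
Lemma sstepn_average (w : R -> R) (p q a l e B : R) : 0 < l -> p <= a ->
  a + l^-1 <= q -> (forall x, p <= x <= q -> {for x, continuous w}) ->
  0 <= e -> (forall x, a <= x <= a + l^-1 -> `|w x - w a| <= e) ->
  (forall x, `|'D_1 (@sstep R) x| <= B) ->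
  `|Rintegral mu `[p, q] (fun x => w x * 'D_1 (sstepn l a) x) - w a| <= e * B.
Proof.
move=> l0 pa aq cw e0 we HB.
have li0 : 0 < l^-1 by rewrite invr_gt0.
have pq : p < q by lra.
pose D x := 'D_1 (sstepn l a) x.
have cD : continuous D by have [_ [_ /(_ 1) []]] := Ck_sstepn 1 l a.
have B0 : 0 <= B by apply: le_trans (HB 0).
have D0 x : ~ (a <= x <= a + l^-1) -> D x = 0.
  move=> nx; rewrite /D Dsstepn Dsstep0 ?mul0r// => /andP[h1 h2]; apply: nx.
  rewrite -mulrBr pmulr_rge0// subr_ge0 in h1.
  by rewrite -mulrBr -ler_pdivlMl// mulr1 in h2; rewrite h1/=; lra.
have DB x : `|D x| <= B * l.
  by rewrite /D Dsstepn normrM (gtr0_norm l0) ler_pM2r.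
have iD : mu.-integrable `[p, q] (EFin \o D).
  by apply: continuous_segment_integrable => x _; exact: cD.
have iwD : mu.-integrable `[p, q] (EFin \o (fun x => w x * D x)).
  by apply: continuous_segment_integrable => x pxq; apply: cvgM; [exact: cw|exact: cD].
have intD : Rintegral mu `[p, q] D = 1.
  rewrite /Rintegral (@continuous_FTC2 R D (sstepn l a) p q pq).
  - by rewrite sstepn1// sstepn0// -EFinB subr0.
  - exact: continuous_subspaceT.
  - have cs : continuous (sstepn l a) by exact: (Ck_sstepn 0 l a).1.
    split.
    + by move=> x _; have [_ [d _]] := Ck_sstepn 1 l a; exact: d.
    + exact: cvg_at_right_filter (cs p).
    + exact: cvg_at_left_filter (cs q).
  - by move=> x _; rewrite derive1E.
have -> : Rintegral mu `[p, q] (fun x => w x * D x) - w a =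
    Rintegral mu `[p, q] (fun x => (w x - w a) * D x).
  have iwaD : mu.-integrable `[p, q] (EFin \o (fun x => w a * D x)).
    by apply: continuous_segment_integrable => x _; apply: cvgM; [exact: cvg_cst|exact: cD].
  rewrite -[X in _ - X]mulr1 -intD -RintegralZl// -RintegralB//.
  by apply: eq_Rintegral => x _; rewrite mulrBl.
rewrite (@Rintegral_shrink _ `[a, a + l^-1]); last 2 first.
  by move=> x; rewrite /= !in_itv/= => /andP[? ?]; apply/andP; split; lra.
  by move=> x _; rewrite /= in_itv/= => nx; rewrite D0 ?mulr0.
have iE : mu.-integrable `[a, a + l^-1] (EFin \o (fun x => (w x - w a) * D x)).
  apply: continuous_segment_integrable => x /andP[h1 h2].
  apply: cvgM; last exact: cD.
  by apply: cvgB; [apply: cw; apply/andP; split; lra|exact: cvg_cst].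
apply: le_trans (le_normr_Rintegral _ iE) _ => //.
apply: (@le_trans _ _ (Rintegral mu `[a, a + l^-1] (cst (e * (B * l))))).
  apply: le_Rintegral => //.
  - exact: (integrable_norm iE).
  - by apply: continuous_segment_integrable => x _; exact: cvg_cst.
  - move=> x; rewrite /= in_itv/= => ax; rewrite normrM; apply: ler_pM => //.
    exact: we.
rewrite Rintegral_cst//= lebesgue_measure_itv/= lte_fin ltrDl li0/=.
by rewrite addrC addKr mulrA mulfK// gt_eqF.
Qed.

(** At almost every point [f] is the derivative of its primitive, which vanishes. The extension by 0
    makes [f] locally integrable on the whole line. *)
Lemma zero_ae (f : R -> R) (c d : R) : mu.-integrable `[c, d] (EFin \o f) ->
  (forall x, c < x < d -> Rintegral mu `]c, x] f = 0) ->
  {ae mu, forall x, c < x < d -> f x = 0}.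
Proof.
move=> fi f0.
pose g := f \_ `[c, d].
have gi : mu.-integrable setT (EFin \o g).
  have H := @integrable_mkcond _ _ R mu `[c, d] (EFin \o f) (measurable_itv _).
  have := H.1 fi.
  by apply: eq_integrable => // x _; rewrite /= /g !patchE; case: ifPn.
have lg : locally_integrable setT g.
  by apply: open_integrable_locally => //; exact: openT.
have gE t : c <= t <= d -> g t = f t.
  by move=> ct; rewrite /g patchE mem_set//= in_itv.
apply: ae_imp (lebesgue_differentiation lg) => x Lx /andP[cx xd].
rewrite -gE; last by rewrite !ltW.
have gi' : mu.-integrable [set` Interval (BRight c) (BRight d)] (EFin \o g).
  by apply: integrableS gi => //; exact: measurableT.
have cx' : (BRight c < BRight x)%O by rewrite bnd_simp.
have [dF <-] := FTC1_lebesgue_pt xd gi' cx' Lx.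
rewrite derive1E.
transitivity ('D_1 (cst (0 : R) : R -> R) x); last exact: derive_cst.
apply: near_eq_derive; near=> y.
have yc : c < y by near: y; exact: lt_nbhsr.
have yd : y < d by near: y; exact: lt_nbhsl.
rewrite -(f0 y) ?yc//; apply: eq_Rintegral => t; rewrite inE/= in_itv/= => /andP[ct ty].
by apply: gE; rewrite ltW//=; lra.
Unshelve. all: by end_near. Qed.

End approximate_identity.

(** * Traces on the sides of a rectangle and the integral of the weak derivative *)

Section rectangle.
Context {R : realType}.
Local Notation pt := (R * R)%type.
Local Notation lam2 := (@leb2 R).
Local Notation mu := (@lebesgue_measure R).

Lemma slice_continuous (v : pt -> R) (x y : R) : {for (x, y), continuous v} ->
  {for x, continuous (fun t => v (t, y))}.
Proof.
move=> cv; apply: (@continuous_comp _ _ _ (fun t => (t, y) : pt) v); last exact: cv.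
move=> U /nbhs_osquare[e e0 H]; apply/nbhs_ballP; exists e => //= s.
rewrite /ball/= => ts; apply: H.
by split; rewrite /= ?subrr ?normr0// distrC.
Qed.

(** A smooth approximation of the indicator of []a, b]]. The product with [-1] replaces a difference
    so that [CkD] and [CkM] apply. *)
Definition tent (l a b x : R) := sstepn l a x + (-1) * sstepn l b x.

Lemma Ck_tent n l a b : Ck n (tent l a b).
Proof.
by apply: CkD; [exact: Ck_sstepn|apply: CkM; [exact: Ck_cst|exact: Ck_sstepn]].
Qed.

Lemma tent_norm l a b x : `|tent l a b x| <= 1.
Proof.
have h1 := @sstep_ge0 R (l * x + - (l * a)); have h2 := @sstep_le1 R (l * x + - (l * a)).
have h3 := @sstep_ge0 R (l * x + - (l * b)); have h4 := @sstep_le1 R (l * x + - (l * b)).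
by rewrite /tent /sstepn mulN1r ler_norml; apply/andP; split; lra.
Qed.

Lemma Dtent l a b x :
  'D_1 (tent l a b) x = 'D_1 (sstepn l a) x - 'D_1 (sstepn l b) x.
Proof.
have [_ [d1 _]] := Ck_sstepn 1 l a; have {}d1 := d1 x 1.
have [_ [d2 _]] := Ck_sstepn 1 l b; have {}d2 := d2 x 1.
have -> : tent l a b = sstepn l a - sstepn l b.
  by apply/funext => t; rewrite /tent mulN1r.
by rewrite deriveB.
Qed.

Lemma tent_support l a b b' x : 0 < l -> a <= b -> b + l^-1 <= b' ->
  ~ (a <= x <= b') -> tent l a b x = 0.
Proof.
move=> l0 ab bb nx; have li0 : 0 < l^-1 by rewrite invr_gt0.
rewrite /tent; have [xa|ax] := ltP x a.
  by rewrite !sstepn0 ?mulr0 ?addr0//; lra.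
have bx : b' < x by rewrite ltNge; apply/negP => xb; apply: nx; rewrite ax.
by rewrite !sstepn1//; lra.
Qed.

Lemma tent_cvg (l : R^nat) a b x : (forall n, 0 < l n) -> (l n)^-1 @[n --> \oo] --> 0 ->
  a < b -> \forall n \near \oo, tent (l n) a b x = \1_`]a, b] x.
Proof.
move=> l0 lc ab.
have small (t : R) : 0 < t -> \forall n \near \oo, (l n)^-1 <= t.
  move=> t0; move/cvgrPdist_le : lc => /(_ t t0); apply: filterS => n.
  by rewrite sub0r normrN; apply: le_trans; exact: ler_norm.
rewrite indicE; case: (ltP a x) => ax; last first.
  rewrite memNset/=; last by rewrite in_itv/= ltNge ax.
  by apply: nearW => n; rewrite /tent !sstepn0 ?mulr0 ?addr0//; lra.
case: (leP x b) => xb.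
  rewrite mem_set/=; last by rewrite in_itv/= ax xb.
  have xa0 : 0 < x - a by lra.
  apply: filterS (small _ xa0) => n ln.
  by rewrite /tent (sstepn0 (l0 n) xb) mulr0 addr0 sstepn1//; lra.
rewrite memNset/=; last by rewrite in_itv/= ax/= leNgt xb.
have xb0 : 0 < x - b by lra.
apply: filterS (small _ xb0) => n ln.
by rewrite /tent !sstepn1//; lra.
Qed.

Let indic_in (p q x : R) : p <= x <= q -> \1_`[p, q] x = 1 :> R.
Proof. by move=> pxq; rewrite indicE mem_set//= in_itv. Qed.

Let indic_out (p q x : R) : ~ (p <= x <= q) -> \1_`[p, q] x = 0 :> R.
Proof. by move=> pxq; rewrite indicE memNset//= in_itv. Qed.

(** The weak equation is tested with products of two tents, which converge to the indicator of []a,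
    b]] times []c, d]]. The derivative of the first tent is an approximate identity at [a] minus one
    at [b], whence the values of [v] on the two vertical sides. Both limits are taken by dominated
    convergence. *)
Lemma rect_identity (v gam : pt -> R) (a b b' c d d' : R) :
  a < b -> b < b' -> c < d -> d < d' ->
  (forall z, (`[a, b'] `*` `[c, d']) z -> {for z, continuous v}) ->
  measurable_fun (`[a, b'] `*` `[c, d']) v ->
  lam2.-integrable (`[a, b'] `*` `[c, d']) (EFin \o gam) ->
  (forall al be : R -> R, (forall n, Ck n al) -> (forall n, Ck n be) ->
    (forall x, ~ (a <= x <= b') -> al x = 0) ->
    (forall x, ~ (c <= x <= d') -> be x = 0) ->
    Rintegral lam2 (`[a, b'] `*` `[c, d']) (fun z => v z * ('D_1 al z.1 * be z.2)) =
    - Rintegral lam2 (`[a, b'] `*` `[c, d']) (fun z => gam z * (al z.1 * be z.2))) ->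
  Rintegral mu `]c, d] (fun y => v (a, y) - v (b, y)) =
  - Rintegral lam2 (`]a, b] `*` `]c, d]) gam.
Proof.
move=> ab bb' cd dd'; set Q := `[a, b'] `*` `[c, d'] => cv mv gi WD.
have mQ : measurable Q by exact: measurableX.
have cQ : compact Q by apply: compact_setX; exact: segment_compact.
have Qlty : (lam2 Q < +oo)%E.
  by rewrite /Q leb2_setX// !lebesgue_measure_itv/= !lte_fin; case: ifP; case: ifP;
    rewrite ?mul0e ?mule0 ?ltry// -!EFinB -EFinM ltry.
have [M M0 HM] : exists2 M, 0 <= M & forall z, Q z -> `|v z| <= M.
  have /compact_bounded[K [Kr HK]] : compact (v @` Q).
    apply: continuous_compact => //; apply: continuous_in_subspaceT => z.
    by rewrite inE; exact: cv.
  exists (`|K| + 1) => // z Qz; apply: (HK (`|K| + 1)).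
    by rewrite (le_lt_trans (ler_norm K))// ltrDl.
  by exists z.
have [B B0 HB] := @Dsstep_bound R.
have [N N0 [Nb Nd]] : exists2 N : nat, (0 < N)%N & N%:R^-1 <= b' - b /\ N%:R^-1 <= d' - d.
  have m0 : 0 < Num.min (b' - b) (d' - d) by rewrite lt_min !subr_gt0 bb'.
  have := near_infty_natSinv_lt (PosNum m0).
  case=> n _ /(_ n (leqnn n)) /=; rewrite lt_min => /andP[/ltW ? /ltW ?].
  by exists n.+1.
(* The shift by [N] keeps the supports of all the tents inside [[a, b']] and [[c, d']]. *)
pose l n : R := (n + N)%:R.
have l0 n : 0 < l n by rewrite ltr0n addn_gt0 N0 orbT.
have lN n : (l n)^-1 <= N%:R^-1.
  by rewrite lef_pV2 ?posrE ?ltr0n ?addn_gt0 ?N0 ?orbT// ler_nat leq_addl.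
have lb n : b + (l n)^-1 <= b' by have := lN n; lra.
have ld n : d + (l n)^-1 <= d' by have := lN n; lra.
have lc : (l n)^-1 @[n --> \oo] --> 0.
  apply/cvgrPdist_le => e e0.
  have := near_infty_natSinv_lt (PosNum e0); apply: filterS => n /= ne.
  rewrite sub0r normrN ger0_norm ?invr_ge0 ?(ltW (l0 n))//.
  apply: le_trans (ltW ne); rewrite lef_pV2 ?posrE ?ltr0n ?addn_gt0 ?N0 ?orbT//.
  by rewrite ler_nat -addn1 leq_add2l.
pose al n := tent (l n) a b; pose be n := tent (l n) c d.
have al0 n x : ~ (a <= x <= b') -> al n x = 0 by apply: tent_support => //; exact: ltW.
have be0 n x : ~ (c <= x <= d') -> be n x = 0 by apply: tent_support => //; exact: ltW.
have cal n : continuous (al n) := (Ck_tent 0 (l n) a b).1.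
have cbe n : continuous (be n) := (Ck_tent 0 (l n) c d).1.
have cDal n : continuous ('D_1 (al n)) by have [_ [_ /(_ 1) []]] := Ck_tent 1 (l n) a b.
have c1 (f : R -> R) : continuous f -> continuous (fun z : pt => f z.1).
  by move=> cf z; apply: continuous_comp; [exact: cvg_fst|exact: cf].
have c2 (f : R -> R) : continuous f -> continuous (fun z : pt => f z.2).
  by move=> cf z; apply: continuous_comp; [exact: cvg_snd|exact: cf].
have mab n : measurable_fun setT (fun z : pt => al n z.1 * be n z.2).
  by apply: continuous_measurable2 => z; apply: cvgM; [exact: (c1 _ (cal n))|exact: (c2 _ (cbe n))].
have mDab n : measurable_fun setT (fun z : pt => 'D_1 (al n) z.1 * be n z.2).
  by apply: continuous_measurable2 => z; apply: cvgM; [exact: (c1 _ (cDal n))|exact: (c2 _ (cbe n))].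
have mg : measurable_fun Q gam by apply/measurable_EFinP; exact: (measurable_int lam2 gi).
pose chi (z : pt) : R := \1_`]a, b] z.1 * \1_`]c, d] z.2.
have mchi : measurable_fun setT chi.
  by apply: measurable_funM; apply: measurableT_comp => //; exact: measurable_indic.
have rhs : (\int[lam2]_(z in Q) (gam z * (al n z.1 * be n z.2))%:E)%E @[n --> \oo] -->
    (\int[lam2]_(z in Q) (gam z * chi z)%:E)%E.
  have := @dominated_convergence _ pt R lam2 Q mQ
    (fun n z => (gam z * (al n z.1 * be n z.2))%:E) (fun z => (gam z * chi z)%:E)
    (fun z => `|gam z|%:E).
  case=> //.
  - move=> n; apply/measurable_EFinP; apply: measurable_funM => //.
    exact: measurable_funTS.
  - by apply/measurable_EFinP; apply: measurable_funM => //; exact: measurable_funTS.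
  - apply: aeW => z _.
    have h1 := tent_cvg z.1 l0 lc ab; have h2 := tent_cvg z.2 l0 lc cd.
    apply: cvg_near_cst; apply: filterS2 h1 h2 => n h1 h2.
    by rewrite /chi /al /be h1 h2.
  - exact: (integrable_norm gi).
  - apply: aeW => z n _; rewrite abse_EFin lee_fin normrM ler_piMr// normrM.
    by rewrite mulr_ile1// tent_norm.
have iL n : lam2.-integrable Q (EFin \o (fun z => v z * ('D_1 (al n) z.1 * be n z.2))).
  apply: (measurable_bounded_integrable mQ Qlty).
    by apply: measurable_funM => //; exact: measurable_funTS.
  exists (M * ((2 * B) * l n)); split; first exact: num_real.
  move=> K MK z Qz /=; apply: le_trans (ltW MK).
  rewrite normrM; apply: ler_pM => //; first exact: HM.
  rewrite normrM -[leRHS]mulr1; apply: ler_pM => //; last exact: tent_norm.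
  rewrite Dtent !Dsstepn -mulrBl normrM (gtr0_norm (l0 n)) ler_pM2r//.
  apply: le_trans (ler_normB _ _) _.
  by rewrite mulr_natl mulr2n; apply: lerD; exact: HB.
pose F n : pt -> \bar R := (EFin \o (fun z => v z * ('D_1 (al n) z.1 * be n z.2))) \_ Q.
have iF n : lam2.-integrable setT (F n).
  exact: ((@integrable_mkcond _ pt R lam2 Q _ mQ).1 (iL n)).
pose J y := fun x : R => v (x, y).
have cJ y x : c <= y <= d' -> a <= x <= b' -> {for x, continuous (J y)}.
  by move=> cy ax; apply: slice_continuous; apply: cv; split; rewrite /= in_itv.
pose I n y := Rintegral mu `[a, b'] (fun x => J y x * 'D_1 (al n) x).
pose Ia n y (t : R) := Rintegral mu `[a, b'] (fun x => J y x * 'D_1 (sstepn (l n) t) x).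
have cD n t : continuous ('D_1 (sstepn (l n) t)).
  by have [_ [_ /(_ 1) []]] := Ck_sstepn 1 (l n) t.
have iJ n y t : c <= y <= d' ->
    mu.-integrable `[a, b'] (EFin \o (fun x => J y x * 'D_1 (sstepn (l n) t) x)).
  move=> cy; apply: continuous_segment_integrable => x ax.
  by apply: cvgM; [exact: cJ|exact: cD].
have IE n y : c <= y <= d' -> I n y = Ia n y a - Ia n y b.
  move=> cy; rewrite /I /Ia -RintegralB//; [|exact: iJ|exact: iJ].
  by apply: eq_Rintegral => x _; rewrite Dtent mulrBr.
have inner n y : (\int[mu]_x F n (x, y) =
    (\1_`[c, d'] y * (I n y * be n y))%:E)%E.
  have [cy|ncy] := pselect (c <= y <= d'); last first.
    rewrite indic_out// mul0r.
    rewrite integral0_eq// => x _; rewrite /F patchE memNset// => -[_].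
    by rewrite /= in_itv.
  rewrite indic_in// mul1r.
  transitivity (\int[mu]_(x in `[a, b']) (J y x * 'D_1 (al n) x * be n y)%:E)%E.
    rewrite [RHS]integral_mkcond; apply: eq_integral => x _.
    rewrite /F !patchE; have [ax|nax] := pselect (a <= x <= b').
      have Qxy : (x, y) \in Q by rewrite inE; split; rewrite /= in_itv.
      have xI : x \in `[a, b']%classic by rewrite inE/= in_itv.
      by rewrite Qxy xI /= mulrA.
    have Qxy : ((x, y) \in Q) = false.
      by apply/negbTE; rewrite notin_setE => -[/= + _]; rewrite in_itv.
    have xI : (x \in `[a, b']%classic) = false.
      by apply/negbTE; rewrite notin_setE/= in_itv.
    by rewrite Qxy xI.
  have iJal : mu.-integrable `[a, b'] (EFin \o (fun x => J y x * 'D_1 (al n) x)).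
    apply: continuous_segment_integrable => x ax.
    by apply: cvgM; [exact: cJ|exact: cDal].
  rewrite -RintegralZr//.
  rewrite /Rintegral fineK//; apply: integrable_fin_num => //.
  apply: continuous_segment_integrable => x ax.
  apply: cvgM; last exact: cvg_cst.
  by apply: cvgM; [exact: cJ|exact: cDal].
have lim1 y t : c <= y <= d' -> a <= t -> t <= b ->
    Ia n y t @[n --> \oo] --> J y t.
  move=> cy at_ tb; apply/cvgrPdist_le => e e0.
  have cJt : {for t, continuous (J y)} by apply: cJ => //; rewrite at_ (le_trans tb (ltW bb')).
  have eB0 : 0 < e / B by rewrite divr_gt0.
  move/cvgrPdist_le : cJt => /(_ _ eB0) /nbhs_ballP[r /= r0 Hr].
  have r20 : 0 < r / 2 by lra.
  move/cvgrPdist_le : lc => /(_ _ r20); apply: filterS => n.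
  rewrite sub0r normrN => /(le_trans (ler_norm _)) ln.
  have := @sstepn_average R (J y) a b' t (l n) (e / B) B (l0 n) at_.
  rewrite distrC divfK ?gt_eqF//; apply => //.
  - by have := lb n; lra.
  - by move=> x ax; exact: cJ.
  - exact: ltW.
  - move=> x /andP[tx xt]; rewrite distrC; apply: Hr; rewrite /ball/= distrC.
    clear - indic_in indic_out ln tx xt r0; rewrite ger0_norm; lra.
(* The trivial oscillation bound [2 * M] in [sstepn_average] gives a bound uniform in [n], as
   domination requires; the derivatives of the tents themselves grow like [l n]. *)
have bnd n y t : c <= y <= d' -> a <= t -> t <= b -> `|Ia n y t| <= M + 2 * M * B.
  move=> cy at_ tb; have li0 : 0 < (l n)^-1 by rewrite invr_gt0.
  have QJ x : a <= x <= b' -> `|J y x| <= M.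
    by move=> ax; apply: HM; split; rewrite /= in_itv.
  have := @sstepn_average R (J y) a b' t (l n) (2 * M) B (l0 n) at_.
  move=> /(_ _ _ _ _ HB) H.
  have {}H : `|Ia n y t - J y t| <= 2 * M * B.
    apply: H.
    - by have := lb n; lra.
    - by move=> x ax; exact: cJ.
    - by rewrite mulr_ge0.
    - move=> x /andP[tx xt]; apply: le_trans (ler_normB _ _) _.
      have h1 : `|J y x| <= M.
        apply: QJ; have hb := lb n; clear - indic_in indic_out at_ tb tx xt hb.
        by apply/andP; split; lra.
      have h2 : `|J y t| <= M by apply: QJ; rewrite at_ (le_trans tb (ltW bb')).
      by rewrite mulr_natl mulr2n; exact: lerD.
  have h2 : `|J y t| <= M by apply: QJ; rewrite at_ (le_trans tb (ltW bb')).
  rewrite -(subrK (J y t) (Ia n y t)); apply: le_trans (ler_normD _ _) _; lra.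
have lhs : (\int[lam2]_(z in Q) (v z * ('D_1 (al n) z.1 * be n z.2))%:E)%E @[n --> \oo] -->
    (\int[mu]_y (\1_`]c, d] y * (v (a, y) - v (b, y)))%:E)%E.
  have E n : (\int[lam2]_(z in Q) (v z * ('D_1 (al n) z.1 * be n z.2))%:E =
      \int[mu]_y (\1_`[c, d'] y * (I n y * be n y))%:E)%E.
    rewrite integral_mkcond -/(F n) leb2_fubini_y//.
    by apply: eq_integral => y _; exact: inner.
  under eq_fun do rewrite E.
  have mK n : measurable_fun setT (fun y => (\1_`[c, d'] y * (I n y * be n y))%:E).
    have := measurable_fubini_y (iF n).
    by congr measurable_fun; apply/funext => y; exact: inner.
  have cvK y : (\1_`[c, d'] y * (I n y * be n y))%:E @[n --> \oo] -->
      (\1_`]c, d] y * (v (a, y) - v (b, y)))%:E.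
    apply: cvg_EFin; first exact: nearW.
    have [cy|ncy] := pselect (c <= y <= d'); last first.
      rewrite (_ : _ \o _ = cst 0); last first.
        by apply/funext => n /=; rewrite indic_out// mul0r.
      rewrite indicE memNset ?mul0r/=; first exact: cvg_cst.
      by rewrite ?in_itv/= => /andP[h1 h2]; apply: ncy; rewrite (ltW h1) (le_trans h2 (ltW dd')).
    rewrite (_ : _ \o _ = (fun n => (Ia n y a - Ia n y b) * be n y)); last first.
      by apply/funext => n /=; rewrite indic_in// mul1r IE.
    rewrite [X in _ --> X]mulrC; apply: cvgM.
      by apply: cvgB; apply: lim1 => //; exact: ltW.
    by apply: cvg_near_cst; exact: tent_cvg.
  have := @dominated_convergence _ _ R mu setT measurableT
    (fun n y => (\1_`[c, d'] y * (I n y * be n y))%:E)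
    (fun y => (\1_`]c, d] y * (v (a, y) - v (b, y)))%:E)
    (fun y => (\1_`[c, d'] y * (2 * (M + 2 * M * B)))%:E) mK.
  case=> //.
  - by apply: emeasurable_fun_cvg mK _ => y _; exact: cvK.
  - by apply: aeW => y _; exact: cvK.
  - have H1 : mu.-integrable setT (EFin \o (\1_`[c, d'] : R -> R)).
      exact: integrable_indic_itv.
    have := integrableZr measurableT (2 * (M + 2 * M * B)) H1.
    by apply: eq_integrable => // y _ /=; rewrite EFinM.
  - apply: aeW => y n _; rewrite abse_EFin lee_fin.
    have [cy|ncy] := pselect (c <= y <= d'); last first.
      by rewrite indic_out// !mul0r normr0.
    rewrite indic_in// !mul1r normrM -[leRHS]mulr1.
    apply: ler_pM => //; last exact: tent_norm.
    rewrite IE//; apply: le_trans (ler_normB _ _) _.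
    rewrite mulr_natl mulr2n; apply: lerD; first exact: (bnd n y a cy (lexx a) (ltW ab)).
    exact: (bnd n y b cy (ltW ab) (lexx b)).
have key n : (\int[lam2]_(z in Q) (v z * ('D_1 (al n) z.1 * be n z.2))%:E =
    - \int[lam2]_(z in Q) (gam z * (al n z.1 * be n z.2))%:E)%E.
  have ig : lam2.-integrable Q (EFin \o (fun z => gam z * (al n z.1 * be n z.2))).
    have -> : EFin \o (fun z => gam z * (al n z.1 * be n z.2)) =
        ((EFin \o gam) \* (EFin \o (fun z : pt => (al n z.1 * be n z.2)%R)))%E.
      by apply/funext => z /=; rewrite EFinM.
    apply: integrableMl => //; first exact: measurable_funTS.
    exists 1; split => // K K1 z _ /=; apply: le_trans (ltW K1).
    by rewrite normrM mulr_ile1// tent_norm.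
  have := WD (al n) (be n) (fun m => Ck_tent m _ _ _) (fun m => Ck_tent m _ _ _)
    (al0 n) (be0 n).
  rewrite /Rintegral => H.
  rewrite -(fineK (integrable_fin_num mQ (iL n))) -(fineK (integrable_fin_num mQ ig)).
  by rewrite -EFinN -H.
have lim : (\int[mu]_y (\1_`]c, d] y * (v (a, y) - v (b, y)))%:E =
    - \int[lam2]_(z in Q) (gam z * chi z)%:E)%E.
  have E : (fun n => \int[lam2]_(z in Q) (v z * ('D_1 (al n) z.1 * be n z.2))%:E)%E =
      (fun n => - \int[lam2]_(z in Q) (gam z * (al n z.1 * be n z.2))%:E)%E.
    by apply/funext => n; exact: key.
  rewrite E in lhs; have rhs' := cvgeN rhs.
  apply: (@cvg_unique _ (@ereal_hausdorff R) _ _ _ _ lhs).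
  exact: rhs'.
rewrite /Rintegral -fineN; congr fine.
transitivity (\int[mu]_y (\1_`]c, d] y * (v (a, y) - v (b, y)))%:E)%E.
  rewrite integral_mkcond; apply: eq_integral => y _.
  by rewrite patchE indicE; case: ifPn => _; rewrite ?mul1r ?mul0r.
rewrite lim; congr (- _)%E.
rewrite [LHS]integral_mkcond [RHS]integral_mkcond; apply: eq_integral => z _.
rewrite !patchE /chi !indicE.
have [[/= h1 h2]|h] := pselect ((`]a, b] `*` `]c, d]) z).
  have Qz : Q z.
    move: h1 h2; rewrite /= !in_itv/= => /andP[z1 z2] /andP[z3 z4].
    split; rewrite /= in_itv/=; first by rewrite (ltW z1) (le_trans z2 (ltW bb')).
    by rewrite (ltW z3) (le_trans z4 (ltW dd')).
  by rewrite !mem_set// !mulr1.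
rewrite (memNset h); case: ifPn => // _.
have [h1|h1] := boolP (z.1 \in `]a, b]%classic); last by rewrite mul0r mulr0.
rewrite (_ : (z.2 \in _) = false) ?mulr0//.
by apply/negbTE/negP; rewrite inE => h2; apply: h; split => //; rewrite inE in h1.
Qed.

End rectangle.

(** * Absolute continuity on lines *)

Section lines.
Context {R : realType}.
Local Notation pt := (R * R)%type.
Local Notation lam2 := (@leb2 R).
Local Notation mu := (@lebesgue_measure R).

Let mitv (i : interval R) : @measurable _ (measurableTypeR R) [set` i].
Proof. exact: measurable_itv. Qed.

Lemma slice_measurable (f : pt -> R) (y : R) : measurable_fun setT f ->
  measurable_fun setT (fun x => f (x, y)).
Proof.
move=> mf; have m1 : measurable_fun [set: R] (fun x : R => (x, y) : pt).
  by apply: measurable_fun_pair; [exact: measurable_id|exact: measurable_cst].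
exact: measurableT_comp mf m1.
Qed.

Lemma vslice_continuous (v : pt -> R) (x y : R) : {for (x, y), continuous v} ->
  {for y, continuous (fun t => v (x, t))}.
Proof.
move=> cv; apply: (@continuous_comp _ _ _ (fun t => (x, t) : pt) v); last exact: cv.
move=> U /nbhs_osquare[e e0 H]; apply/nbhs_ballP; exists e => //= s.
rewrite /ball/= => ts; apply: H.
by split; rewrite /= ?subrr ?normr0// distrC.
Qed.

(** Let [f y] be the defect of the fundamental theorem of calculus on the line of height [y]. The
    rectangle identity for every upper side [t] says that all integrals of [f] over []c, t]] vanish,
    and [zero_ae] concludes. *)
Lemma rect_line_ae (v gam : pt -> R) (a b b' c d : R) :
  a < b -> b < b' -> c < d ->
  (forall z, (`[a, b'] `*` `[c, d]) z -> {for z, continuous v}) ->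
  measurable_fun (`[a, b'] `*` `[c, d]) v ->
  lam2.-integrable (`[a, b'] `*` `[c, d]) (EFin \o gam) ->
  (forall al be : R -> R, (forall n, Ck n al) -> (forall n, Ck n be) ->
    (forall x, ~ (a <= x <= b') -> al x = 0) ->
    (forall x, ~ (c <= x <= d) -> be x = 0) ->
    Rintegral lam2 (`[a, b'] `*` `[c, d]) (fun z => v z * ('D_1 al z.1 * be z.2)) =
    - Rintegral lam2 (`[a, b'] `*` `[c, d]) (fun z => gam z * (al z.1 * be z.2))) ->
  {ae mu, forall y, c < y < d ->
    mu.-integrable `]a, b] (fun x => (gam (x, y))%:E) /\
    v (b, y) - v (a, y) = Rintegral mu `]a, b] (fun x => gam (x, y))}.
Proof.
move=> ab bb cd cv mv gi WD.
have RI t : c < t < d -> Rintegral mu `]c, t] (fun y => v (a, y) - v (b, y)) =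
    - Rintegral lam2 (`]a, b] `*` `]c, t]) gam.
  by move=> /andP[ct td]; exact: rect_identity cv mv gi WD.
pose P t : set pt := `]a, b] `*` `]c, t].
have mP t : measurable (P t) by exact: measurableX.
have iP t : t <= d -> lam2.-integrable (P t) (EFin \o gam).
  move=> td; apply: integrableS gi => //; first exact: measurableX.
  move=> z [/=]; rewrite !in_itv/= => /andP[? ?] /andP[? ?].
  by split; rewrite /= ?in_itv/=; apply/andP; split; lra.
pose g t := (EFin \o gam) \_ (P t).
have ig t : t <= d -> lam2.-integrable setT (g t).
  by move=> td; exact: ((@integrable_mkcond _ pt R lam2 (P t) _ (mP t)).1 (iP t td)).
have igd := ig d (lexx d).
pose G y := (\int[mu]_x g d (x, y))%E.
have mG : measurable_fun setT G by exact: measurable_fubini_y.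
have ae1 := ae_integrable_fubini_y igd.
have mag : measurable_fun setT (fun z => `|g d z|)%E.
  by apply: measurableT_comp => //; exact: (measurable_int lam2 igd).
have iG : mu.-integrable setT G.
  apply/integrableP; split => //.
  apply: (@le_lt_trans _ _ (\int[mu]_y \int[mu]_x `|g d (x, y)|)%E).
    apply: ae_ge0_le_integral => //.
    - exact: measurableT_comp.
    - by move=> y _; apply: integral_ge0.
    - exact: (measurable_tonelli_y mag).
    apply: ae_imp ae1 => y iy _; apply: le_abse_integral => //.
    exact: (measurable_int mu iy).
  have <- := leb2_tonelli_y mag (fun z => abse_ge0 _).
  by have /integrableP[] := igd.
have GE t : t <= d -> (\int[lam2]_(z in P t) (gam z)%:E = \int[mu]_(y in `]c, t]) G y)%E.
  move=> td; rewrite integral_mkcond -/(g t) leb2_fubini_y; last exact: ig.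
  rewrite [RHS]integral_mkcond; apply: eq_integral => y _.
  rewrite patchE; case: ifPn; rewrite (inE, notin_setE)/= in_itv/= => cy.
    apply: eq_integral => x _; rewrite /g !patchE /P.
    have [xab|nx] := pselect ((`]a, b]%classic : set R) x).
      rewrite !mem_set//=; split => //=; rewrite in_itv//=.
      by case/andP: cy => -> /= yt; lra.
    by rewrite !memNset//= => -[].
  by apply: integral0_eq => x _; rewrite /g patchE memNset// => -[_] /=; rewrite in_itv.
pose f y := (v (a, y) - v (b, y)) + fine (G y).
have iv : mu.-integrable `[c, d] (EFin \o (fun y => v (a, y) - v (b, y))).
  apply: continuous_segment_integrable => y cy.
  by apply: cvgB; apply: vslice_continuous; apply: cv; split; rewrite /= ?in_itv//=; lra.
have ifG : mu.-integrable `[c, d] (EFin \o (fun y => fine (G y))).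
  apply: (le_integrable (mitv _) _ _ (integrableS measurableT (mitv _) (@subsetT _ _) iG)).
    apply/measurable_EFinP; apply: measurable_funTS.
    exact: measurableT_comp (fine_measurable measurableT) mG.
  move=> y _ /=; case: (G y) => [r| |] /=; first exact: lexx.
    by rewrite normr0 leey.
  by rewrite normr0 leey.
have if_ : mu.-integrable `[c, d] (EFin \o f).
  by apply: eq_integrable (integrableD (mitv _) iv ifG) => // y _; rewrite /= EFinD.
have f0 t : c < t < d -> Rintegral mu `]c, t] f = 0.
  move=> ctd; have /andP[ct td] := ctd.
  have sub : `]c, t] `<=` (`[c, d] : set R).
    by move=> y /=; rewrite !in_itv/= => /andP[? ?]; apply/andP; split; lra.
  have iv' := integrableS (mitv _) (mitv `]c, t]) sub iv.
  have ifG' := integrableS (mitv _) (mitv `]c, t]) sub ifG.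
  rewrite RintegralD// RI//.
  suff -> : Rintegral mu `]c, t] (fun y => fine (G y)) = Rintegral lam2 (P t) gam.
    by rewrite addNr.
  rewrite /Rintegral GE ?(ltW td)//; congr fine.
  have iGt := integrableS measurableT (mitv `]c, t]) (@subsetT _ _) iG.
  apply: ae_eq_integral => //.
  - exact: (measurable_int mu ifG').
  - exact: (measurable_int mu iGt).
  by apply: ae_imp (integrable_ae (mitv _) iGt) => y h cy; rewrite fineK// h.
have H0 := zero_ae if_ f0.
have /negligibleU/(_ H0) : mu.-negligible (~` [set y | mu.-integrable setT (fun x => g d (x, y))]).
  exact: ae1.
apply: negligibleS => y /= ny; apply: contrapT => /not_orP[/contrapT iy /contrapT fy].
apply: ny => cyd; have {}fy := fy cyd.
have gE x : g d (x, y) = ((fun x => (gam (x, y))%:E) \_ `]a, b]) x.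
  rewrite /g !patchE /P; have [xab|nx] := pselect ((`]a, b]%classic : set R) x).
    by rewrite !mem_set//=; split => //=; rewrite in_itv/=; case/andP: cyd => -> /ltW.
  by rewrite !memNset//= => -[].
split.
  apply: ((@integrable_mkcond _ _ R mu _ _ (mitv _)).2 _).
  by apply: eq_integrable iy => // x _; exact: gE.
have -> : Rintegral mu `]a, b] (fun x => gam (x, y)) = fine (G y).
  rewrite /Rintegral integral_mkcond; congr fine.
  by apply: eq_integral => x _; rewrite gE.
move: fy; rewrite /f => /eqP; rewrite addr_eq0 => /eqP fy.
by rewrite -[RHS]opprK -fy opprB.
Qed.

Lemma tube (O : set pt) (a b y : R) : open O ->
  (forall x, a <= x <= b -> O (x, y)) ->
  exists2 r, 0 < r & forall x t, a <= x <= b -> `|t - y| <= r -> O (x, t).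
Proof.
move=> oO Oab.
have /compact_near_coveringP H := @segment_compact R a b.
have {}H := H R (0^'+) (fun r x => forall t, `|t - y| <= r -> O (x, t)) _.
have : \forall r \near 0^'+, `[a, b] `<=` (fun x => forall t : R, `|t - y| <= r -> O (x, t)).
  apply: H => x; rewrite /= ?in_itv/= => ax.
  have /nbhs_osquare[e e0 He] : nbhs (x, y) O by exact: oO _ (Oab _ ax).
  exists (ball x e, [set r | r < e]); first split => /=.
  - exact: nbhsx_ballx.
  - exact: nbhs_right_lt.
  - move=> [x' r] [/= xx' re] t tr; apply: He; split => /=.
      by rewrite distrC.
    exact: le_lt_trans re.
move=> Hr; have /filter_ex[r [r0 rH]] : \forall r \near (0 : R)^'+, 0 < r /\
    `[a, b] `<=` (fun x => forall t : R, `|t - y| <= r -> O (x, t)).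
  by near=> r; split; near: r => //; exact: nbhs_right_gt.
exists r => // x t ax tr; apply: (rH x) => //=.
Unshelve. all: by end_near. Qed.

(** The point [z] is given in rotated coordinates, and [c * g1 + s * g2] is the derivative along the
    first rotated axis. Extension by 0 off [X] allows integration over whole lines and squares that
    leave [X]. *)
Definition dirdev (X : set pt) (g1 g2 : pt -> R) (c s k : R) (z : pt) : R :=
  (fun q => `|c * g1 q + s * g2 q - k|) \_ X (rot c s z).

Lemma dirdev_ge0 X g1 g2 c s k z : 0 <= dirdev X g1 g2 c s k z.
Proof. by rewrite /dirdev patchE; case: ifP. Qed.

Lemma measurable_dirdev X g1 g2 c s k : measurable X ->
  measurable_fun X g1 -> measurable_fun X g2 ->
  measurable_fun setT (dirdev X g1 g2 c s k).
Proof.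
move=> mX m1 m2; apply: measurableT_comp; last exact: measurable_rot.
apply/(measurable_restrictT _ mX); apply: measurableT_comp => //.
apply: measurable_funB => //; apply: measurable_funD;
  by apply: measurable_funM.
Qed.

Definition continuous_closure (X : set pt) (u : pt -> R) :=
  forall z, closure X z -> forall e, 0 < e -> exists2 d, 0 < d &
    forall q, closure X q -> csquare z d q -> `|u q - u z| < e.

Lemma le1_cs (c s : R) : c ^+ 2 + s ^+ 2 = 1 -> `|c| <= 1 /\ `|s| <= 1.
Proof.
move=> cs; split; rewrite -(@expr_le1 _ 2)// real_normK ?num_real//.
  by have := sqr_ge0 s; lra.
by have := sqr_ge0 c; lra.
Qed.

Lemma rot_dist (c s : R) (x x' y : R) : c ^+ 2 + s ^+ 2 = 1 ->
  csquare (rot c s (x', y)) `|x - x'| (rot c s (x, y)).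
Proof.
move=> cs.
have [c1 s1] := le1_cs cs.
split; rewrite /rot/=.
  rewrite (_ : _ - _ = c * (x - x')); last by ring.
  by rewrite normrM ler_piMl.
rewrite (_ : _ - _ = s * (x - x')); last by ring.
by rewrite normrM ler_piMl.
Qed.

(** The exceptional heights of countably many rational rectangles are discarded at once. At any
    other height, a compact part of the segment with rational ends is a line of such a rectangle, by
    the tube lemma. The ends are then reached by continuity of [u] on [closure X], so they may lie
    on the boundary. *)
Lemma weak_deriv_line (X : set pt) (u g1 g2 : pt -> R) (c s k : R) :
  open X -> bounded_plane X -> L2 X u -> L2 X g1 -> L2 X g2 ->
  weak_deriv X u (e1 R) g1 -> weak_deriv X u (e2 R) g2 ->
  c ^+ 2 + s ^+ 2 = 1 -> continuous_closure X u ->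
  {ae mu, forall y, forall a b, a < b ->
    closure X (rot c s (a, y)) -> closure X (rot c s (b, y)) ->
    (forall x, a < x < b -> X (rot c s (x, y))) ->
    ((`|u (rot c s (b, y)) - u (rot c s (a, y)) - k * (b - a)|)%:E <=
     \int[mu]_(x in `]a, b[) (dirdev X g1 g2 c s k (x, y))%:E)%E}.
Proof.
move=> oX bX u2 g12 g22 w1 w2 cs cu.
have mX := open_measurable2 oX.
pose O := rot c s @^-1` X.
have oO : open O by apply: open_comp => // z _; exact: rot_continuous.
have mO := open_measurable2 oO.
pose v z := u (rot c s z).
pose gam z := c * g1 (rot c s z) + s * g2 (rot c s z).
have cuX z : X z -> {for z, continuous u}.
  move=> Xz; apply/cvgrPdist_lt => e e0.
  have [d d0 Hd] := cu z (subset_closure Xz) e e0.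
  have [r r0 rX] := open_csquare oX Xz.
  apply/nbhs_osquare; exists (Num.min d r); first by rewrite lt_min d0.
  move=> q [/=]; rewrite !lt_min => /andP[q1 q2] /andP[q3 q4].
  rewrite distrC; apply: Hd; last by split; exact: ltW.
  by apply: subset_closure; apply: rX; split; exact: ltW.
have cv z : O z -> {for z, continuous v}.
  by move=> Oz; apply: continuous_comp; [exact: rot_continuous|exact: cuX].
have mv : measurable_fun O v.
  apply: (measurable_comp mX _ u2.1); first by move=> _ [z Oz <-].
  exact: measurable_funTS (measurable_rot c s).
have igam : lam2.-integrable O (EFin \o gam).
  have i1 := integrable_preserves (preserves_leb2_rot cs) mX (L2_integrable oX bX g12).
  have i2 := integrable_preserves (preserves_leb2_rot cs) mX (L2_integrable oX bX g22).
  apply: eq_integrable (integrableD mO (integrableZl mO c i1) (integrableZl mO s i2)) => //.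
(* Five rationals describe a rectangle together with the room up to [b'] on its right. The geometric
   conditions are premises, so unsuitable rationals satisfy [S] vacuously. *)
pose S (q : rat * rat * rat * rat * rat) (y : R) :=
  let a := ratr q.1.1.1.1 : R in let b := ratr q.1.1.1.2 in let b' := ratr q.1.1.2 in
  let c0 := ratr q.1.2 in let d0 := ratr q.2 in
  a < b -> b < b' -> c0 < d0 -> `[a, b'] `*` `[c0, d0] `<=` O -> c0 < y < d0 ->
  mu.-integrable `]a, b] (fun x => (gam (x, y))%:E) /\
    v (b, y) - v (a, y) = Rintegral mu `]a, b] (fun x => gam (x, y)).
have aeS q : {ae mu, forall y, S q y}.
  rewrite /S; set a := ratr _ : R; set b := ratr _ : R; set b' := ratr _ : R.
  set c0 := ratr _ : R; set d0 := ratr _ : R.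
  have [[ab bb cd QO]|nh] := pselect [/\ a < b, b < b', c0 < d0 & `[a, b'] `*` `[c0, d0] `<=` O];
    last by apply: aeW => y ab bb cd QO; exfalso; exact: nh.
  have := @rect_line_ae v gam a b b' c0 d0 ab bb cd (fun z Qz => cv z (QO z Qz)).
  move=> /(_ (measurable_funS mO QO mv)).
  have mQ : measurable (`[a, b'] `*` `[c0, d0] : set pt) by exact: measurableX.
  move=> /(_ (integrableS mO mQ QO igam)) H.
  have {}H := H (fun al be sal sbe al0 be0 =>
    @weak_deriv_rot R X u g1 g2 c s a b' c0 d0 al be oX bX u2 g12 g22 w1 w2 cs QO sal sbe al0 be0).
  by apply: ae_imp H => y H _ _ _ _; exact: H.
have aeN : {ae mu, forall y, forall n : nat, if unpickle n is Some q then S q y else True}.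
  apply: ae_foralln => n; case: (unpickle n) => [q|]; first exact: aeS.
  exact: aeW.
apply: ae_imp aeN => y Hy a b ab Xa Xb Xab.
have Sy q : S q y by have := Hy (pickle q); rewrite pickleK.
pose dd := fun x => dirdev X g1 g2 c s k (x, y).
have mdd : measurable_fun setT dd.
  apply: (slice_measurable (f := dirdev X g1 g2 c s k)).
  by apply: measurable_dirdev => //; [exact: g12.1|exact: g22.1].
have [->|] := eqVneq (\int[mu]_(x in `]a, b[) (dd x)%:E)%E +oo%E; first by rewrite leey.
rewrite -ltey => Ifin.
have I0 : (0 <= \int[mu]_(x in `]a, b[) (dd x)%:E)%E.
  by apply: integral_ge0 => x _; rewrite lee_fin dirdev_ge0.
have [I IE] : exists I : R, (\int[mu]_(x in `]a, b[) (dd x)%:E = I%:E)%E.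
  by exists (fine (\int[mu]_(x in `]a, b[) (dd x)%:E)%E); rewrite fineK// ge0_fin_numE.
rewrite IE lee_fin; apply/ler_addgt0Pr => e e0.
(* Four errors: moving each of the two ends changes both [u] and the linear term [k * (b - a)]. *)
have e3 : 0 < e / 4 by lra.
have [d1 d10 H1] := cu _ Xa _ e3; have [d2 d20 H2] := cu _ Xb _ e3.
pose d3 := e / 4 / (`|k| + 1).
have k1 : 0 < `|k| + 1 by rewrite ltr_wpDl.
have d30 : 0 < d3 by rewrite divr_gt0.
have kd3 (t : R) : `|t| <= d3 -> `|k * t| <= e / 4.
  move=> td; rewrite normrM; apply: (@le_trans _ _ ((`|k| + 1) * d3)).
    by apply: ler_pM => //; rewrite lerDl.
  by rewrite /d3 mulrC divfK// gt_eqF.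
pose m := (a + b) / 2.
pose r1 := Num.min m (a + Num.min d1 d3); pose r2 := Num.max m (b - Num.min d2 d3).
have [p pin] : exists p : rat, ratr p \in `]a, r1[.
  by apply: rat_in_itvoo; rewrite /r1 lt_min /m; apply/andP; split;
    [lra|rewrite ltrDl lt_min d10].
have [q qin] : exists q : rat, ratr q \in `]r2, b[.
  by apply: rat_in_itvoo; rewrite /r2 gt_max /m; apply/andP; split;
    [lra|rewrite ltrBlDr ltrDl lt_min d20].
move: pin qin; rewrite !in_itv/= /r1 /r2 lt_min gt_max.
set P := ratr p : R; set Q := ratr q : R.
move=> /andP[aP /andP[Pm Pa]] /andP[/andP[mQ Qb'] Qb].
have {}Pa : P - a <= d1 /\ P - a <= d3.
  have : P - a < Num.min d1 d3 by lra.
  by rewrite lt_min => /andP[? ?]; split; exact: ltW.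
have {}Qb' : b - Q <= d2 /\ b - Q <= d3.
  have : b - Q < Num.min d2 d3 by lra.
  by rewrite lt_min => /andP[? ?]; split; exact: ltW.
have [q' /andP[]] : exists q' : rat, ratr q' \in `]Q, b[ by exact: rat_in_itvoo.
set Q' := ratr q' : R => /= QQ' Q'b.
have PQ : P < Q := lt_trans Pm mQ.
have [r r0 Hr] : exists2 r, 0 < r & forall x t, P <= x <= Q' -> `|t - y| <= r -> O (x, t).
  apply: tube => // x /andP[Px xQ]; apply: Xab; apply/andP; split; first exact: lt_le_trans aP Px.
  by apply: le_lt_trans xQ Q'b.
have [c0] : exists c0 : rat, ratr c0 \in `]y - r, y[ by apply: rat_in_itvoo; rewrite gtrBl.
have [d0] : exists d0 : rat, ratr d0 \in `]y, y + r[ by apply: rat_in_itvoo; rewrite ltrDl.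
rewrite !in_itv/=; set C0 := ratr c0 : R; set D0 := ratr d0 : R.
move=> /andP[yD0 D0r] /andP[C0r C0y].
have [|||||iPQ EPQ] := Sy (p, q, q', c0, d0); rewrite /= -/P -/Q -/Q' -/C0 -/D0 //.
- exact: lt_trans C0y yD0.
- move=> [x t] [/=]; rewrite !in_itv/= => Px /andP[Ct tD].
  by apply: Hr => //; rewrite ler_norml; clear - mitv Ct tD C0r D0r; apply/andP; split; lra.
- by rewrite C0y.
have OPQ x : P <= x <= Q -> X (rot c s (x, y)).
  move=> /andP[Px xQ]; apply: Xab.
  by rewrite (lt_le_trans aP Px) (le_lt_trans xQ Qb).
have bd : `|v (Q, y) - v (P, y) - k * (Q - P)| <= I.
  have ik : mu.-integrable `]P, Q] (EFin \o cst k).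
    apply: (@integrableS _ _ R mu `[P, Q]) => //.
      by move=> x /=; rewrite !in_itv/= => /andP[/ltW -> ->].
    by apply: continuous_segment_integrable => x _; exact: cst_continuous.
  have ipk : mu.-integrable `]P, Q] (EFin \o (fun x => gam (x, y) - k)).
    by have H := integrableB (mitv _) iPQ ik; exact: H.
  have -> : v (Q, y) - v (P, y) - k * (Q - P) =
      Rintegral mu `]P, Q] (fun x => gam (x, y) - k).
    rewrite RintegralB// EPQ Rintegral_cst//= lebesgue_measure_itv/= lte_fin PQ.
    by rewrite -EFinB.
  rewrite -lee_fin -IE.
  have := le_normr_Rintegral (mitv _) ipk; rewrite -lee_fin => /le_trans; apply.
  have inorm := integrable_norm ipk.
  rewrite /Rintegral fineK; last exact: integrable_fin_num.
  apply: (@le_trans _ _ (\int[mu]_(x in `]P, Q]) (dd x)%:E)%E).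
    rewrite le_eqVlt; apply/orP; left; apply/eqP; apply: eq_integral => x.
    rewrite inE/= in_itv/= => /andP[Px xQ].
    by rewrite /dd /dirdev patchE mem_set//; apply: OPQ; rewrite (ltW Px).
  apply: ge0_subset_integral => //.
  - by apply/measurable_EFinP; exact: measurable_funTS.
  - by move=> x _; rewrite lee_fin dirdev_ge0.
  - move=> x /=; rewrite !in_itv/= => /andP[Px xQ].
    by rewrite (lt_trans aP Px) (le_lt_trans xQ Qb).
have n1 : `|v (P, y) - v (a, y)| < e / 4.
  apply: H1; first by apply: subset_closure; apply: OPQ; rewrite lexx ltW.
  by apply: csquare_le (rot_dist _ _ _ cs); rewrite ger0_norm ?subr_ge0 ?(ltW aP) ?Pa.1.
have n2 : `|v (Q, y) - v (b, y)| < e / 4.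
  apply: H2; first by apply: subset_closure; apply: OPQ; rewrite lexx ltW.
  by apply: csquare_le (rot_dist _ _ _ cs); rewrite distrC ger0_norm ?subr_ge0 ?(ltW Qb) ?Qb'.1.
have n3 : `|k * (P - a)| <= e / 4 by apply: kd3; rewrite ger0_norm ?subr_ge0 ?(ltW aP) ?Pa.2.
have n4 : `|k * (b - Q)| <= e / 4 by apply: kd3; rewrite ger0_norm ?subr_ge0 ?(ltW Qb) ?Qb'.2.
rewrite -!/(v _) (_ : v (b, y) - v (a, y) - k * (b - a) =
   (v (Q, y) - v (P, y) - k * (Q - P)) + (v (P, y) - v (a, y)) - (v (Q, y) - v (b, y))
   - k * (P - a) - k * (b - Q)); last by ring.
have tri (x1 x2 x3 x4 x5 : R) : `|x1 + x2 - x3 - x4 - x5| <= `|x1| + `|x2| + `|x3| + `|x4| + `|x5|.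
  do 3 (apply: le_trans (ler_normB _ _) _; rewrite lerD2r).
  exact: ler_normD.
apply: le_trans (tri _ _ _ _ _) _; clear - mitv bd n1 n2 n3 n4; lra.
Qed.

End lines.

(** * Good lines and boxes *)

Section frame.
Context {R : realType}.
Local Notation pt := (R * R)%type.
Local Notation lam2 := (@leb2 R).
Local Notation mu := (@lebesgue_measure R).

(** Chebyshev: if [V] exceeded [B] at almost every height, its integral would be at least
    [B * (q - p)]. *)
Lemma select_line (V : R -> \bar R) (P : R -> Prop) (p q I B : R) : p < q ->
  measurable_fun setT V -> (forall y, 0 <= V y)%E -> {ae mu, forall y, P y} ->
  (\int[mu]_(y in `]p, q[) V y <= I%:E)%E -> I < B * (q - p) ->
  exists y, [/\ p < y < q, P y & (V y <= B%:E)%E].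
Proof.
move=> pq mV V0 aeP VI IB; apply: contrapT => nex.
have I0 : 0 <= I by rewrite -lee_fin; apply: le_trans VI; apply: integral_ge0.
have B0 : 0 <= B by rewrite -(@pmulr_lge0 _ (q - p)) ?subr_gt0// (le_trans I0)// ltW.
have H : (\int[mu]_(y in `]p, q[) (cst B%:E) y <= \int[mu]_(y in `]p, q[) V y)%E.
  apply: ae_ge0_le_integral => //.
  - exact: measurable_funTS.
  - apply: ae_imp aeP => y Py ypq; rewrite leNgt; apply/negP => /ltW yB; apply: nex.
    by exists y; split => //; move: ypq; rewrite /= in_itv.
have := le_trans H VI.
rewrite integral_cst//= lebesgue_measure_itv/= lte_fin pq -EFinB -EFinM lee_fin.
by rewrite leNgt IB.
Qed.

Lemma ae_and (P Q : R -> Prop) : {ae mu, forall y, P y} -> {ae mu, forall y, Q y} ->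
  {ae mu, forall y, P y /\ Q y}.
Proof.
move=> aP aQ; have := negligibleU aP aQ; apply: negligibleS => y /= nPQ.
by apply: contrapT => /not_orP[/contrapT ? /contrapT ?]; apply: nPQ.
Qed.

Definition frame (c s : R) (x : pt) (t u : R) : pt :=
  (x.1 + (c * t - s * u), x.2 + (s * t + c * u)).

Definition frame_t (c s : R) (x q : pt) : R := c * (q.1 - x.1) + s * (q.2 - x.2).
Definition frame_u (c s : R) (x q : pt) : R := - s * (q.1 - x.1) + c * (q.2 - x.2).

Lemma frame_tK (c s : R) (x : pt) t u : c ^+ 2 + s ^+ 2 = 1 ->
  frame_t c s x (frame c s x t u) = t.
Proof.
move=> cs; rewrite /frame_t/= (_ : _ + _ = (c ^+ 2 + s ^+ 2) * t); last by ring.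
by rewrite cs mul1r.
Qed.

Lemma frame_uK (c s : R) (x : pt) t u : c ^+ 2 + s ^+ 2 = 1 ->
  frame_u c s x (frame c s x t u) = u.
Proof.
move=> cs; rewrite -[RHS]mul1r -cs /frame_u/=; ring.
Qed.

Lemma frameK (c s : R) (x q : pt) : c ^+ 2 + s ^+ 2 = 1 ->
  frame c s x (frame_t c s x q) (frame_u c s x q) = q.
Proof.
move=> cs; case: q => q1 q2; rewrite /frame /frame_t /frame_u/=; congr pair.
  rewrite (_ : _ + _ = x.1 + (c ^+ 2 + s ^+ 2) * (q1 - x.1)); last by ring.
  by rewrite cs; ring.
rewrite (_ : _ + _ = x.2 + (c ^+ 2 + s ^+ 2) * (q2 - x.2)); last by ring.
by rewrite cs; ring.
Qed.

Lemma frame_rot (c s : R) (x : pt) t u : c ^+ 2 + s ^+ 2 = 1 ->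
  frame c s x t u = rot c s (frame_t c s (0, 0) x + t, frame_u c s (0, 0) x + u).
Proof.
move=> cs; rewrite /frame /rot /frame_t /frame_u /=; congr pair.
  rewrite [RHS](_ : _ = (c ^+ 2 + s ^+ 2) * x.1 + (c * t - s * u)); last by ring.
  by rewrite cs mul1r.
rewrite [RHS](_ : _ = (c ^+ 2 + s ^+ 2) * x.2 + (s * t + c * u)); last by ring.
by rewrite cs mul1r.
Qed.

Lemma csD_le (c s a b : R) : c ^+ 2 + s ^+ 2 = 1 -> `|c * a + s * b| <= `|a| + `|b|.
Proof.
move=> /le1_cs[c1 s1]; apply: le_trans (ler_normD _ _) _.
by rewrite !normrM; apply: lerD; rewrite ler_piMl.
Qed.

Lemma frame_csquare (c s : R) (x : pt) t u : c ^+ 2 + s ^+ 2 = 1 ->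
  csquare x (`|t| + `|u|) (frame c s x t u).
Proof.
move=> cs; split; rewrite /= [_ + _ - _]addrC addKr.
  by rewrite -mulrN -(normrN u); apply: csD_le.
by rewrite addrC [leRHS]addrC; apply: csD_le.
Qed.

Lemma frame_tu_le (c s d : R) (x q : pt) : c ^+ 2 + s ^+ 2 = 1 -> csquare x d q ->
  `|frame_t c s x q| <= 2 * d /\ `|frame_u c s x q| <= 2 * d.
Proof.
move=> cs [/= q1 q2]; split.
  by apply: le_trans (csD_le _ _ cs) _; lra.
have cs' : (- s) ^+ 2 + c ^+ 2 = 1 by rewrite sqrrN addrC.
by apply: le_trans (csD_le _ _ cs') _; lra.
Qed.

Lemma continuous_frame_t (c s : R) (x : pt) : continuous (frame_t c s x : pt -> R).
Proof.
move=> q; apply: cvgD; apply: cvgM; try exact: cvg_cst.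
  by apply: cvgB; [exact: cvg_fst|exact: cvg_cst].
by apply: cvgB; [exact: cvg_snd|exact: cvg_cst].
Qed.

Lemma continuous_frame_u (c s : R) (x : pt) : continuous (frame_u c s x : pt -> R).
Proof. exact: continuous_frame_t. Qed.

(** One notion for two uses: with the zero matrix it is [h] and serves the images of null sets, with
    a matrix close to [Dh] it serves the fibers. *)
Definition lindev (h : pt -> pt) (a11 a12 a21 a22 : R) (q : pt) : pt :=
  ((h q).1 - (a11 * q.1 + a12 * q.2), (h q).2 - (a21 * q.1 + a22 * q.2)).

Lemma lindev0 h q : lindev h 0 0 0 0 q = h q.
Proof. by rewrite /lindev !mul0r addr0 !subr0 -surjective_pairing. Qed.

Lemma within_continuous_closure (X : set pt) (h : pt -> pt) :
  {within closure X, continuous h} ->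
  continuous_closure X (fun x => (h x).1) /\ continuous_closure X (fun x => (h x).2).
Proof.
move=> /subspace_continuousP ch.
have H z e : closure X z -> 0 < e -> exists2 d, 0 < d &
    forall q, closure X q -> csquare z d q -> osquare (h z) e (h q).
  move=> Xz e0; have : nbhs (h z) (osquare (h z) e) by apply/nbhs_osquare; exists e.
  move=> /(ch z Xz); rewrite /within/= => /nbhs_osquare[d d0 Hd].
  exists (d / 2); first by rewrite divr_gt0.
  by move=> q Xq [q1 q2]; apply: Hd => //; split; lra.
split=> z Xz e e0; have [d d0 Hd] := H z e Xz e0; exists d => // q Xq zq;
  by have [] := Hd q Xq zq.
Qed.

Lemma leb2_closure_gt0 (X : set pt) (x : pt) (r : R) : open X -> closure X x -> 0 < r ->
  (0 < lam2 (csquare x r `&` X))%E.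
Proof.
move=> oX Xx r0.
have /Xx[z [Xz zr]] : nbhs x (osquare x r) by apply/nbhs_osquare; exists r.
have oU : open (osquare x r `&` X) by apply: openI => //; exact: open_osquare.
have [e e0 He] := open_csquare oU (conj zr Xz).
have : (lam2 (csquare z e) <= lam2 (csquare x r `&` X))%E.
  apply: le_measure; rewrite ?inE; first exact: measurable_csquare.
    by apply: measurableI; [exact: measurable_csquare|exact: open_measurable2].
  by move=> q /He[[? ?] ?]; split => //; split; exact: ltW.
by apply: lt_le_trans; rewrite leb2_csquare ?ltW// lte_fin mulr_gt0// exprn_gt0.
Qed.

Variables (X : set pt) (h : pt -> pt) (g11 g12 g21 g22 : pt -> R).
Hypotheses (oX : open X) (bX : bounded_plane X).
Hypotheses (h1L : L2 X (fun x => (h x).1)) (h2L : L2 X (fun x => (h x).2)).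
Hypotheses (L11 : L2 X g11) (L12 : L2 X g12) (L21 : L2 X g21) (L22 : L2 X g22).
Hypotheses (w11 : weak_deriv X (fun x => (h x).1) (e1 R) g11)
  (w12 : weak_deriv X (fun x => (h x).1) (e2 R) g12)
  (w21 : weak_deriv X (fun x => (h x).2) (e1 R) g21)
  (w22 : weak_deriv X (fun x => (h x).2) (e2 R) g22).
Hypotheses (ch1 : continuous_closure X (fun x => (h x).1))
  (ch2 : continuous_closure X (fun x => (h x).2)).

(** The sum of the entries of [Dh - A] in absolute value. As [|c|] and [|s|] are at most 1, it
    dominates [dirdev] for both components of [h] and every rotation. *)
Definition graddev (a11 a12 a21 a22 : R) : pt -> R :=
  (fun z => `|g11 z - a11| + `|g12 z - a12| + `|g21 z - a21| + `|g22 z - a22|) \_ X.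

Lemma graddev_ge0 a11 a12 a21 a22 z : 0 <= graddev a11 a12 a21 a22 z.
Proof. by rewrite /graddev patchE; case: ifP => // _; rewrite !addr_ge0. Qed.

Let mX : measurable X. Proof. exact: open_measurable2. Qed.

Lemma measurable_graddev a11 a12 a21 a22 :
  measurable_fun setT (graddev a11 a12 a21 a22).
Proof.
apply/(measurable_restrictT _ mX).
have m g a : L2 X g -> measurable_fun X (fun z => `|g z - a|).
  by move=> [mg _]; apply: measurableT_comp => //; exact: measurable_funB.
by do ?apply: measurable_funD; exact: m.
Qed.

Lemma dirdev_le (c s : R) a11 a12 a21 a22 z : c ^+ 2 + s ^+ 2 = 1 ->
  dirdev X g11 g12 c s (c * a11 + s * a12) z <= graddev a11 a12 a21 a22 (rot c s z) /\
  dirdev X g21 g22 c s (c * a21 + s * a22) z <= graddev a11 a12 a21 a22 (rot c s z).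
Proof.
move=> cs.
have [c1 s1] := le1_cs cs.
have H (x y a b : R) : `|c * x + s * y - (c * a + s * b)| <= `|x - a| + `|y - b|.
  rewrite (_ : _ - _ = c * (x - a) + s * (y - b)); last by ring.
  apply: le_trans (ler_normD _ _) _; rewrite !normrM.
  by apply: lerD; rewrite ler_piMl.
rewrite /dirdev /graddev !patchE; case: ifP => // _; split.
  by apply: le_trans (H _ _ _ _) _; rewrite -addrA lerDl addr_ge0.
by apply: le_trans (H _ _ _ _) _; rewrite -[leRHS]addrA lerDr addr_ge0.
Qed.

(** By Tonelli some line in the strip carries at most [B] of the total deviation. The integral over
    that line bounds the one over each of its segments, so a single line serves all [a], [b] and
    both components. *)
Lemma good_line (D : set pt) (c s a11 a12 a21 a22 a0 b0 p q I B : R) :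
  c ^+ 2 + s ^+ 2 = 1 -> p < q -> measurable D ->
  (forall x y, a0 <= x <= b0 -> p <= y <= q -> D (rot c s (x, y))) ->
  (\int[lam2]_(z in D) (graddev a11 a12 a21 a22 z)%:E <= I%:E)%E ->
  I < B * (q - p) ->
  exists2 y, p < y < q & forall a b, a0 <= a -> a < b -> b <= b0 ->
    closure X (rot c s (a, y)) -> closure X (rot c s (b, y)) ->
    (forall x, a < x < b -> X (rot c s (x, y))) ->
    `|(h (rot c s (b, y))).1 - (h (rot c s (a, y))).1 - (c * a11 + s * a12) * (b - a)| <= B /\
    `|(h (rot c s (b, y))).2 - (h (rot c s (a, y))).2 - (c * a21 + s * a22) * (b - a)| <= B.
Proof.
move=> cs pq mD QD DI IB.
pose w z := graddev a11 a12 a21 a22 (rot c s z).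
have mw : measurable_fun setT w.
  by apply: measurableT_comp; [exact: measurable_graddev|exact: measurable_rot].
have w0 z : 0 <= w z by exact: graddev_ge0.
pose Q : set pt := `[a0, b0] `*` `]p, q[.
have mQ : measurable Q by exact: measurableX.
pose f : pt -> \bar R := (EFin \o w) \_ Q.
have mf : measurable_fun setT f.
  by apply/(measurable_restrictT _ mQ)/measurable_EFinP; exact: measurable_funTS.
have f0 z : (0 <= f z)%E by rewrite /f patchE; case: ifP => //= _; rewrite lee_fin.
pose V y := (\int[mu]_x f (x, y))%E.
have mV : measurable_fun setT V by exact: measurable_tonelli_y.
have V0 y : (0 <= V y)%E by apply: integral_ge0.
have VI : (\int[mu]_(y in `]p, q[) V y <= I%:E)%E.
  apply: le_trans DI.
  apply: (@le_trans _ _ (\int[mu]_y V y)%E).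
    by apply: ge0_subset_integral.
  rewrite /V -leb2_tonelli_y// /f -integral_mkcond.
  rewrite -(ge0_integral_preserves (preserves_leb2_rot cs) mD); last 2 first.
  - by apply/measurable_EFinP; apply: measurable_funTS; exact: measurable_graddev.
  - by move=> z _; rewrite lee_fin graddev_ge0.
  apply: ge0_subset_integral => //.
  - rewrite -[X in measurable X]setTI; exact: measurable_rot.
  - by apply/measurable_EFinP; exact: measurable_funTS.
  - by move=> z _; rewrite lee_fin.
  - move=> [x y] [/=]; rewrite !in_itv/= => xab /andP[py yq].
    by apply: QD => //; rewrite !ltW.
have l1 := @weak_deriv_line R X _ _ _ c s (c * a11 + s * a12) oX bX h1L L11 L12 w11 w12 cs ch1.
have l2 := @weak_deriv_line R X _ _ _ c s (c * a21 + s * a22) oX bX h2L L21 L22 w21 w22 cs ch2.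
have [y [ypq [Hy1 Hy2] VB]] := select_line pq mV V0 (ae_and l1 l2) VI IB.
exists y => // a b aa ab bb Xa Xb Xab.
have bd (dv : pt -> R) : measurable_fun setT dv ->
    (forall z, 0 <= dv z) -> (forall z, dv z <= w z) ->
    (\int[mu]_(x in `]a, b[) (dv (x, y))%:E <= B%:E)%E.
  move=> mdv dv0 dvw; apply: le_trans VB; rewrite /V integral_mkcond.
  apply: ge0_le_integral => //.
  - by move=> x _; rewrite patchE; case: ifP => //= _; rewrite lee_fin.
  - apply/(measurable_restrictT (fun x => (dv (x, y))%:E) (measurable_itv `]a, b[)).
    apply/measurable_EFinP; apply: measurable_funTS; exact: slice_measurable.
  - have := slice_measurable y (f := fun z => fine (f z)).
    have -> : (fun x => f (x, y)) = EFin \o (fun x => fine (f (x, y))).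
      by apply/funext => x /=; rewrite /f patchE; case: ifP.
    move=> H; apply/measurable_EFinP; apply: H.
    exact: measurableT_comp (fine_measurable measurableT) mf.
  - move=> x _; rewrite patchE; case: ifPn => [|_]; last exact: f0.
    rewrite inE/= in_itv/= => /andP[ax xb]; rewrite /f patchE mem_set ?lee_fin//.
    by split; rewrite /= in_itv//=; apply/andP; split; lra.
split; rewrite -lee_fin.
  apply: le_trans (Hy1 _ _ ab Xa Xb Xab) _; apply: bd.
  - exact: (measurable_dirdev _ _ _ mX L11.1 L12.1).
  - by move=> z; exact: dirdev_ge0.
  - by move=> z; have [] := dirdev_le a11 a12 a21 a22 z cs.
apply: le_trans (Hy2 _ _ ab Xa Xb Xab) _; apply: bd.
- exact: (measurable_dirdev _ _ _ mX L21.1 L22.1).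
- by move=> z; exact: dirdev_ge0.
- by move=> z; have [] := dirdev_le a11 a12 a21 a22 z cs.
Qed.

Lemma frame_line (D : set pt) (x : pt) (c s a11 a12 a21 a22 a0 b0 p q I B : R) :
  c ^+ 2 + s ^+ 2 = 1 -> p < q -> measurable D ->
  (forall t u, a0 <= t <= b0 -> p <= u <= q -> D (frame c s x t u)) ->
  (\int[lam2]_(z in D) (graddev a11 a12 a21 a22 z)%:E <= I%:E)%E ->
  I < B * (q - p) ->
  exists2 u, p < u < q & forall a b, a0 <= a -> a < b -> b <= b0 ->
    closure X (frame c s x a u) -> closure X (frame c s x b u) ->
    (forall t, a < t < b -> X (frame c s x t u)) ->
    csquare (lindev h a11 a12 a21 a22 (frame c s x a u)) B
      (lindev h a11 a12 a21 a22 (frame c s x b u)).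
Proof.
move=> cs pq mD QD DI IB.
set t0 := frame_t c s (0, 0) x; set u0 := frame_u c s (0, 0) x.
have fr t u : frame c s x t u = rot c s (t0 + t, u0 + u) by exact: frame_rot.
have fr' t u : rot c s (t, u) = frame c s x (t - t0) (u - u0) by rewrite fr !subrKC.
have QD' t u : t0 + a0 <= t <= t0 + b0 -> u0 + p <= u <= u0 + q -> D (rot c s (t, u)).
  by move=> ? ?; rewrite fr'; apply: QD; lra.
have pq' : u0 + p < u0 + q by rewrite ltrD2l.
have IB' : I < B * (u0 + q - (u0 + p)) by rewrite opprD addrACA subrr add0r.
have [u upq H] := good_line cs pq' mD QD' DI IB'.
exists (u - u0); first by lra.
move=> a b aa ab bb Xa Xb Xab.
have Xab' t : t0 + a < t < t0 + b -> X (rot c s (t, u)).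
  by move=> ?; rewrite fr'; apply: Xab; lra.
have := H (t0 + a) (t0 + b); rewrite !lerD2l ltrD2l => /(_ aa ab bb).
rewrite -{1 2}(subrKC u0 u) -!fr => /(_ Xa Xb Xab').
rewrite -{1 2 3 4}(subrKC u0 u) -!fr (_ : t0 + b - (t0 + a) = b - a); last by ring.
move=> [H1 H2]; split; rewrite /lindev/=.
  rewrite (_ : _ - _ - _ = (h (frame c s x b (u - u0))).1 -
    (h (frame c s x a (u - u0))).1 - (c * a11 + s * a12) * (b - a))//.
  by rewrite /frame/=; ring.
rewrite (_ : _ - _ - _ = (h (frame c s x b (u - u0))).2 -
  (h (frame c s x a (u - u0))).2 - (c * a21 + s * a22) * (b - a))//.
by rewrite /frame/=; ring.
Qed.

(** A quarter-turn takes the frame [(c, s)] to [(- s, c)] and exchanges the two families of lines,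
    up to a sign. *)
Lemma frame_vline (D : set pt) (x : pt) (c s a11 a12 a21 a22 a0 b0 p q I B : R) :
  c ^+ 2 + s ^+ 2 = 1 -> p < q -> measurable D ->
  (forall t u, p <= t <= q -> a0 <= u <= b0 -> D (frame c s x t u)) ->
  (\int[lam2]_(z in D) (graddev a11 a12 a21 a22 z)%:E <= I%:E)%E ->
  I < B * (q - p) ->
  exists2 t, p < t < q & forall a b, a0 <= a -> a < b -> b <= b0 ->
    closure X (frame c s x t a) -> closure X (frame c s x t b) ->
    (forall u, a < u < b -> X (frame c s x t u)) ->
    csquare (lindev h a11 a12 a21 a22 (frame c s x t a)) B
      (lindev h a11 a12 a21 a22 (frame c s x t b)).
Proof.
move=> cs pq mD QD DI IB.
have cs' : (- s) ^+ 2 + c ^+ 2 = 1 by rewrite sqrrN addrC.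
have fq t u : frame c s x (- u) t = frame (- s) c x t u by congr pair => /=; ring.
have qp : - q < - p by rewrite ltrN2.
have QD' t u : a0 <= t <= b0 -> - q <= u <= - p -> D (frame (- s) c x t u).
  by move=> tab /andP[qu up]; rewrite -fq; apply: QD => //; apply/andP; split; lra.
have IB' : I < B * (- p - - q) by rewrite opprK addrC.
have [u /andP[qu up] H] := frame_line cs' qp mD QD' DI IB'.
exists (- u); first by apply/andP; split; lra.
move=> a b aa ab bb; rewrite !fq => Xa Xb Xab; apply: H => // t tab.
by rewrite -fq; exact: Xab.
Qed.

(* Along the graph of a Lipschitz function: seen from [x] in the rotated frame,
   [X] is closed under moving upwards, contains the top strip, and either
   contains the bottom strip (interior points) or stays away from it. *)
Definition box_shape (c s k d : R) (x : pt) : Prop :=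
  [/\ forall t u u', `|t| <= 2 * d -> `|u| <= 2 * k * d -> `|u'| <= 2 * k * d -> u < u' ->
        closure X (frame c s x t u) -> X (frame c s x t u'),
      forall t u, `|t| <= 2 * d -> k * d <= u <= 2 * k * d -> X (frame c s x t u) &
      (forall t u, `|t| <= 2 * d -> k * d <= - u <= 2 * k * d -> X (frame c s x t u)) \/
      (forall t u, `|t| <= 2 * d -> k * d <= - u <= 2 * k * d ->
         ~ closure X (frame c s x t u))].

Lemma csquare_sym (x y : pt) (d : R) : csquare x d y -> csquare y d x.
Proof. by move=> [? ?]; split; rewrite distrC. Qed.

Lemma csquare_trans (x y z : pt) (d e : R) :
  csquare x d y -> csquare y e z -> csquare x (d + e) z.
Proof.
move=> [/= a1 a2] [/= b1 b2]; split => /=.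
  rewrite -(subrKA y.1) addrC; apply: le_trans (ler_normD _ _) _; exact: lerD.
rewrite -(subrKA y.2) addrC; apply: le_trans (ler_normD _ _) _; exact: lerD.
Qed.

(** One good line in each of the four strips between the box of size [d] and that of size [2 * d].
    Any point of the resulting frame in [closure X] is joined to the corner [(t2, u2)] along at most
    two sides: from the left side up and then along the top, from the bottom along it and then up
    the right side. *)
Lemma box_osc (D : set pt) (x : pt) (c s k d I B : R) :
  c ^+ 2 + s ^+ 2 = 1 -> 0 < d -> 1 <= k -> box_shape c s k d x -> measurable D ->
  (forall t u, `|t| <= 2 * d -> `|u| <= 2 * k * d -> D (frame c s x t u)) ->
  (\int[lam2]_(z in D) (graddev 0 0 0 0 z)%:E <= I%:E)%E -> I < B * d ->
  exists t1 t2 u1 u2, [/\ - (2 * d) < t1 < - d, d < t2 < 2 * d,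
    - (2 * k * d) < u1 < - (k * d), k * d < u2 < 2 * k * d &
    closure X (frame c s x t2 u2) /\
    forall t u, t1 <= t <= t2 -> u1 <= u <= u2 -> closure X (frame c s x t u) ->
      (t <= t1 \/ t2 <= t \/ u <= u1 \/ u2 <= u) ->
      csquare (h (frame c s x t2 u2)) (2 * B) (h (frame c s x t u))].
Proof.
move=> cs d0 k1 [Hup Htop Hbot] mD HD DI IB.
have kd : d <= k * d by rewrite ler_peMl// ltW.
have I0 : 0 <= I.
  by rewrite -lee_fin; apply: le_trans DI; apply: integral_ge0 => z _;
    rewrite lee_fin graddev_ge0.
have B0 : 0 <= B by rewrite -(@pmulr_lge0 _ d)// (le_trans I0)// ltW.
have Bkd : I < B * (2 * k * d - k * d).
  apply: (lt_le_trans IB); apply: ler_wpM2l => //; lra.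
have Bkd' : I < B * (- (k * d) - - (2 * k * d)).
  apply: (lt_le_trans IB); apply: ler_wpM2l => //; lra.
have Bd : I < B * (2 * d - d) by rewrite mulr_natl mulr2n addrK.
have Bd' : I < B * (- d - - (2 * d)) by rewrite opprK addrC mulr_natl mulr2n addrK.
have kd2 : k * d < 2 * k * d by lra.
have kd2' : - (2 * k * d) < - (k * d) by lra.
have d2 : d < 2 * d by lra.
have d2' : - (2 * d) < - d by lra.
have D1 t u : - (2 * d) <= t <= 2 * d -> k * d <= u <= 2 * k * d -> D (frame c s x t u).
  by move=> /andP[? ?] /andP[? ?]; apply: HD; rewrite ler_norml; apply/andP; split; lra.
have D2 t u : - (2 * d) <= t <= 2 * d -> - (2 * k * d) <= u <= - (k * d) ->
    D (frame c s x t u).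
  by move=> /andP[? ?] /andP[? ?]; apply: HD; rewrite ler_norml; apply/andP; split; lra.
have D3 t u : d <= t <= 2 * d -> - (2 * k * d) <= u <= 2 * k * d -> D (frame c s x t u).
  by move=> /andP[? ?] /andP[? ?]; apply: HD; rewrite ler_norml; apply/andP; split; lra.
have D4 t u : - (2 * d) <= t <= - d -> - (2 * k * d) <= u <= 2 * k * d ->
    D (frame c s x t u).
  by move=> /andP[? ?] /andP[? ?]; apply: HD; rewrite ler_norml; apply/andP; split; lra.
have [u2 /andP[u2a u2b] H2] := frame_line cs kd2 mD D1 DI Bkd.
have [u1 /andP[u1a u1b] H1] := frame_line cs kd2' mD D2 DI Bkd'.
have [t2 /andP[t2a t2b] V2] := frame_vline cs d2 mD D3 DI Bd.
have [t1 /andP[t1a t1b] V1] := frame_vline cs d2' mD D4 DI Bd'.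
clear D1 D2 D3 D4.
have nt t : t1 <= t -> t <= t2 -> `|t| <= 2 * d.
  by move=> ? ?; rewrite ler_norml; apply/andP; split; lra.
have nu u : u1 <= u -> u <= u2 -> `|u| <= 2 * k * d.
  by move=> ? ?; rewrite ler_norml; apply/andP; split; lra.
have Xtop t : t1 <= t -> t <= t2 -> X (frame c s x t u2).
  by move=> ? ?; apply: Htop; [exact: nt|rewrite !ltW].
have cX := @subset_closure _ X.
exists t1, t2, u1, u2; split; rewrite ?t1a ?t1b ?t2a ?t2b ?u1a ?u1b ?u2a ?u2b//.
have t12 : t1 < t2 by lra.
have u12 : u1 < u2 by lra.
split; first by apply: cX; apply: Xtop => //; exact: ltW.
have top t : t1 <= t -> t <= t2 -> csquare (h (frame c s x t2 u2)) B (h (frame c s x t u2)).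
  rewrite [t <= t2]le_eqVlt => tt /orP[/eqP ->|tt2]; first exact: csquare_center.
  have := H2 t t2; rewrite !lindev0 => H; apply: csquare_sym; apply: H => //.
  - by lra.
  - exact: ltW.
  - by apply: cX; apply: Xtop => //; exact: ltW.
  - by apply: cX; apply: Xtop => //; exact: ltW.
  - by move=> t' /andP[ta tb]; exact: Xtop (le_trans tt (ltW ta)) (ltW tb).
have vert t u : `|t| <= 2 * d -> u1 <= u -> u <= u2 -> closure X (frame c s x t u) ->
    X (frame c s x t u2) ->
    (forall a b, - (2 * k * d) <= a -> a < b -> b <= 2 * k * d ->
    closure X (frame c s x t a) -> closure X (frame c s x t b) ->
    (forall u, a < u < b -> X (frame c s x t u)) ->
    csquare (lindev h 0 0 0 0 (frame c s x t a)) B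
      (lindev h 0 0 0 0 (frame c s x t b))) ->
    csquare (h (frame c s x t u2)) B (h (frame c s x t u)).
  rewrite [u <= u2]le_eqVlt => tt uu /orP[/eqP -> _ _ _|uu2 Xtu Xtu2 H].
    exact: csquare_center.
  move: (H u u2); rewrite !lindev0 => {}H; apply: csquare_sym; apply: H => //.
  - by lra.
  - exact: ltW.
  - exact: cX.
  - move=> u' /andP[ua ub].
    exact: Hup tt (nu _ uu (ltW uu2)) (nu _ (le_trans uu (ltW ua)) (ltW ub)) ua Xtu.
move=> t u /andP[tt1 tt2] /andP[uu1 uu2] Xtu; have BB : B <= 2 * B by rewrite mulr_natl mulr2n lerDl.
case=> [tle|[tge|[ule|uge]]].
- have tE : t = t1 by apply/eqP; rewrite eq_le tle tt1.
  subst t; rewrite mulr_natl mulr2n; apply: csquare_trans (top t1 _ _) _ => //.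
  by apply: vert => //; [exact: nt|apply: Xtop].
- have tE : t = t2 by apply/eqP; rewrite eq_le tge tt2.
  subst t; apply: (csquare_le BB).
  by apply: vert => //; [exact: nt|apply: Xtop].
- have uE : u = u1 by apply/eqP; rewrite eq_le ule uu1.
  subst u; have ku1 : k * d <= - u1 <= 2 * k * d.
    by apply/andP; split; [rewrite lerNr|rewrite lerNl]; exact: ltW.
  (* At a boundary point the bottom side misses [closure X], so only the interior case remains. *)
  case: Hbot => Hbot; last by case: (Hbot t u1 (nt _ tt1 tt2) ku1 Xtu).
  rewrite mulr_natl mulr2n; apply: (@csquare_trans _ (h (frame c s x t2 u1))).
    apply: vert => //; [by apply: nt => //; exact: ltW| | by apply: Xtop => //; exact: ltW].
    by apply: cX; apply: Hbot => //; apply: nt => //; exact: ltW.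
  move: tt2; rewrite le_eqVlt => /orP[/eqP ->|tt2]; first exact: csquare_center.
  have := H1 t t2; rewrite !lindev0 => H; apply: csquare_sym; apply: H => //.
  - by lra.
  - exact: ltW.
  - by apply: cX; apply: Hbot => //; apply: nt => //; exact: ltW.
  - by move=> t' /andP[ta tb]; exact: Hbot (nt _ (le_trans tt1 (ltW ta)) (ltW tb)) ku1.
- have uE : u = u2 by apply/eqP; rewrite eq_le uge uu2.
  by subst u; apply: (csquare_le BB); exact: top.
Qed.

(** In [monotone_map_osc], [U] is the box bounded by the good lines and [V] the closed complement of
    its interior, so that they overlap in the frame. The constant is 8 from that lemma times 2 from
    [box_osc]. *)
Lemma mono_box_osc (Y D : set pt) (x y0 : pt) (c s k d r I B : R) :
  monotone_map X Y h -> connected Y -> bounded_plane Y -> 0 < r ->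
  csquare y0 (3 * r) `<=` Y ->
  c ^+ 2 + s ^+ 2 = 1 -> 0 < d -> 1 <= k -> box_shape c s k d x -> measurable D ->
  (forall t u, `|t| <= 2 * d -> `|u| <= 2 * k * d -> D (frame c s x t u)) ->
  (forall q, closure X q -> D q -> csquare y0 (2 * r) (h q)) ->
  (\int[lam2]_(z in D) (graddev 0 0 0 0 z)%:E <= I%:E)%E -> I < B * d ->
  exists eta, forall t u, `|t| <= d -> `|u| <= k * d -> closure X (frame c s x t u) ->
    csquare eta (16 * B) (h (frame c s x t u)).
Proof.
move=> mh coY bY r0 y0Y cs d0 k1 bs mD HD hD DI IB.
have [t1 [t2 [u1 [u2 [/andP[t1a t1b] /andP[t2a t2b] /andP[u1a u1b] /andP[u2a u2b]
  [X0 H]]]]]] := box_osc cs d0 k1 bs mD HD DI IB.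
have I0 : 0 <= I.
  by rewrite -lee_fin; apply: le_trans DI; apply: integral_ge0 => z _;
    rewrite lee_fin graddev_ge0.
have B0 : 0 <= B by rewrite -(@pmulr_lge0 _ d)// (le_trans I0)// ltW.
have clt (P : set R) : closed P -> closed [set q : pt | P (frame_t c s x q)].
  by move=> cP; apply: closed_comp => // q _; exact: continuous_frame_t.
have clu (P : set R) : closed P -> closed [set q : pt | P (frame_u c s x q)].
  by move=> cP; apply: closed_comp => // q _; exact: continuous_frame_u.
pose U : set pt := [set q | t1 <= frame_t c s x q] `&` [set q | frame_t c s x q <= t2] `&`
  [set q | u1 <= frame_u c s x q] `&` [set q | frame_u c s x q <= u2].
pose V : set pt := [set q | frame_t c s x q <= t1] `|` [set q | t2 <= frame_t c s x q] `|`
  [set q | frame_u c s x q <= u1] `|` [set q | u2 <= frame_u c s x q].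
have cU : closed U.
  by apply: closedI; [apply: closedI; [apply: closedI|]|];
    rewrite /=; [apply: (clt [set v | t1 <= v])|apply: (clt [set v | v <= t2])
      |apply: (clu [set v | u1 <= v])|apply: (clu [set v | v <= u2])];
    (exact: closed_ge || exact: closed_le).
have cV : closed V.
  by apply: closedU; [apply: closedU; [apply: closedU|]|];
    rewrite /=; [apply: (clt [set v | v <= t1])|apply: (clt [set v | t2 <= v])
      |apply: (clu [set v | v <= u1])|apply: (clu [set v | u2 <= v])];
    (exact: closed_ge || exact: closed_le).
have UD q : U q -> D q.
  move=> [[[/= a1 a2] a3] a4]; rewrite -(frameK x q cs); apply: HD;
    by rewrite ler_norml; apply/andP; split; lra.
exists (h (frame c s x t2 u2)) => t u td ukd Xtu.
have -> : 16 * B = 8 * (2 * B) by ring.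
apply: (monotone_map_osc (U := U) (V := V) mh coY bY r0 y0Y cU cV) => //.
- move=> q _.
  have [|a1] := leP (frame_t c s x q) t1; first by move=> ?; right; left; left; left.
  have [|a2] := leP t2 (frame_t c s x q); first by move=> ?; right; left; left; right.
  have [|a3] := leP (frame_u c s x q) u1; first by move=> ?; right; left; right.
  have [|a4] := leP u2 (frame_u c s x q); first by move=> ?; right; right.
  by left; split; [split; [split|]|]; rewrite /= ltW.
- move=> q Xq [[[/= a1 a2] a3] a4] Vq; rewrite -(frameK x q cs); apply: H.
  + by rewrite a1 a2.
  + by rewrite a3 a4.
  + by rewrite frameK.
  + by case: Vq => [[[]|]|] /= ?; tauto.
- apply: hD => //; apply: HD; rewrite ler_norml; apply/andP; split; lra.
- by move=> q Xq Uq; apply: hD => //; exact: UD.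
- by lra.
- move: td ukd; rewrite !ler_norml => /andP[? ?] /andP[? ?].
  by do 3?[split]; rewrite /= ?frame_tK ?frame_uK//; lra.
Qed.

(** * Energy of squares and images of sets without energy *)

Let mgd a b c d : measurable_fun setT (graddev a b c d).
Proof. exact: measurable_graddev. Qed.

(** The indicator gives positive energy to every square centred in [closure X], so that the
    parameter [t] of [graddev_energy] can be chosen as the root of the energy over the size. *)
Definition energy (z : pt) : R := \1_X z + graddev 0 0 0 0 z ^+ 2.

Lemma energy_ge0 z : 0 <= energy z.
Proof. by rewrite addr_ge0// sqr_ge0. Qed.

Lemma measurable_energy : measurable_fun setT energy.
Proof.
apply: measurable_funD; first exact: measurable_indic.
exact: measurable_funX.
Qed.

Lemma integrable_energy : lam2.-integrable setT (EFin \o energy).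
Proof.
have i1 : lam2.-integrable X (EFin \o cst 1).
  apply/integrableP; split; first by apply/measurable_EFinP; exact: measurable_cst.
  rewrite (_ : (fun x => _) = cst 1%:E); last by apply/funext => x /=; rewrite normr1.
  by rewrite integral_cst// mul1e; exact: bounded_plane_lty.
have i2 g : L2 X g -> lam2.-integrable X (EFin \o (fun z => g z ^+ 2)).
  move=> [mg gfin]; apply/integrableP; split.
    by apply/measurable_EFinP; exact: measurable_funX.
  rewrite (_ : (fun x => _) = (fun x => (g x ^+ 2)%:E))//.
  by apply/funext => x /=; rewrite ger0_norm ?sqr_ge0.
pose f z := 1 + 4 * (g11 z ^+ 2 + g12 z ^+ 2 + g21 z ^+ 2 + g22 z ^+ 2).
have if_ : lam2.-integrable X (EFin \o f).
  have := integrableD mX i1 (integrableZl mX 4 (integrableD mX (integrableD mX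
    (integrableD mX (i2 _ L11) (i2 _ L12)) (i2 _ L21)) (i2 _ L22))).
  by apply: eq_integrable => // z _; rewrite /= /f !EFinD.
have := (@integrable_mkcond _ pt R lam2 X _ mX).1 if_.
apply: le_integrable => //; first by apply/measurable_EFinP; exact: measurable_energy.
move=> z _; rewrite /= ger0_norm ?energy_ge0// patchE /energy /graddev patchE indicE.
case: ifPn => zX /=; last by rewrite expr0n addr0 normr0 lexx.
rewrite lee_fin /f !subr0; apply: le_trans (ler_norm _).
rewrite lerD2l -(@real_normK _ (g11 z)) ?num_real// -(@real_normK _ (g12 z)) ?num_real//.
rewrite -(@real_normK _ (g21 z)) ?num_real// -(@real_normK _ (g22 z)) ?num_real//.
set a := `|g11 z|; set b := `|g12 z|; set c := `|g21 z|; set d := `|g22 z|.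
rewrite -subr_ge0 (_ : _ - _ = (a - b) ^+ 2 + (a - c) ^+ 2 + (a - d) ^+ 2 +
  (b - c) ^+ 2 + (b - d) ^+ 2 + (c - d) ^+ 2); last by ring.
by rewrite !addr_ge0// sqr_ge0.
Qed.

(** Young's inequality in the form [y <= t + y ^+ 2 / t], integrated over [D]. *)
Lemma graddev_energy (D : set pt) (A t M : R) : measurable D -> 0 < t ->
  (lam2 D <= A%:E)%E -> (\int[lam2]_(z in D) (energy z)%:E <= M%:E)%E ->
  (\int[lam2]_(z in D) (graddev 0 0 0 0 z)%:E <= (t * A + t^-1 * M)%:E)%E.
Proof.
move=> mD t0 DA DM.
apply: (@le_trans _ _ (\int[lam2]_(z in D) (t%:E + (t^-1)%:E * (energy z)%:E))%E).
  apply: ge0_le_integral => //.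
  - by move=> z _; rewrite lee_fin graddev_ge0.
  - by apply/measurable_EFinP; exact: measurable_funTS.
  - apply: emeasurable_funD => //; apply: measurable_funeM.
    by apply/measurable_EFinP/measurable_funTS; exact: measurable_energy.
  - move=> z _; rewrite -EFinM -EFinD lee_fin -(ler_pM2l t0) mulrDr mulrA mulfV ?gt_eqF//.
    rewrite mul1r /energy; set y := graddev _ _ _ _ z; rewrite indicE.
    have := sqr_ge0 (t - y); have := sqr_ge0 y; case: (z \in X) => /=; nra.
have me : measurable_fun D (fun z => (energy z)%:E).
  by apply/measurable_EFinP/measurable_funTS; exact: measurable_energy.
have e0 z : D z -> (0 <= (energy z)%:E)%E by rewrite lee_fin energy_ge0.
have t0' : (0 <= (t^-1)%:E :> \bar R)%E by rewrite lee_fin invr_ge0 ltW.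
have t1 : (0 <= t%:E :> \bar R)%E by rewrite lee_fin ltW.
have mte : measurable_fun D (fun z => (t^-1)%:E * (energy z)%:E)%E.
  exact: measurable_funeM.
rewrite (ge0_integralD lam2 mD (fun _ _ => t1) (measurable_cst _)
  (fun z Dz => mule_ge0 t0' (e0 z Dz)) mte).
rewrite integral_cst// (ge0_integralZl lam2 mD me e0 t0').
rewrite EFinD !EFinM; apply: leeD; apply: lee_pmul => //.
exact: integral_ge0.
Qed.

Variable Y : set pt.
Hypotheses (mh : monotone_map X Y h) (coY : connected Y) (bY : bounded_plane Y).

Lemma energy_null_image (E E' : set pt) (y0 : pt) (c s k r : R) :
  0 < r -> csquare y0 (3 * r) `<=` Y -> c ^+ 2 + s ^+ 2 = 1 -> 1 <= k ->
  measurable E' -> (\int[lam2]_(z in E') (energy z)%:E = 0)%E -> E `<=` E' ->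
  E `<=` closure X -> (forall x, E x -> csquare y0 r (h x)) ->
  (forall x, E x -> exists2 d0, 0 < d0 & forall d, 0 < d -> d < d0 ->
    box_shape c s k d x) ->
  lam2.-negligible (h @` E).
Proof.
move=> r0 y0Y cs k1 mE' E'0 EE' EX Er Ebox.
(* The image square found below has half-side [16 * B], which is [192 * (1 + k)] times the root of
   the energy [M]. *)
have [C Ck] : exists C : nat, (192 * (1 + k)) ^+ 2 <= C%:R.
  by exists (Num.bound ((192 * (1 + k)) ^+ 2)); exact: ltW (archi_boundP (sqr_ge0 _)).
apply: (null_image (F := EFin \o energy) (C := C) integrable_energy _ mE' E'0 EE').
  by move=> z; rewrite lee_fin energy_ge0.
move=> x Ex; have [d0 d00 Hd0] := Ebox x Ex.
have [e1 e10 He1] := ch1 (EX x Ex) r0.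
have [e2 e20 He2] := ch2 (EX x Ex) r0.
pose e := Num.min e1 e2.
have e0 : 0 < e by rewrite lt_min e10 e20.
have k4 : 0 < 4 + 4 * k by lra.
exists (Num.min (d0 / 2) (e / (4 + 4 * k))).
  by rewrite lt_min; apply/andP; split; exact: divr_gt0.
move=> del del0; rewrite lt_min => /andP[deld dele].
(* A square of half-side [del] has frame coordinates at most [2 * del], so boxes of size [2 * del]
   are used. Their doubles satisfy [|t| + |u| <= rho]. *)
pose rho := (4 + 4 * k) * del.
have rho0 : 0 < rho by exact: mulr_gt0.
have rhoe : rho < e by rewrite /rho mulrC -ltr_pdivlMr.
pose D := csquare x rho.
have mD : measurable D by exact: measurable_csquare.
have [M M0 DM] : exists2 M, 0 < M & (\int[lam2]_(z in D) (energy z)%:E = M%:E)%E.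
  have Dfin : (\int[lam2]_(z in D) (energy z)%:E \is a fin_num)%E.
    apply: integrable_fin_num => //.
    exact: integrableS measurableT mD (@subsetT _ _) integrable_energy.
  exists (fine (\int[lam2]_(z in D) (energy z)%:E)); last by rewrite fineK.
  rewrite -lte_fin fineK//; apply: lt_le_trans (leb2_closure_gt0 oX (EX x Ex) rho0) _.
  rewrite setIC -integral_indic//; apply: ge0_le_integral => //.
  - by apply/measurable_EFinP; exact: measurable_indic.
  - by apply/measurable_EFinP/measurable_funTS; exact: measurable_energy.
  - by move=> z _; rewrite lee_fin /energy lerDl sqr_ge0.
pose q := Num.sqrt M.
have q0 : 0 < q by rewrite sqrtr_gt0.
have qM : q ^+ 2 = M by rewrite sqr_sqrtr// ltW.
have DI : (\int[lam2]_(z in D) (graddev 0 0 0 0 z)%:E <= (5 * rho * q)%:E)%E.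
  (* With [t = q / rho] the two terms of Young's inequality are [4 * rho * q] and [rho * q]. *)
  have t0 : 0 < q / rho by exact: divr_gt0.
  have := @graddev_energy D (4 * rho ^+ 2) (q / rho) M mD t0.
  rewrite leb2_csquare ?(ltW rho0)// DM !lexx => /(_ isT isT).
  rewrite (_ : _ + _ = 5 * rho * q)// -qM; field.
  by rewrite !gt_eqF.
(* Then [B * (2 * del) = 6 * rho * q], strictly more than the [5 * rho * q] just found. *)
pose B := 3 * (4 + 4 * k) * q.
have IB : 5 * rho * q < B * (2 * del).
  rewrite /B /rho -subr_gt0 (_ : _ - _ = (4 + 4 * k) * del * q); last by ring.
  by rewrite !mulr_gt0.
have HD t u : `|t| <= 2 * (2 * del) -> `|u| <= 2 * k * (2 * del) -> D (frame c s x t u).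
  move=> ht hu; apply: csquare_le (frame_csquare x t u cs); rewrite /rho; lra.
have hD p : closure X p -> D p -> csquare y0 (2 * r) (h p).
  move=> Xp Dp; rewrite mulr_natl mulr2n; apply: csquare_trans (Er x Ex) _.
  have ee1 : e <= e1 by rewrite ge_min lexx.
  have ee2 : e <= e2 by rewrite ge_min lexx orbT.
  split; rewrite ltW//.
    by apply: He1 => //; apply: csquare_le Dp; lra.
  by apply: He2 => //; apply: csquare_le Dp; lra.
have del2 : 0 < 2 * del by rewrite mulr_gt0.
have bs : box_shape c s k (2 * del) x.
  by apply: Hd0 => //; lra.
have [eta Heta] := mono_box_osc mh coY bY r0 y0Y cs del2 k1 bs mD HD hD DI IB.
exists eta, (16 * B); split.
- by rewrite /B !mulr_ge0// ltW.
- move=> x' Ex' xx'; have [tt uu] := frame_tu_le cs xx'.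
  rewrite -(frameK x x' cs); apply: Heta => //.
  + by apply: le_trans uu _; rewrite ler_peMl// ltW.
  + by rewrite frameK//; exact: EX.
- apply: (@le_trans _ _ (C%:R%:E * M%:E)%E).
    rewrite -EFinM lee_fin -qM (_ : _ ^+ 2 = (192 * (1 + k)) ^+ 2 * q ^+ 2).
      by apply: ler_wpM2r => //; exact: sqr_ge0.
    by rewrite /B; ring.
  apply: lee_wpmul2l; rewrite ?lee_fin// -DM; apply: ge0_subset_integral => //.
  + exact: measurable_csquare.
  + by apply/measurable_EFinP/measurable_funTS; exact: measurable_energy.
  + by move=> z _; rewrite lee_fin energy_ge0.
  + apply: csquare_le; rewrite /rho ler_pM2r//; apply: le_trans Ck.
    set t := 192 * (1 + k); have t1 : 1 <= t by rewrite /t; lra.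
    apply: (@le_trans _ _ t); first by rewrite /t; lra.
    by rewrite expr2 ler_peMl//; lra.
Qed.

End frame.

(** * Crossing a grid *)

Section crossings.
Context {R : realType}.
Local Notation pt := (R * R)%type.

Lemma rat_near (x e : R) : 0 < e -> exists q : rat, `|ratr q - x| < e.
Proof.
move=> e0; have [q] : exists q : rat, ratr q \in `](x - e), (x + e)[%R.
  by apply: rat_in_itvoo; lra.
by rewrite in_itv/= => /andP[? ?]; exists q; rewrite ltr_norml; apply/andP; split; lra.
Qed.

(** The matrix stretches the sup norm by a factor at least [C]. *)
Definition expands (a11 a12 a21 a22 C : R) : Prop :=
  forall z1 z2 m, `|a11 * z1 + a12 * z2| <= m -> `|a21 * z1 + a22 * z2| <= m ->
    C * `|z1| <= m /\ C * `|z2| <= m.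

(** By Cramer's rule [g] stretches by at least [J / S], and a rational matrix within [e] of it loses
    at most [e]. Since [J / S = (C + 1) * b] and [e < b], a factor [C * e] remains: the expansion
    beats the tolerance by any prescribed ratio. *)
Lemma expands_ratr (g11 g12 g21 g22 C : R) : 0 < g11 * g22 - g12 * g21 -> 0 < C ->
  exists a11 a12 a21 a22 e : rat, [/\ 0 < ratr e :> R,
    `|g11 - ratr a11| + `|g12 - ratr a12| + `|g21 - ratr a21| + `|g22 - ratr a22| < ratr e &
    expands (ratr a11) (ratr a12) (ratr a21) (ratr a22) (C * ratr e)].
Proof.
move=> J0 C0; set J := g11 * g22 - g12 * g21 in J0.
pose S := `|g11| + `|g12| + `|g21| + `|g22|.
have S0 : 0 <= S by rewrite /S !addr_ge0.
have JS : J <= S * S.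
  apply: le_trans (ler_norm _) _; apply: le_trans (ler_normB _ _) _; rewrite !normrM /S.
  have := normr_ge0 g11; have := normr_ge0 g12; have := normr_ge0 g21.
  have := normr_ge0 g22; nra.
have {}S0 : 0 < S by rewrite lt_neqAle S0 andbT; apply: contraTneq JS => <-; lra.
pose b := J / S / (C + 1).
have b0 : 0 < b by rewrite !divr_gt0//; lra.
have bE : (C + 1) * b * S = J by rewrite /b; field; rewrite !gt_eqF//; lra.
have [e He] := rat_near (b / 2) (divr_gt0 b0 (ltr0n _ 2)).
have [e0 eb] : 0 < ratr e :> R /\ (ratr e : R) < b.
  by move: He; rewrite ltr_norml => /andP[? ?]; split; lra.
have e5 : 0 < ratr e / 5 :> R by exact: divr_gt0.
have [a11 H11] := rat_near g11 e5; have [a12 H12] := rat_near g12 e5.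
have [a21 H21] := rat_near g21 e5; have [a22 H22] := rat_near g22 e5.
move: H11 H12 H21 H22; rewrite ![`|ratr _ - _|]distrC => H11 H12 H21 H22.
exists a11, a12, a21, a22, e; split => //; first by lra.
move=> z1 z2 m Hm1 Hm2.
set al11 := ratr a11 in H11 Hm1 *; set al12 := ratr a12 in H12 Hm1 *.
set al21 := ratr a21 in H21 Hm2 *; set al22 := ratr a22 in H22 Hm2 *.
set ep := ratr e in e0 eb e5 H11 H12 H21 H22 *.
(* Here [n] is the sup norm of [(z1, z2)]. *)
suff H n : `|z1| <= n -> `|z2| <= n -> (`|z1| = n \/ `|z2| = n) -> C * ep * n <= m.
  have [z12|z21] := leP `|z1| `|z2|.
    have Hn : C * ep * `|z2| <= m by apply: H => //; right.
    split=> //; apply: le_trans Hn; apply: ler_wpM2l => //.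
    by rewrite mulr_ge0// ltW.
  have Hn : C * ep * `|z1| <= m by apply: H => //; [exact: ltW|left].
  split=> //; apply: le_trans Hn; apply: ler_wpM2l; last exact: ltW.
  by rewrite mulr_ge0// ltW.
move=> n1 n2 nE.
have n0 : 0 <= n by exact: le_trans n1.
have row (p1 p2 q1 q2 : R) : `|p1 - q1| < ep / 5 -> `|p2 - q2| < ep / 5 ->
    `|q1 * z1 + q2 * z2| <= m -> `|p1 * z1 + p2 * z2| <= m + ep * n.
  move=> Hp1 Hp2 Hq.
  rewrite (_ : _ + _ = (q1 * z1 + q2 * z2) + ((p1 - q1) * z1 + (p2 - q2) * z2)); last by ring.
  apply: le_trans (ler_normD _ _) _; apply: lerD => //.
  apply: le_trans (ler_normD _ _) _; rewrite !normrM.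
  have : `|p1 - q1| * `|z1| <= ep / 5 * n by apply: ler_pM => //; exact: ltW.
  have : `|p2 - q2| * `|z2| <= ep / 5 * n by apply: ler_pM => //; exact: ltW.
  by have := mulr_ge0 (ltW e0) n0; lra.
have R1 := row _ _ _ _ H11 H12 Hm1; have R2 := row _ _ _ _ H21 H22 Hm2.
set W := m + ep * n in R1 R2.
have W0 : 0 <= W by exact: le_trans R1.
have Jz (p1 p2 w1 w2 z : R) : J * z = p1 * w1 - p2 * w2 -> `|w1| <= W -> `|w2| <= W ->
    `|p1| + `|p2| <= S -> J * `|z| <= S * W.
  move=> E W1 W2 pS; rewrite -[J]ger0_norm ?(ltW J0)// -normrM E.
  apply: le_trans (ler_normB _ _) _; rewrite !normrM.
  apply: (@le_trans _ _ ((`|p1| + `|p2|) * W)); last exact: ler_wpM2r.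
  by rewrite mulrDl; apply: lerD; apply: ler_wpM2l.
have Jn : J * n <= S * W.
  case: nE => <-.
    apply: (Jz g22 g12 _ _ _ _ R1 R2); first by rewrite /J; ring.
    by rewrite /S; have := normr_ge0 g11; have := normr_ge0 g21; lra.
  apply: (Jz g11 g21 _ _ _ _ R2 R1); first by rewrite /J; ring.
  by rewrite /S; have := normr_ge0 g12; have := normr_ge0 g22; lra.
have {}Jn : (C + 1) * b * n <= W.
  by rewrite -(ler_pM2l S0); apply: le_trans Jn; rewrite -bE mulrCA mulrA.
have : (C + 1) * ep * n <= (C + 1) * b * n.
  by apply: ler_wpM2r => //; apply: ler_wpM2l; [lra|exact: ltW].
by rewrite /W in Jn; lra.
Qed.

Lemma connected_crossing (K O F : set pt) (x z : pt) : connected K -> open O -> closed F ->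
  O `<=` F -> K x -> O x -> K z -> ~ F z -> exists2 k, K k & F k /\ ~ O k.
Proof.
move=> cK oO cF OF Kx Ox Kz nFz; apply: contrapT => nex.
have KF : K `&` O = K `&` F.
  apply/seteqP; split=> k [Kk kk]; split => //; first exact: OF.
  by apply: contrapT => nO; apply: nex; exists k.
have : K `&` O = K.
  apply: cK; first by exists x.
    by exists O.
  by exists F.
by move=> KO; apply: nFz; move: Kz; rewrite -KO KF => -[].
Qed.

Lemma open_setX (A B : set R) : open A -> open B -> open (A `*` B).
Proof.
move=> oA oB; rewrite -[A `*` B]/(fst @^-1` A `&` snd @^-1` B); apply: openI.
  by apply: open_comp => // z _; exact: cvg_fst.
by apply: open_comp => // z _; exact: cvg_snd.
Qed.

Lemma closed_setX (A B : set R) : closed A -> closed B -> closed (A `*` B).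
Proof.
move=> cA cB; rewrite -[A `*` B]/(fst @^-1` A `&` snd @^-1` B); apply: closedI.
  by apply: closed_comp => // z _; exact: cvg_fst.
by apply: closed_comp => // z _; exact: cvg_snd.
Qed.

Lemma frame_crossing (K : set pt) (x z : pt) (r rho t1 t2 u1 u2 : R) :
  connected K -> K x -> K z -> ~ csquare x r z -> 0 < rho -> rho + r / 8 <= r ->
  - (rho + r / 8) < t1 < - rho -> rho < t2 < rho + r / 8 ->
  - (rho + r / 8) < u1 < - rho -> rho < u2 < rho + r / 8 ->
  exists t u, [/\ K (x.1 + t, x.2 + u), `|t| <= rho + r / 8, `|u| <= rho + r / 8 &
    (rho <= `|u| /\ (u = u1 \/ u = u2)) \/ (rho <= `|t| /\ (t = t1 \/ t = t2))].
Proof.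
move=> cK Kx Kz xz rho0 rhor /andP[t1a t1b] /andP[t2a t2b] /andP[u1a u1b] /andP[u2a u2b].
pose O : set pt := `]x.1 + t1, x.1 + t2[ `*` `]x.2 + u1, x.2 + u2[.
pose F : set pt := `[x.1 + t1, x.1 + t2] `*` `[x.2 + u1, x.2 + u2].
have oO : open O by apply: open_setX; exact: interval_open.
have cF : closed F by apply: closed_setX; exact: interval_closed.
have OF : O `<=` F.
  by move=> q [/=]; rewrite !in_itv/= => /andP[? ?] /andP[? ?]; split;
    rewrite /= in_itv/= !ltW.
have Ox : O x by split; rewrite /= in_itv/=; apply/andP; split; lra.
have nFz : ~ F z.
  move=> [/=]; rewrite !in_itv/= => /andP[? ?] /andP[? ?]; apply: xz.
  by split; rewrite /= ler_norml; apply/andP; split; lra.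
have [k Kk [[/=]]] := connected_crossing cK oO cF OF Kx Ox Kz nFz.
rewrite !in_itv/= => /andP[a1 a2] /andP[b1 b2] nO.
exists (k.1 - x.1), (k.2 - x.2); split.
- by rewrite !subrKC -surjective_pairing.
- by rewrite ler_norml; apply/andP; split; lra.
- by rewrite ler_norml; apply/andP; split; lra.
have [c1|c1] := leP k.1 (x.1 + t1).
  have -> : k.1 - x.1 = t1 by lra.
  by right; split; [rewrite ler0_norm; lra|left].
have [c2|c2] := leP (x.1 + t2) k.1.
  have -> : k.1 - x.1 = t2 by lra.
  by right; split; [rewrite ger0_norm; lra|right].
have [c3|c3] := leP k.2 (x.2 + u1).
  have -> : k.2 - x.2 = u1 by lra.
  by left; split; [rewrite ler0_norm; lra|left].
have [c4|c4] := leP (x.2 + u2) k.2.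
  have -> : k.2 - x.2 = u2 by lra.
  by left; split; [rewrite ger0_norm; lra|right].
by case: nO; split; rewrite /= in_itv/=; apply/andP.
Qed.

(* [K] crosses the boundaries of two concentric boxes bounded by lines along
   which [w] oscillates little, and these lines form a connected grid. *)
Lemma grid_crossing (K : set pt) (w : pt -> pt) (x z : pt) (r B : R) :
  connected K -> K x -> K z -> ~ csquare x r z -> 0 < r -> 0 <= B ->
  (forall p, - r <= p -> p + r / 8 <= r -> exists2 u, p < u < p + r / 8 &
    forall a b, `|a| <= r -> `|b| <= r ->
      csquare (w (x.1 + a, x.2 + u)) B (w (x.1 + b, x.2 + u))) ->
  (forall p, - r <= p -> p + r / 8 <= r -> exists2 t, p < t < p + r / 8 &
    forall a b, `|a| <= r -> `|b| <= r ->
      csquare (w (x.1 + t, x.2 + a)) B (w (x.1 + t, x.2 + b))) ->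
  exists t1 u1 t2 u2, [/\ K (x.1 + t1, x.2 + u1), K (x.1 + t2, x.2 + u2),
    csquare (w (x.1 + t1, x.2 + u1)) (3 * B) (w (x.1 + t2, x.2 + u2)) &
    3 / 8 * r <= `|t2 - t1| \/ 3 / 8 * r <= `|u2 - u1|].
Proof.
move=> cK Kx Kz xz r0 B0 lineH lineV.
have hit rho : 0 < rho -> rho + r / 8 <= r -> exists t u,
    [/\ K (x.1 + t, x.2 + u), `|t| <= rho + r / 8, `|u| <= rho + r / 8 &
    (rho <= `|u| /\ forall a b, `|a| <= r -> `|b| <= r ->
      csquare (w (x.1 + a, x.2 + u)) B (w (x.1 + b, x.2 + u))) \/
    (rho <= `|t| /\ forall a b, `|a| <= r -> `|b| <= r ->
      csquare (w (x.1 + t, x.2 + a)) B (w (x.1 + t, x.2 + b)))].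
  move=> rho0 rhor.
  have p1 : - r <= - (rho + r / 8) by rewrite lerN2.
  have pE : - (rho + r / 8) + r / 8 = - rho by ring.
  have p2 : - (rho + r / 8) + r / 8 <= r by lra.
  have p3 : - r <= rho by lra.
  have [t1] := lineV _ p1 p2; rewrite pE => t1P V1; have [t2 t2P V2] := lineV _ p3 rhor.
  have [u1] := lineH _ p1 p2; rewrite pE => u1P H1; have [u2 u2P H2] := lineH _ p3 rhor.
  have [t [u [Ktu tr ur G]]] := frame_crossing cK Kx Kz xz rho0 rhor t1P t2P u1P u2P.
  exists t, u; split => //.
  case: G => -[le [E|E]]; [left|left|right|right]; split => //; rewrite E; first exact: H1.
  - exact: H2.
  - exact: V1.
  - exact: V2.
(* The inner crossing has coordinates at most [r / 4], the outer one a coordinate at least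
   [5 / 8 * r]; the gap is [3 / 8 * r]. *)
have [t1 [u1 [K1 t1r u1r G1]]] := hit (r / 8) ltac:(lra) ltac:(lra).
have [t2 [u2 [K2 t2r u2r G2]]] := hit (5 / 8 * r) ltac:(lra) ltac:(lra).
(* Crossings on parallel lines are linked by one further transversal line, hence three segments at
   most. *)
have [u0 /andP[u0a u0b] H0] := lineH 0 ltac:(lra) ltac:(lra).
have [t0 /andP[t0a t0b] V0] := lineV 0 ltac:(lra) ltac:(lra).
clear hit lineH lineV.
have n1t : `|t1| <= r by lra.
have n1u : `|u1| <= r by lra.
have n2t : `|t2| <= r by lra.
have n2u : `|u2| <= r by lra.
have n0t : `|t0| <= r by rewrite ger0_norm; lra.
have n0u : `|u0| <= r by rewrite ger0_norm; lra.
exists t1, u1, t2, u2; split => //; last first.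
  case: G2 => -[H _]; [right|left].
    by have := ler_normD (u2 - u1) u1; rewrite subrK; lra.
  by have := ler_normD (t2 - t1) t1; rewrite subrK; lra.
have E3 : 3 * B = B + B + B by ring.
have BB : B + B <= 3 * B by lra.
case: G1 => -[_ G1]; case: G2 => -[_ G2].
- rewrite E3; apply: (csquare_trans (csquare_trans (G1 t1 t0 n1t n0t) (V0 u1 u2 n1u n2u))).
  exact: G2.
- by apply: (csquare_le BB); apply: (csquare_trans (G1 t1 t2 n1t n2t)); exact: G2.
- by apply: (csquare_le BB); apply: (csquare_trans (G1 u1 u2 n1u n2u)); exact: G2.
- rewrite E3; apply: (csquare_trans (csquare_trans (G1 u1 u0 n1u n0u) (H0 t1 t2 n1t n2t))).
  exact: G2.
Qed.

End crossings.

(** * Null images and fibers *)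

Section negligible_images.
Context {R : realType}.
Local Notation pt := (R * R)%type.
Local Notation lam2 := (@leb2 R).

Lemma negligible_countable (T : countType) (P : T -> set pt) :
  (forall i, lam2.-negligible (P i)) -> lam2.-negligible (\bigcup_i P i).
Proof.
move=> nP.
pose F n := if (unpickle n : option T) is Some i then P i else set0.
have : lam2.-negligible (\bigcup_n F n).
  by apply: negligible_bigcup => n; rewrite /F; case: unpickle => [i|];
    [exact: nP|exact: negligible_set0].
by apply: negligibleS => z [i _ Pz]; exists (pickle i) => //; rewrite /F pickleK.
Qed.

Lemma rat_square (x : pt) (e : R) : 0 < e -> exists i : rat * rat * rat,
  csquare (ratr i.1.1, ratr i.1.2) (ratr i.2) x /\
  csquare (ratr i.1.1, ratr i.1.2) (ratr i.2) `<=` csquare x e.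
Proof.
move=> e0; have e4 : 0 < e / 4 by exact: divr_gt0.
have [a Ha] := rat_near x.1 e4; have [b Hb] := rat_near x.2 e4.
have [d Hd] := rat_near (e / 2) e4.
have Hd' : e / 4 <= ratr d <= 3 * (e / 4).
  by move: Hd; rewrite ltr_norml => /andP[? ?]; apply/andP; split; lra.
have /andP[Hd1 Hd2] := Hd'.
exists (a, b, d); split => /=.
  by split; rewrite /= distrC ltW// (lt_le_trans _ Hd1).
by apply: csquare_subset => /=; lra.
Qed.

(** Lindelöf with rational squares: those over which the image is null already cover [S]. *)
Lemma negligible_image_local (H : pt -> pt) (S : set pt) :
  (forall x, S x -> exists2 e, 0 < e & lam2.-negligible (H @` (S `&` csquare x e))) ->
  lam2.-negligible (H @` S).
Proof.
move=> HS.
pose Q (i : rat * rat * rat) := csquare (ratr i.1.1 : R, ratr i.1.2 : R) (ratr i.2).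
pose P i := if `[< lam2.-negligible (H @` (S `&` Q i)) >] then H @` (S `&` Q i) else set0.
have : lam2.-negligible (\bigcup_i P i).
  apply: negligible_countable => i; rewrite /P; case: asboolP => // _.
  exact: negligible_set0.
apply: negligibleS => _ [x Sx <-]; have [e e0 He] := HS x Sx.
have [i [ix ie]] := rat_square x e0.
exists i => //; rewrite /P asboolT; first by exists x.
by apply: negligibleS He => _ [z [Sz /ie xz] <-]; exists z.
Qed.

Lemma frame_t_shift (c s : R) (p x q : pt) :
  frame_t c s p q = frame_t c s p x + frame_t c s x q.
Proof. by rewrite /frame_t; ring. Qed.

Lemma frame_u_shift (c s : R) (p x q : pt) :
  frame_u c s p q = frame_u c s p x + frame_u c s x q.
Proof. by rewrite /frame_u; ring. Qed.

(** Over [|t| <= 2 * d] the graph through a boundary point varies by at most [2 * L * d], less than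
    [k * d] for [k = 2 * L + 2]. So it passes below the top strip and above the bottom strip. One
    chart serves all boundary points near [p]. *)
Lemma lipschitz_chart (X : set pt) (p : pt) : lipschitz_domain X ->
  (closure X `\` X) p -> exists rho c s k d0,
    [/\ 0 < rho, 0 < d0, c ^+ 2 + s ^+ 2 = 1, 1 <= k &
     forall x, (closure X `\` X) x -> csquare p rho x ->
       forall d, 0 < d -> d < d0 -> box_shape X c s k d x].
Proof.
move=> [oX _ _ _ HX] /HX[r [c [s [f [r0 cs [L0 Lf0] Hf]]]]].
pose L := `|L0|.
have L0' : 0 <= L by exact: normr_ge0.
have Lf a b m : `|a - b| <= m -> `|f a - f b| <= L * m.
  move=> abm; apply: le_trans (Lf0 _ _) _.
  apply: (@le_trans _ _ (L * `|a - b|)); first by rewrite ler_wpM2r// ler_norm.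
  exact: ler_wpM2l.
have {}Hf q : osquare p r q -> X q <-> f (frame_t c s p q) < frame_u c s p q.
  by move=> [pq1 pq2]; apply: Hf; split; rewrite /ball/= distrC.
have clX q : osquare p r q -> closure X q -> f (frame_t c s p q) <= frame_u c s p q.
  move=> pq Xq; rewrite leNgt; apply/negP => lt.
  (* A point of [X] within [m] of [q] differs by at most [2 * m] in each frame coordinate; its
     height over the graph then differs by at most [2 * (1 + L) * m], half of the gap. *)
  pose m := (f (frame_t c s p q) - frame_u c s p q) / (4 * (1 + L)).
  have L1 : 0 < 4 * (1 + L) by lra.
  have m0 : 0 < m by rewrite divr_gt0// subr_gt0.
  have mE : 4 * (1 + L) * m = f (frame_t c s p q) - frame_u c s p q.
    by rewrite /m mulrC divfK// gt_eqF.
  have /Xq[q' [Xq' [[pq1 pq2] qq']]] : nbhs q (osquare p r `&` osquare q m).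
    apply: filterI; first exact: open_osquare.
    by apply/nbhs_osquare; exists m.
  have qq : csquare q m q' by case: qq' => ? ?; split; exact: ltW.
  have := (Hf q' (conj pq1 pq2)).1 Xq'.
  have [T U] := frame_tu_le cs qq.
  rewrite (frame_t_shift c s p q q') (frame_u_shift c s p q q').
  set t := frame_t c s p q; set u := frame_u c s p q in mE lt *.
  have := Lf (t + frame_t c s q q') t (2 * m); rewrite addrC addKr addrC => /(_ T).
  move: U; rewrite !ler_norml => /andP[_ U] /andP[Lft _] ft.
  have : 0 < L * m + m + m; last by nra.
  by have := mulr_ge0 L0' (ltW m0); lra.
pose k := 2 * L + 2.
have k0 : 0 < 2 * (2 + 2 * k) by rewrite /k; lra.
exists (r / 2), c, s, k, (r / (2 * (2 + 2 * k))); split => //.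
- exact: divr_gt0.
- exact: divr_gt0.
- by rewrite /k; lra.
move=> x [Xx nXx] px d d0; rewrite ltr_pdivlMr// => dr.
have box t u : `|t| <= 2 * d -> `|u| <= 2 * k * d -> osquare p r (frame c s x t u).
  move=> td ud; have [a1 a2] := csquare_trans px (frame_csquare x t u cs).
  have le : r / 2 + (`|t| + `|u|) < r by lra.
  by split; [exact: le_lt_trans a1 le|exact: le_lt_trans a2 le].
have px' : osquare p r x by case: px => ? ?; split; lra.
have fx : f (frame_t c s p x) = frame_u c s p x.
  apply/eqP; rewrite eq_le clX//= leNgt; apply/negP => lt.
  by apply: nXx; apply/(Hf x px').
have T t u : frame_t c s p (frame c s x t u) = frame_t c s p x + t.
  by rewrite (frame_t_shift c s p x) frame_tK.
have U t u : frame_u c s p (frame c s x t u) = frame_u c s p x + u.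
  by rewrite (frame_u_shift c s p x) frame_uK.
have fd t : `|t| <= 2 * d ->
    `|f (frame_t c s p x + t) - frame_u c s p x| <= L * (2 * d).
  by move=> td; rewrite -fx; apply: Lf; rewrite addrC addKr.
have kd0 : 0 < k * d by rewrite mulr_gt0// /k; lra.
have Ld : L * (2 * d) < k * d by rewrite /k; lra.
split.
- move=> t u u' td ud ud' uu Xtu; apply/(Hf _ (box _ _ td ud')).
  by have := clX _ (box _ _ td ud) Xtu; rewrite !T !U; lra.
- move=> t u td /andP[u1 u2].
  have ud : `|u| <= 2 * k * d by rewrite ler_norml; apply/andP; split; lra.
  apply/(Hf _ (box _ _ td ud)); rewrite T U.
  by move: (fd t td); rewrite ler_norml => /andP[_ ?]; lra.
- right=> t u td /andP[u1 u2] Xtu.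
  have ud : `|u| <= 2 * k * d by rewrite ler_norml; apply/andP; split; lra.
  have := clX _ (box _ _ td ud) Xtu; rewrite T U.
  by move: (fd t td); rewrite ler_norml => /andP[? _]; lra.
Qed.

(** [null_image] for the identity with density [\1_X]: the boundary has no mass, yet a fixed
    proportion of each small square about a boundary point lies in [X]. *)
Lemma lipschitz_boundary_negligible (X : set pt) : lipschitz_domain X ->
  lam2.-negligible (closure X `\` X).
Proof.
move=> lX; have [oX _ _ bX _] := lX; have mX := open_measurable2 oX.
rewrite -[_ `\` _]image_id; apply: negligible_image_local => p Xp.
have [rho [c [s [k [d0 [rho0 d00 cs k1 Hx]]]]]] := lipschitz_chart lX Xp.
exists rho => //.
have [C Ck] : exists C : nat, 2 * k + 4 <= C%:R.
  by exists (Num.bound (2 * k + 4)); rewrite ltW// archi_boundP//; lra.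
have mE' : measurable (closure X `\` X).
  by apply: measurableD => //; apply: closed_measurable2; exact: closed_closure.
have iF : lam2.-integrable setT (EFin \o (\1_X : pt -> R)).
  apply/integrableP; split; first by apply/measurable_EFinP; exact: measurable_indic.
  rewrite (_ : (fun x => _) = (fun x => (\1_X x)%:E)); last first.
    by apply/funext => x /=; rewrite normr_nat.
  by rewrite integral_indic// setIT; exact: bounded_plane_lty.
apply: (null_image (F := EFin \o \1_X) (C := C) iF _ mE').
- by move=> z; rewrite lee_fin.
- by apply: integral0_eq => z [_ nX]; rewrite /= indicE memNset.
- by move=> z [].
move=> x [Xx px]; exists d0 => // d dd0 ddlt; exists x, d; split => //.
- exact: ltW.
- have [_ Htop _] := Hx x Xx px d dd0 ddlt.
  have dk : d <= k * d by rewrite ler_peMl// ltW.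
  (* The middle of the top strip; the square of half-side [d / 4] about it stays in the strip, hence
     in [X]. *)
  pose z := frame c s x 0 (3 / 2 * (k * d)).
  have d4 : 0 <= d / 4 by rewrite divr_ge0// ltW.
  have sub : csquare z (d / 4) `<=` X `&` csquare x (C%:R * d).
    move=> q zq; have [T U] := frame_tu_le cs zq; split.
      rewrite -(frameK x q cs); apply: Htop.
        by rewrite (frame_t_shift c s x z) frame_tK// add0r; lra.
      rewrite (frame_u_shift c s x z) frame_uK//.
      by move: U; rewrite ler_norml => /andP[? ?]; apply/andP; split; lra.
    have := csquare_trans (frame_csquare x 0 (3 / 2 * (k * d)) cs) zq.
    apply: csquare_le; rewrite normr0 add0r ger0_norm; last by rewrite mulr_ge0//; lra.
    apply: (@le_trans _ _ ((2 * k + 4) * d)); last by rewrite ler_pM2r.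
    by rewrite (_ : (_ + _) * d = 2 * (k * d) + 4 * d); [lra|ring].
  apply: (@le_trans _ _ (4%:E * lam2 (csquare z (d / 4)))%E).
    rewrite leb2_csquare// -EFinM lee_fin le_eqVlt; apply/orP; left; apply/eqP.
    by field.
  apply: lee_pmul => //; first by rewrite lee_fin; lra.
  rewrite integral_indic//; last exact: measurable_csquare.
  apply: le_measure => //; rewrite inE; first exact: measurable_csquare.
  by apply: measurableI => //; exact: measurable_csquare.
Qed.

(** * Images of null sets and of the boundary under the map *)

Variables (X : set pt) (h : pt -> pt) (g11 g12 g21 g22 : pt -> R).
Hypothesis lX : lipschitz_domain X.
Hypotheses (h1L : L2 X (fun x => (h x).1)) (h2L : L2 X (fun x => (h x).2)).
Hypotheses (L11 : L2 X g11) (L12 : L2 X g12) (L21 : L2 X g21) (L22 : L2 X g22).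
Hypotheses (w11 : weak_deriv X (fun x => (h x).1) (e1 R) g11)
  (w12 : weak_deriv X (fun x => (h x).1) (e2 R) g12)
  (w21 : weak_deriv X (fun x => (h x).2) (e1 R) g21)
  (w22 : weak_deriv X (fun x => (h x).2) (e2 R) g22).
Variable Y : set pt.
Hypotheses (mh : monotone_map X Y h) (oY : open Y) (coY : connected Y)
  (bY : bounded_plane Y).

Let oX : open X. Proof. by case: lX. Qed.
Let bX : bounded_plane X. Proof. by case: lX. Qed.
Let ch1 : continuous_closure X (fun x => (h x).1).
Proof. by case: mh => /within_continuous_closure[]. Qed.
Let ch2 : continuous_closure X (fun x => (h x).2).
Proof. by case: mh => /within_continuous_closure[]. Qed.
Let en := energy X g11 g12 g21 g22.

(** Only points with value in the open set [Y] are kept, because the oscillation estimate needs a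
    square about [h x] inside [Y]; the other values lie on the boundary of [Y]. *)
Lemma image_local_box (S : set pt) (E' : set pt) : S `<=` closure X ->
  measurable E' -> (\int[lam2]_(z in E') (en z)%:E = 0)%E -> S `<=` E' ->
  (forall p, S p -> exists rho c s k, [/\ 0 < rho, c ^+ 2 + s ^+ 2 = 1, 1 <= k &
    forall x, S x -> csquare p rho x -> exists2 d0, 0 < d0 &
      forall d, 0 < d -> d < d0 -> box_shape X c s k d x]) ->
  lam2.-negligible (h @` (S `&` h @^-1` Y)).
Proof.
move=> SX mE' F0 SE' Hbox; apply: negligible_image_local => x [Sx /= Yhx].
have [rho [c [s [k [rho0 cs k1 H]]]]] := Hbox x Sx.
have [e e0 He] := open_csquare oY Yhx.
have e3 : 0 < e / 3 by exact: divr_gt0.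
have [m1 m10 Hm1] := ch1 (SX x Sx) e3.
have [m2 m20 Hm2] := ch2 (SX x Sx) e3.
pose m := Num.min rho (Num.min m1 m2).
have m_rho : m <= rho by rewrite ge_min lexx.
have m_1 : m <= m1 by rewrite !ge_min lexx orbT.
have m_2 : m <= m2 by rewrite !ge_min lexx !orbT.
exists m; first by rewrite !lt_min rho0 m10.
apply: (energy_null_image oX bX h1L h2L L11 L12 L21 L22 w11 w12 w21 w22 ch1 ch2
  mh coY bY e3 _ cs k1 mE' F0 (y0 := h x)).
- by rewrite mulrC divfK.
- by move=> z [[/SE' ? _] _].
- by move=> z [[/SX ? _] _].
- move=> z [[Sz _] xz]; split; rewrite ltW//.
    by apply: Hm1; [exact: SX|exact: csquare_le xz].
  by apply: Hm2; [exact: SX|exact: csquare_le xz].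
- by move=> z [[Sz _] xz]; apply: H => //; exact: csquare_le xz.
Qed.

Lemma negligible_image_interior (N : set pt) : N `<=` X -> lam2.-negligible N ->
  lam2.-negligible (h @` (N `&` h @^-1` Y)).
Proof.
move=> NX [N' [mN' N'0 NN']].
apply: (image_local_box _ mN' _ NN').
- by move=> z /NX; exact: subset_closure.
- apply: null_set_integral => //; apply/measurable_EFinP/measurable_funTS.
  by apply: measurable_energy L11 L12 L21 L22.
(* At interior points the unrotated frame with [k = 1] will do: small boxes lie entirely in [X]. *)
move=> p Np; exists 1, 1, 0, 1; split => //; first by rewrite expr1n expr0n addr0.
move=> x Nx _; have [e e0 He] := open_csquare oX (NX x Nx).
exists (e / 4); first exact: divr_gt0.
move=> d d0 de; have cs : (1 : R) ^+ 2 + 0 ^+ 2 = 1 by rewrite expr1n expr0n addr0.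
have HX t u : `|t| <= 2 * d -> `|u| <= 2 * 1 * d -> X (frame 1 0 x t u).
  by move=> td ud; apply: He; apply: csquare_le (frame_csquare x t u cs); lra.
split.
- by move=> t u u' td _ ud' _ _; exact: HX.
- by move=> t u td /andP[? ?]; apply: HX => //; rewrite ler_norml; apply/andP; split; lra.
- by left=> t u td /andP[? ?]; apply: HX => //; rewrite ler_norml; apply/andP; split; lra.
Qed.

Lemma negligible_image_boundary :
  lam2.-negligible (h @` ((closure X `\` X) `&` h @^-1` Y)).
Proof.
have S1 : closure X `\` X `<=` closure X by move=> z [].
have mE' : measurable (closure X `\` X).
  apply: measurableD; last exact: open_measurable2.
  by apply: closed_measurable2; exact: closed_closure.
have F0 : (\int[lam2]_(z in closure X `\` X) (en z)%:E = 0)%E.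
  apply: integral0_eq => z [_ nX].
  by rewrite /en /energy /graddev patchE indicE memNset//= expr0n addr0.
apply: (image_local_box S1 mE' F0 (fun _ h => h)).
move=> p Xp; have [rho [c [s [k [d0 [rho0 d00 cs k1 Hx]]]]]] := lipschitz_chart lX Xp.
by exists rho, c, s, k; split => // x Xx px; exists d0 => //; exact: Hx.
Qed.

(** * Almost every point is alone in its fiber *)

Let gd := graddev X g11 g12 g21 g22.
Let mX : measurable X. Proof. exact: open_measurable2. Qed.
Let mgd a b c d : measurable_fun setT (gd a b c d).
Proof. exact: measurable_graddev. Qed.

Lemma integrable_graddev a11 a12 a21 a22 :
  lam2.-integrable setT (EFin \o gd a11 a12 a21 a22).
Proof.
have i1 g a : L2 X g -> lam2.-integrable X (fun z => `|(g z - a)%:E|)%E.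
  move=> gL; apply: integrable_abse.
  have ic : lam2.-integrable X (EFin \o cst a).
    apply/integrableP; split; first by apply/measurable_EFinP; exact: measurable_cst.
    rewrite (_ : (fun x => _) = cst `|a|%:E)//.
    rewrite integral_cst//; apply: lte_mul_pinfty => //.
    exact: bounded_plane_lty.
  by have := integrableB mX (L2_integrable oX bX gL) ic; apply: eq_integrable.
have if_ := integrableD mX (integrableD mX (integrableD mX (i1 _ a11 L11) (i1 _ a12 L12))
  (i1 _ a21 L21)) (i1 _ a22 L22).
have := (@integrable_mkcond _ pt R lam2 X _ mX).1 if_.
by apply: eq_integrable => // z _; rewrite /gd /graddev /= !patchE; case: ifP.
Qed.

(** Let [A] be the set where the deviation is below [e]. In a square of half-side [r] it contributes
    at most [4 * e * r ^+ 2], so at a bad point the part [F] carried by the complement of [A] has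
    mass above [e * r ^+ 2] in all small squares. As [F] has no mass on [A], [null_image] for the
    identity applies. *)
Lemma deviation_negligible (a11 a12 a21 a22 e : R) : 0 < e ->
  lam2.-negligible [set x | (X x /\ gd a11 a12 a21 a22 x < e) /\
    exists2 d0, 0 < d0 & forall r, 0 < r -> r < d0 ->
      ((5 * e * r ^+ 2)%:E < \int[lam2]_(z in csquare x r) (gd a11 a12 a21 a22 z)%:E)%E].
Proof.
move=> e0; set g := gd a11 a12 a21 a22.
pose A : set pt := X `&` [set x | g x < e].
have mA : measurable A.
  apply: measurableI => //; rewrite -[X in measurable X]setTI.
  rewrite (_ : [set x | g x < e] = g @^-1` `]-oo, e[); first exact: mgd.
  by apply/funext => x /=; rewrite in_itv.
have mAc : measurable (~` A) by exact: measurableC.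
pose F : pt -> \bar R := (EFin \o g) \_ (~` A).
have g0 z : 0 <= g z by exact: graddev_ge0.
have F0 z : (0 <= F z)%E by rewrite /F patchE; case: ifP => //= _; rewrite lee_fin.
have iF : lam2.-integrable setT F.
  apply: ((@integrable_mkcond _ pt R lam2 (~` A) _ mAc).1 _).
  exact: integrableS measurableT mAc (@subsetT _ _) (integrable_graddev _ _ _ _).
(* With [r = C * d], the bound [C * e >= 1] turns mass above [e * r ^+ 2] into [r ^+ 2 <= C * mass],
   and [C >= 1] gives [d <= r]. *)
have [C Ce] : exists C : nat, 1 + 1 / e <= C%:R.
  exists (Num.bound (1 + 1 / e)); rewrite ltW// archi_boundP// addr_ge0// divr_ge0//.
  exact: ltW.
have ie0 : 0 < 1 / e by exact: divr_gt0.
have C1 : 1 <= C%:R :> R by lra.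
have C0 : 0 < C%:R :> R by lra.
have Ce1 : 1 <= C%:R * e by rewrite -ler_pdivrMr//; lra.
rewrite -[X in _.-negligible X]image_id; apply: (null_image (C := C) iF F0 mA).
- by apply: integral0_eq => z Az; rewrite /F patchE memNset//= => nA; exact: nA.
- by move=> x [].
move=> x [_ [d0 d00 H]]; exists (d0 / C%:R); first exact: divr_gt0.
move=> d dd0; rewrite ltr_pdivlMr// mulrC => dC; exists x, d; split => //; first exact: ltW.
set r := C%:R * d; have r0 : 0 < r by exact: mulr_gt0.
set D := csquare x r; have mD : measurable D by exact: measurable_csquare.
have mF : measurable_fun D F by apply: measurable_funTS; exact: (measurable_int lam2 iF).
have Ifin : (\int[lam2]_(z in D) F z \is a fin_num)%E.
  by apply: integrable_fin_num => //; exact: integrableS measurableT mD (@subsetT _ _) iF.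
have := H r r0 dC; rewrite -/D => lt.
have le : (\int[lam2]_(z in D) (g z)%:E <= \int[lam2]_(z in D) F z + (4 * e * r ^+ 2)%:E)%E.
  have ee : (0 <= e%:E :> \bar R)%E by rewrite lee_fin ltW.
  apply: (@le_trans _ _ (\int[lam2]_(z in D) (F z + e%:E))%E).
    apply: ge0_le_integral => //.
    - by move=> z _; rewrite lee_fin.
    - by apply/measurable_EFinP; apply: measurable_funTS; exact: mgd.
    - by apply: emeasurable_funD => //; exact: measurable_cst.
    - move=> z _; rewrite /F patchE; case: ifPn => [|/negP]; rewrite inE /=.
        by move=> _; rewrite lee_fin lerDl ltW.
      by move=> /contrapT[_ /= ge]; rewrite add0e lee_fin ltW.
  rewrite (ge0_integralD lam2 mD (fun z _ => F0 z) mF (fun _ _ => ee) (measurable_cst _)).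
  rewrite integral_cst//; apply: leeD2l.
  have : (e%:E * lam2 (csquare x r) <= (4 * e * r ^+ 2)%:E)%E; last exact.
  by rewrite leb2_csquare ?(ltW r0)// -EFinM lee_fin mulrCA mulrA.
have {}lt := lt_le_trans lt le; rewrite -(fineK Ifin) -EFinD lte_fin in lt.
rewrite -(fineK Ifin) -EFinM lee_fin.
set I := fine _ in lt *.
have lt' : e * r ^+ 2 < I by lra.
apply: (@le_trans _ _ (C%:R * (e * r ^+ 2))); last by rewrite ler_pM2l// ltW.
rewrite mulrA -[leLHS]mul1r; apply: ler_pM => //; first exact: sqr_ge0.
by rewrite /r exprMn ler_peMl ?sqr_ge0// expr_ge1// ltW.
Qed.

Lemma connected_fiber (x : pt) : closure X x -> connected (closure X `&` h @^-1` [set h x]).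
Proof.
move=> Xx; have [_ im mono] := mh; have [] // := mono [set h x].
  by move=> _ ->; rewrite -im; exists x.
by split; [exact: compact_set1|exact: connected1|exists (h x)].
Qed.

(** On the fiber [h] is constant, so [h - A] changes there exactly as [- A] does. A second point in
    the fiber forces two crossings far apart at which [h - A] differs little, against the expansion
    of [A]. Arbitrarily small good radii suffice, since the square need only lie in [X] and miss
    [z]. *)
Lemma singleton_fiber (a11 a12 a21 a22 e : R) (x : pt) : 0 < e ->
  expands a11 a12 a21 a22 (400 * e) -> X x ->
  (forall d0, 0 < d0 -> exists r, [/\ 0 < r, r < d0 &
     (\int[lam2]_(z in csquare x r) (gd a11 a12 a21 a22 z)%:E <= (5 * e * r ^+ 2)%:E)%E]) ->
  forall z, closure X z -> h z = h x -> z = x.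
Proof.
move=> e0 ex Xx Hr z Xz hzx; apply: contrapT => zx.
set K := closure X `&` h @^-1` [set h x].
have cK : connected K by apply: connected_fiber; exact: subset_closure.
have [m m0 xz] : exists2 m, 0 < m & ~ csquare x m z.
  have [E1|N1] := eqVneq z.1 x.1.
    have N2 : z.2 != x.2.
      apply/negP => /eqP E2; apply: zx.
      by rewrite (surjective_pairing z) E1 E2 -surjective_pairing.
    exists (`|z.2 - x.2| / 2); first by rewrite divr_gt0// normr_gt0 subr_eq0.
    have n0 : 0 < `|z.2 - x.2| by rewrite normr_gt0 subr_eq0.
    by move=> [_ /=]; lra.
  exists (`|z.1 - x.1| / 2); first by rewrite divr_gt0// normr_gt0 subr_eq0.
  have n0 : 0 < `|z.1 - x.1| by rewrite normr_gt0 subr_eq0.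
  by move=> [/= + _]; lra.
have [m' m'0 Hm'] := open_csquare oX Xx.
have [|r [r0 rm HI]] := Hr (Num.min m m'); first by rewrite lt_min m0 m'0.
move: rm; rewrite lt_min => /andP[rm rm'].
have cs : (1 : R) ^+ 2 + 0 ^+ 2 = 1 by rewrite expr1n expr0n addr0.
pose fr := frame 1 0 x.
have frE t u : fr t u = (x.1 + t, x.2 + u).
  by rewrite /fr /frame; congr pair; ring.
pose D := csquare x r.
have mD : measurable D by exact: measurable_csquare.
have HD t u : `|t| <= r -> `|u| <= r -> D (fr t u).
  by move=> ? ?; rewrite frE; split; rewrite /= [_ + _ - _]addrC addKr.
have DX q : D q -> X q by move=> Dq; apply: Hm'; apply: csquare_le Dq; exact: ltW.
have cX := @subset_closure _ X.
pose w := lindev h a11 a12 a21 a22.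
(* Lines come from strips of width [r / 8], so [B * (r / 8)] has to exceed [5 * e * r ^+ 2]: any
   factor above 40 works. *)
pose B := 41 * e * r.
have B0 : 0 <= B by rewrite /B !mulr_ge0// ltW.
have IB p : 5 * e * r ^+ 2 < B * (p + r / 8 - p).
  rewrite /B -subr_gt0 (_ : _ - _ = e * r ^+ 2 / 8); last by field.
  by rewrite divr_gt0// mulr_gt0// exprn_gt0.
have nr p v : - r <= p -> p + r / 8 <= r -> p <= v <= p + r / 8 -> `|v| <= r.
  by move=> ? ? /andP[? ?]; rewrite ler_norml; apply/andP; split; lra.
have pr p : p < p + r / 8 by rewrite ltrDl divr_gt0.
have lineH p : - r <= p -> p + r / 8 <= r ->
    exists2 u, p < u < p + r / 8 & forall a b, `|a| <= r -> `|b| <= r ->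
      csquare (w (x.1 + a, x.2 + u)) B (w (x.1 + b, x.2 + u)).
  move=> rp pr8.
  have QD t u : - r <= t <= r -> p <= u <= p + r / 8 -> D (fr t u).
    by move=> tr up; apply: HD; [rewrite ler_norml|exact: nr up].
  have [u up H] := frame_line oX bX h1L h2L L11 L12 L21 L22 w11 w12 w21 w22 ch1 ch2
    cs (pr p) mD QD HI (IB p).
  exists u => // a b; rewrite -!frE !ler_norml => /andP[a1 a2] /andP[b1 b2].
  have Du t : - r <= t -> t <= r -> X (fr t u).
    move=> t1 t2; apply: DX; apply: QD; first by rewrite t1.
    by case/andP: up => ? ?; rewrite !ltW.
  have Xa := cX _ (Du a a1 a2); have Xb := cX _ (Du b b1 b2).
  have [ab|ba|->] := ltgtP a b; last exact: csquare_center.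
    apply: H => // t /andP[at_ tb]; apply: Du; first exact: ltW (le_lt_trans a1 at_).
    exact: ltW (lt_le_trans tb b2).
  apply: csquare_sym; apply: H => // t /andP[bt ta]; apply: Du.
    exact: ltW (le_lt_trans b1 bt).
  exact: ltW (lt_le_trans ta a2).
have lineV p : - r <= p -> p + r / 8 <= r ->
    exists2 t, p < t < p + r / 8 & forall a b, `|a| <= r -> `|b| <= r ->
      csquare (w (x.1 + t, x.2 + a)) B (w (x.1 + t, x.2 + b)).
  move=> rp pr8.
  have QD t u : p <= t <= p + r / 8 -> - r <= u <= r -> D (fr t u).
    by move=> tp ur; apply: HD; [exact: nr tp|rewrite ler_norml].
  have [t tp H] := frame_vline oX bX h1L h2L L11 L12 L21 L22 w11 w12 w21 w22 ch1 ch2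
    cs (pr p) mD QD HI (IB p).
  exists t => // a b; rewrite -!frE !ler_norml => /andP[a1 a2] /andP[b1 b2].
  have Dt u : - r <= u -> u <= r -> X (fr t u).
    move=> u1 u2; apply: DX; apply: QD; last by rewrite u1.
    by case/andP: tp => ? ?; rewrite !ltW.
  have Xa := cX _ (Dt a a1 a2); have Xb := cX _ (Dt b b1 b2).
  have [ab|ba|->] := ltgtP a b; last exact: csquare_center.
    apply: H => // u /andP[at_ tb]; apply: Dt; first exact: ltW (le_lt_trans a1 at_).
    exact: ltW (lt_le_trans tb b2).
  apply: csquare_sym; apply: H => // u /andP[bt ta]; apply: Dt.
    exact: ltW (le_lt_trans b1 bt).
  exact: ltW (lt_le_trans ta a2).
have Kx : K x by split => //; exact: cX.
have Kz : K z by split.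
have xrz : ~ csquare x r z by move=> H; apply: xz; apply: csquare_le H; exact: ltW.
have [t1 [u1 [t2 [u2 [[_ /= K1] [_ /= K2] W far]]]]] :=
  grid_crossing cK Kx Kz xrz r0 B0 lineH lineV.
move: W; rewrite /w /lindev K1 K2 => -[/= W1 W2].
have [||E1 E2] := ex (t2 - t1) (u2 - u1) (3 * B).
- rewrite -normrN; apply: le_trans W1; rewrite le_eqVlt; apply/orP; left; apply/eqP.
  by congr `|_|; ring.
- rewrite -normrN; apply: le_trans W2; rewrite le_eqVlt; apply/orP; left; apply/eqP.
  by congr `|_|; ring.
(* Here [400 * 3 / 8 = 150] against [3 * 41 = 123]. *)
have small v : 400 * e * `|v| <= 3 * B -> 3 / 8 * r <= `|v| -> False.
  rewrite /B => H vr.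
  have := ler_wpM2l (ltW e0) vr; have := mulr_gt0 e0 r0; lra.
by case: far; [exact: small E1|exact: small E2].
Qed.

Hypothesis J0 : {ae lam2, forall x, X x -> 0 < g11 x * g22 x - g12 x * g21 x}.

(** Once the bad sets of all rational matrices and tolerances are discarded, each remaining point
    with positive Jacobian has a rational matrix from [expands_ratr] to which [singleton_fiber]
    applies. *)
Lemma ae_singleton_fiber : lam2.-negligible
  [set x | X x /\ exists z, [/\ closure X z, h z = h x & z <> x]].
Proof.
pose bad (a11 a12 a21 a22 e : R) := [set x | (X x /\ gd a11 a12 a21 a22 x < e) /\
  exists2 d0, 0 < d0 & forall r, 0 < r -> r < d0 ->
    ((5 * e * r ^+ 2)%:E < \int[lam2]_(z in csquare x r) (gd a11 a12 a21 a22 z)%:E)%E].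
pose P (i : rat * rat * rat * rat * rat) : set pt := if 0 < ratr i.2 :> R then
  bad (ratr i.1.1.1.1) (ratr i.1.1.1.2) (ratr i.1.1.2) (ratr i.1.2) (ratr i.2) else set0.
have nP : lam2.-negligible (\bigcup_i P i).
  apply: negligible_countable => i; rewrite /P; case: ifPn => i0.
    exact: deviation_negligible.
  exact: negligible_set0.
have := negligibleU J0 nP; apply: negligibleS => x [Xx [z [Xz hzx zx]]].
apply: contrapT => /not_orP[/contrapT Jx nbad].
have C0 : (0 : R) < 400 by [].
have [a11 [a12 [a21 [a22 [e [e0 close ex]]]]]] := expands_ratr (Jx Xx) C0.
apply: zx; apply: (singleton_fiber e0 ex Xx) => // d0 d00; apply: contrapT => nex.
apply: nbad; exists (a11, a12, a21, a22, e) => //; rewrite /P /= e0; split.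
  by split => //; rewrite /gd /graddev patchE mem_set.
exists d0 => // r r0 rd; rewrite ltNge; apply/negP => le; apply: nex.
by exists r.
Qed.

End negligible_images.

(** * Full measure of the singleton fibers in the target and in the domain *)

Theorem theorem1p8 (R : realType) (X Y : set (R * R)) (h : R * R -> R * R) :
  lipschitz_domain X -> finitely_connected X ->
  lipschitz_domain Y -> finitely_connected Y ->
  monotone_map X Y h ->
  sobolev12_pos_jacobian X h ->
  (@leb2 R).-negligible (closure Y `\` Yh X h) /\
  exists Xh : set (R * R),
    [/\ Xh `<=` X, (@leb2 R).-negligible (X `\` Xh) & {in Xh &, injective h}].
Proof.
move=> lX _ lY _ mh [h1L [h2L [g11 [g12 [g21 [g22 [[L11 L12 L21 L22] [w11 w12 w21 w22] J0]]]]]]].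
have [oY coY _ bY _] := lY; have [_ im _] := mh.
pose N := [set x | X x /\ exists z, [/\ closure X z, h z = h x & z <> x]].
have nN : (@leb2 R).-negligible N :=
  ae_singleton_fiber lX h1L h2L L11 L12 L21 L22 w11 w12 w21 w22 mh J0.
have NX : N `<=` X by move=> x [].
have n1 := negligible_image_interior lX h1L h2L L11 L12 L21 L22 w11 w12 w21 w22 mh
  oY coY bY NX nN.
have n2 := negligible_image_boundary lX h1L h2L L11 L12 L21 L22 w11 w12 w21 w22 mh
  oY coY bY.
split.
  have := negligibleU (lipschitz_boundary_negligible lY) (negligibleU n1 n2).
  (* A value in [Y] without boundary preimages has a preimage in [X]; if that preimage is not in
     [N], it is the whole fiber. *)
  apply: negligibleS => y [Yy nYh]; have [YY|nY] := pselect (Y y); last by left.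
  right; move: (Yy); rewrite -im => -[x Xx hxy].
  have [Xx'|nX] := pselect (X x); last by right; exists x => //; split; rewrite /= ?hxy.
  left; exists x => //; split; rewrite /= ?hxy//; split => //; apply: contrapT => nz.
  apply: nYh; split; first by exists x.
  exists x; apply/seteqP; split=> [z [Xz /= hzy]|_ ->]; last by split.
  by apply: contrapT => zx; apply: nz; exists z; split; rewrite ?hxy.
exists (X `\` N); split; first by move=> x [].
  by rewrite setDD; apply: negligibleS nN => x [].
move=> x z; rewrite !inE => -[Xx nNx] [Xz nNz] hxz; apply: contrapT => xz.
by apply: nNz; split => //; exists x; split => //; exact: subset_closure.
Qed.
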